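(* Let $k\ge 0$ be an integer, let $\mu\in M_k$, let $\widehat\mu(k,\lambda)$ be its $k$-th Bochner transform, let $F(z)$ be its Carleman transform, and let $z$ be a non-real complex number. Then $$\frac{i\,k!}{\sqrt{2\pi}}\ \mathrm{V.P.}\int_{-\infty}^{\infty}\frac{\widehat\mu(k,\lambda)}{(\lambda+z)^{k+1}}\,d\lambda=F(z).$$
   Context: A (locally finite) complex Borel measure $\mu$ on $\mathbb{R}$ belongs to the class $M_k$ if the measure $\mu_1$ given by $d\mu_1(x)=\frac{d\mu(x)}{1+|x|^k}$ is a finite complex Borel measure. For $\mu\in M_k$ the $k$-th Bochner transform is $$\widehat\mu(k,t)=\frac{1}{\sqrt{2\pi}}\int_{-\infty}^\infty\frac{e^{-ixt}-P_{k-1}(x,t)}{(-ix)^k}\,d\mu(x),\qquad P_{k-1}(x,t)=\begin{cases}\displaystyle\sum_{m=0}^{k-1}\frac{(-ixt)^m}{m!},&|x|\le 1,\\ 0,&|x|>1,\end{cases}$$ where for $k=0$ the sum is empty (so $\widehat\mu(0,t)$ is the Fourier transform $\frac{1}{\sqrt{2\pi}}\int e^{-ixt}d\mu(x)$) and at $x=0$ the integrand is understood by continuity, i.e. as $t^k/k!$. The Carleman transform $F=(F_+,F_-)$ of $\mu\in M_k$ is $$F(z)=F_+(z)=\int_{[0,\infty)}e^{itz}\,d\mu_0(t)\ \ (\operatorname{Im}z>0),\qquad F(z)=F_-(z)=-\int_{(-\infty,0]}e^{itz}\,d\mu_0(t)\ \ (\operatorname{Im}z<0),$$ where $\mu_0=\mu-\tfrac12\mu(\{0\})\delta$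 and $\delta$ is the Dirac measure at $0$. For non-real $z$, $\mathrm{V.P.}\int_{-\infty}^\infty(\cdot)\,d\lambda=\lim_{N\to\infty}\int_{-N}^{N}(\cdot)\,d\lambda$. *)

(* Defs.v *)
From HB Require Import structures.
From mathcomp Require Import all_boot all_order all_algebra.
From mathcomp Require Import all_classical all_reals all_analysis.
From mathcomp Require Export complex.

Set Implicit Arguments.
Unset Strict Implicit.
Unset Printing Implicit Defensive.

Import Order.TTheory GRing.Theory Num.Theory.
Import numFieldNormedType.Exports.

Local Open Scope classical_set_scope.
Local Open Scope ring_scope.
Local Open Scope complex_scope.

Section ComplexMeasures.
Context {R : realType}.
Implicit Types (mu : set (measurableTypeR R) -> R[i]).

Definition borel : set (set (measurableTypeR R)) :=
  [set A | @measurable _ (measurableTypeR R) A].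

Definition bounded_borel : set (set (measurableTypeR R)) :=
  [set A | borel A /\ bounded_set (A : set R)].

(* Taking every [F n] empty forces [mu set0 = 0]. *)
Definition countably_additive_on (D : set (set (measurableTypeR R))) mu :=
  forall F : nat -> set (measurableTypeR R),
    (forall n, D (F n)) -> trivIset setT F -> D (\bigcup_n F n) ->
    (fun n => \sum_(0 <= i < n) mu (F i)) @ \oo
      --> (mu (\bigcup_n F n) : R[i]^o).

Definition finite_complex_measure mu := countably_additive_on borel mu.

(* A locally finite complex measure need not have a value on unbounded sets;
   the values of [mu] outside [bounded_borel] are irrelevant throughout. *)
Definition locally_finite_complex_measure mu :=
  countably_additive_on bounded_borel mu.

(* Positive part of the Jordan decomposition of a locally finite signed
   measure; the negative part of [s] is [upper_variation (- s)]. *)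
Definition upper_variation (s : set (measurableTypeR R) -> R)
    (A : set (measurableTypeR R)) : \bar R :=
  ereal_sup [set (s B)%:E | B in [set B | bounded_borel B /\ B `<=` A]].

Definition signed_integral (s : set (measurableTypeR R) -> R)
    (D : set (measurableTypeR R)) (f : R -> R) : R :=
  fine (\int[upper_variation s]_(x in D) (f x)%:E)
  - fine (\int[upper_variation (fun A => - s A)]_(x in D) (f x)%:E).

Definition complex_integral mu (D : set (measurableTypeR R)) (f : R -> R[i])
    : R[i] :=
  let mu_re A := complex.Re (mu A) in
  let mu_im A := complex.Im (mu A) in
  let f_re x := complex.Re (f x) in
  let f_im x := complex.Im (f x) in
  (signed_integral mu_re D f_re - signed_integral mu_im D f_im)
  +i* (signed_integral mu_re D f_im + signed_integral mu_im D f_re).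

(* The class M_k: [mu1] is the measure with density 1 / (1 + |x|^k) with
   respect to [mu]. *)
Definition class_M (k : nat) mu :=
  locally_finite_complex_measure mu /\
  exists mu1, finite_complex_measure mu1 /\
    forall A, bounded_borel A ->
      mu1 A = complex_integral mu A (fun x => ((1 + `|x| ^+ k)^-1)%:C).

End ComplexMeasures.

Section Transforms.
Context {R : realType}.
Implicit Types (mu : set (measurableTypeR R) -> R[i]).

Definition cexp (z : R[i]) : R[i] :=
  (expR (complex.Re z))%:C
  * (cos (complex.Im z) +i* sin (complex.Im z)).

Definition bochner_poly (k : nat) (x t : R) : R[i] :=
  if `|x| <= 1 then
    \sum_(0 <= m < k) (- 'i%C * x%:C * t%:C) ^+ m / (m`!)%:R
  else 0.

Definition bochner_kernel (k : nat) (x t : R) : R[i] :=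
  if x == 0 then (t ^+ k / (k`!)%:R)%:C
  else (cexp (- 'i%C * x%:C * t%:C) - bochner_poly k x t) / (- 'i%C * x%:C) ^+ k.

Definition bochner_transform mu (k : nat) (t : R) : R[i] :=
  ((Num.sqrt (2 * pi))^-1)%:C
  * complex_integral mu setT (fun x => bochner_kernel k x t).

Definition half_atom_removed mu (A : set (measurableTypeR R)) : R[i] :=
  mu A - 2^-1 * mu [set 0] * (\1_A (0 : R) : R)%:C.

(* Only meaningful when [Im z != 0]. *)
Definition carleman_transform mu (z : R[i]) : R[i] :=
  let f (t : R) := cexp ('i%C * t%:C * z) in
  if 0 < complex.Im z
  then complex_integral (half_atom_removed mu) `[0, +oo[ f
  else - complex_integral (half_atom_removed mu) `]-oo, 0] f.

Definition lebesgue_cintegral (a b : R) (f : R -> R[i]) : R[i] :=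
  Rintegral lebesgue_measure `[a, b] (fun x => complex.Re (f x))
  +i* Rintegral lebesgue_measure `[a, b] (fun x => complex.Im (f x)).

Definition is_VP_integral (f : R -> R[i]) (I : R[i]) :=
  lebesgue_cintegral (- N) N f @[N --> +oo%R] --> (I : R[i]^o).

End Transforms.

(* Main.v *)
(** Fubini moves the [l]-integral inside the measure, so everything reduces to
    [J_k N x], the integral of [bochner_kernel k x l / (l + z)^(k+1)] over
    [-N <= l <= N].  The [l]-derivative of the Bochner kernel of order [k+1] is the
    one of order [k]; integrating by parts, [(k+1) J_(k+1) - J_k] is a boundary term
    that vanishes as [N] grows, so the limit of [J_k] is that of [J_0] divided by [k!].
    For [Im z > 0], writing [1 / (l + z)] as a Laplace-type integral turns [J_0] into
    a superposition of truncated sine integrals, which are bounded and tend to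
    [(pi / 2) sgn]; hence [J_0] tends to [- 2 i pi] times [exp (i x z)] for [x > 0], half of
    that at [x = 0], and [0] for [x < 0].  The case [Im z < 0] follows by conjugation.
    A bound of order [1 / (1 + |x|^k)] on [J_k], uniform in [N], allows dominated
    convergence against each of the four Jordan components of [mu]; these integrate
    [1 / (1 + |x|^k)] because the finite measure [mu1] is bounded. *)
Require Import Defs.
From HB Require Import structures.
From mathcomp Require Import all_boot all_order all_algebra.
From mathcomp Require Import all_classical all_reals all_analysis.
From mathcomp Require Import measurable_realfun ring lra.

Set Implicit Arguments.
Unset Strict Implicit.
Unset Printing Implicit Defensive.

Import Order.TTheory GRing.Theory Num.Theory.
Import numFieldNormedType.Exports.
Import ComplexField.

Local Open Scope classical_set_scope.
Local Open Scope ring_scope.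
Local Open Scope complex_scope.

(** Absolute convergence is missing for |x| <= 1: there the integrand of [J_k] is only O(1/|l|), so
    its uniform bound is carried up from order 0 by the recursion. For |x| > 1 the recursion would
    give |x|^-k at order k + 1, one power too few; there the bound is taken absolutely, |l +
    z|^(-k-1) being integrable as soon as k >= 1. Hence the split of the estimates at |x| = 1, which
    is also where the Bochner kernel jumps.

    On the measure side, [mu] is controlled only on bounded sets, its Jordan components may have
    infinite mass, and [signed_integral] is written with suprema and [fine]. That the variations are
    measures has to be proved, by gluing Hahn decompositions, and every use of linearity must come
    with integrability, since [fine] sends an infinite integral to 0. Removing the half atom changes
    the Jordan components, so the integral against a signed measure is shown to be computable from
    any representation as a difference of two measures. *)

Notation normc := Normc.normc.

(** * Complex-valued integration *)

Section ComplexAlgebra.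
Context {R : realType}.
Implicit Types (z w : R[i]) (x y : R).

Lemma Re_mulc z w : complex.Re (z * w) =
  complex.Re z * complex.Re w - complex.Im z * complex.Im w.
Proof. by case: z; case: w. Qed.

Lemma Im_mulc z w : complex.Im (z * w) =
  complex.Re z * complex.Im w + complex.Im z * complex.Re w.
Proof. by case: z; case: w. Qed.

Lemma Re_addc z w : complex.Re (z + w) = complex.Re z + complex.Re w.
Proof. by case: z; case: w. Qed.

Lemma Im_addc z w : complex.Im (z + w) = complex.Im z + complex.Im w.
Proof. by case: z; case: w. Qed.

Lemma Re_oppc z : complex.Re (- z) = - complex.Re z.
Proof. by case: z. Qed.

Lemma Im_oppc z : complex.Im (- z) = - complex.Im z.
Proof. by case: z. Qed.

Lemma Re_conjc z : complex.Re (conjc z) = complex.Re z.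
Proof. by case: z. Qed.

Lemma Im_conjc z : complex.Im (conjc z) = - complex.Im z.
Proof. by case: z. Qed.

Lemma Re_invc z : complex.Re z^-1 =
  complex.Re z / (complex.Re z ^+ 2 + complex.Im z ^+ 2).
Proof. by case: z. Qed.

Lemma Im_invc z : complex.Im z^-1 =
  - (complex.Im z / (complex.Re z ^+ 2 + complex.Im z ^+ 2)).
Proof. by case: z => a b /=. Qed.

Lemma complex_ext z w : complex.Re z = complex.Re w ->
  complex.Im z = complex.Im w -> z = w.
Proof. by case: z; case: w => /= ? ? ? ? -> ->. Qed.

Lemma normc_Re z : `|complex.Re z| <= normc z.
Proof.
case: z => a b /=; rewrite -sqrtr_sqr ler_wsqrtr// lerDl sqr_ge0 //.
Qed.

Lemma normc_Im z : `|complex.Im z| <= normc z.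
Proof. by case: z => a b /=; rewrite -sqrtr_sqr ler_wsqrtr// lerDr sqr_ge0. Qed.

Lemma normc_ge0 z : 0 <= normc z.
Proof. by case: z => a b; exact: sqrtr_ge0. Qed.

Lemma normc_le_ReIm z : normc z <= `|complex.Re z| + `|complex.Im z|.
Proof.
case: z => a b /=; rewrite -[leRHS]ger0_norm ?addr_ge0// -sqrtr_sqr ler_wsqrtr//.
rewrite sqrrD !real_normK ?num_real// lerD2r lerDl mulrn_wge0// mulr_ge0//.
Qed.

Lemma normcX z n : normc (z ^+ n) = normc z ^+ n.
Proof.
by elim: n => [|n IH]; [rewrite !expr0 Normc.normc1 | rewrite !exprS Normc.normcM IH].
Qed.

Lemma normc_real x : normc x%:C = `|x|.
Proof. by rewrite /= expr0n/= addr0 sqrtr_sqr. Qed.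

Lemma normc_conjc z : normc (conjc z) = normc z.
Proof. by case: z => a b /=; rewrite sqrrN. Qed.

Lemma normc_i : normc 'i = 1 :> R.
Proof. by rewrite /= expr0n/= add0r expr1n sqrtr1. Qed.

Lemma conjcM z w : conjc (z * w) = conjc z * conjc w. Proof. exact: rmorphM. Qed.

Lemma conjcD z w : conjc (z + w) = conjc z + conjc w. Proof. exact: rmorphD. Qed.

Lemma conjcN z : conjc (- z) = - conjc z. Proof. exact: rmorphN. Qed.

Lemma conjcV z : conjc z^-1 = (conjc z)^-1. Proof. exact: fmorphV. Qed.

Lemma conjc_i : conjc 'i = - 'i :> R[i].
Proof. by apply: complex_ext; rewrite //= oppr0. Qed.

Lemma normr_normc z : `|z| = (normc z)%:C.
Proof. by case: z. Qed.

Lemma complex_neq0 z : complex.Im z != 0 -> z != 0.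
Proof. by apply: contra_neq => ->. Qed.

Lemma real_add_neq0 z x : complex.Im z != 0 -> x%:C + z != 0.
Proof. by move=> z0; apply: complex_neq0; rewrite Im_addc /= add0r. Qed.

End ComplexAlgebra.

Section Cexp.
Context {R : realType}.
Implicit Types (z w : R[i]) (x y : R).

Lemma Re_cexp z : complex.Re (cexp z) = expR (complex.Re z) * cos (complex.Im z).
Proof. by rewrite /cexp Re_mulc/= mul0r subr0. Qed.

Lemma Im_cexp z : complex.Im (cexp z) = expR (complex.Re z) * sin (complex.Im z).
Proof. by rewrite /cexp Im_mulc/= mul0r addr0. Qed.

Lemma cexpD z w : cexp (z + w) = cexp z * cexp w.
Proof.
apply: complex_ext.
  by rewrite Re_cexp [RHS]Re_mulc !Re_cexp !Im_cexp Re_addc Im_addc expRD cosD; ring.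
by rewrite Im_cexp [RHS]Im_mulc !Re_cexp !Im_cexp Re_addc Im_addc expRD sinD; ring.
Qed.

Lemma cexp0 : cexp 0 = 1 :> R[i].
Proof. by apply: complex_ext; rewrite ?Re_cexp ?Im_cexp /= expR0 ?cos0 ?sin0 ?mulr1 ?mulr0. Qed.

Lemma normc_cexp z : normc (cexp z) = expR (complex.Re z).
Proof.
rewrite /cexp Normc.normcM normc_real ger0_norm ?expR_ge0//.
by rewrite /= cos2Dsin2 sqrtr1 mulr1.
Qed.

Lemma conjc_cexp z : conjc (cexp z) = cexp (conjc z).
Proof.
by apply: complex_ext; rewrite ?Re_conjc ?Im_conjc ?Re_cexp ?Im_cexp Re_conjc
  Im_conjc ?cosN ?sinN ?mulrN.
Qed.

End Cexp.

(** * Measurability of complex-valued functions *)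

Section CMeasurable.
Context {R : realType} d (T : measurableType d).
Implicit Types (f g : T -> R[i]) (h : T -> R) (D : set T).

Definition cmeasurable D f :=
  measurable_fun D (fun x => complex.Re (f x)) /\
  measurable_fun D (fun x => complex.Im (f x)).

(** Inversion is continuous only off 0. It is split there: constant on the closed set {0}, where its
    value is the conventional 0, and continuous on the open complement. *)
Lemma measurable_funV D h : measurable D -> measurable_fun D h ->
  measurable_fun D (fun x => (h x)^-1).
Proof.
move=> mD mh.
have mV : measurable_fun [set: R] (@GRing.inv R).
  have -> : @GRing.inv R = fun x => if x == 0 then 0 else x^-1.
    by apply/funext => x; case: eqP => // ->; rewrite invr0.
  have m0 : measurable [set x : R | x != 0].
    have -> : [set x : R | x != 0] = ~` [set 0].
      by apply/seteqP; split=> x /= /eqP.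
    by apply: measurableC.
  apply: measurable_fun_if => //.
    apply: (measurable_fun_bool true).
    rewrite setTI (_ : _ @^-1` _ = [set 0])//.
    by apply/seteqP; split => x /= /eqP.
  rewrite setTI (_ : _ @^-1` _ = [set x | x != 0]); last first.
    by apply/seteqP; split=> x /=; case: eqP.
  apply: open_continuous_measurable_fun.
    have -> : [set x : R | x != 0] = ~` [set 0].
      by apply/seteqP; split=> x /= /eqP.
    by rewrite openC; exact: closed_eq.
  by move=> x; rewrite inE/= => x0; exact: inv_continuous.
exact: (measurableT_comp mV).
Qed.

Lemma cmeasurable_cst D c : cmeasurable D (cst c).
Proof. by split; exact: measurable_cst. Qed.

Lemma cmeasurable_real D h : measurable_fun D h -> cmeasurable D (fun x => (h x)%:C).
Proof. by move=> mh; split => //; exact: measurable_cst. Qed.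

Lemma cmeasurableD D f g : cmeasurable D f -> cmeasurable D g ->
  cmeasurable D (fun x => f x + g x).
Proof.
move=> [mf1 mf2] [mg1 mg2]; split.
  by under eq_fun do rewrite Re_addc; exact: measurable_funD.
by under eq_fun do rewrite Im_addc; exact: measurable_funD.
Qed.

Lemma cmeasurableN D f : cmeasurable D f -> cmeasurable D (fun x => - f x).
Proof.
move=> [mf1 mf2]; split.
  by under eq_fun do rewrite Re_oppc; exact: measurable_funN.
by under eq_fun do rewrite Im_oppc; exact: measurable_funN.
Qed.

Lemma cmeasurableB D f g : cmeasurable D f -> cmeasurable D g ->
  cmeasurable D (fun x => f x - g x).
Proof. by move=> mf mg; apply: cmeasurableD => //; exact: cmeasurableN. Qed.

Lemma cmeasurableM D f g : cmeasurable D f -> cmeasurable D g ->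
  cmeasurable D (fun x => f x * g x).
Proof.
move=> [mf1 mf2] [mg1 mg2]; split.
  under eq_fun do rewrite Re_mulc.
  by apply: measurable_funB; exact: measurable_funM.
under eq_fun do rewrite Im_mulc.
by apply: measurable_funD; exact: measurable_funM.
Qed.

Lemma cmeasurableX D f n : cmeasurable D f -> cmeasurable D (fun x => f x ^+ n).
Proof.
move=> mf; elim: n => [|n IH]; first exact: cmeasurable_cst.
by under eq_fun do rewrite exprS; exact: cmeasurableM.
Qed.

Lemma cmeasurableV D f : measurable D -> cmeasurable D f ->
  cmeasurable D (fun x => (f x)^-1).
Proof.
move=> mD [mf1 mf2].
have mn : measurable_fun D
    (fun x => (complex.Re (f x) ^+ 2 + complex.Im (f x) ^+ 2)^-1).
  apply: measurable_funV => //.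
  by apply: measurable_funD; exact: measurable_funX.
split.
  by under eq_fun do rewrite Re_invc; exact: measurable_funM.
under eq_fun do rewrite Im_invc.
by apply: measurable_funN; exact: measurable_funM.
Qed.

Lemma cmeasurable_sum D (F : nat -> T -> R[i]) n :
  (forall i, cmeasurable D (F i)) ->
  cmeasurable D (fun x => \sum_(0 <= i < n) F i x).
Proof.
move=> mF; elim: n => [|n IH].
  by under eq_fun do rewrite big_nil; exact: cmeasurable_cst.
by under eq_fun do rewrite big_nat_recr//=; exact: cmeasurableD.
Qed.

Lemma cmeasurable_cexp D f : cmeasurable D f -> cmeasurable D (fun x => cexp (f x)).
Proof.
move=> [mf1 mf2].
have me : measurable_fun D (fun x => expR (complex.Re (f x))).
  exact: measurableT_comp.
split.
  under eq_fun do rewrite Re_cexp; apply: measurable_funM => //.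
  by apply: measurableT_comp => //; apply: continuous_measurable_fun; exact: continuous_cos.
under eq_fun do rewrite Im_cexp; apply: measurable_funM => //.
by apply: measurableT_comp => //; apply: continuous_measurable_fun; exact: continuous_sin.
Qed.

Lemma cmeasurable_if D (b : T -> bool) f g : measurable D ->
  measurable_fun D b -> cmeasurable D f -> cmeasurable D g ->
  cmeasurable D (fun x => if b x then f x else g x).
Proof.
move=> mD mb [mf1 mf2] [mg1 mg2].
split.
  rewrite (_ : (fun _ => _) = fun x => if b x then complex.Re (f x) else complex.Re (g x)).
    by apply: measurable_fun_if => //; [exact: measurable_funS mf1|exact: measurable_funS mg1].
  by apply/funext => x; case: ifP.
rewrite (_ : (fun _ => _) = fun x => if b x then complex.Im (f x) else complex.Im (g x)).
  by apply: measurable_fun_if => //; [exact: measurable_funS mf2|exact: measurable_funS mg2].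
by apply/funext => x; case: ifP.
Qed.

Lemma cmeasurableS D E f : measurable E -> D `<=` E -> cmeasurable E f -> cmeasurable D f.
Proof. by move=> mE DE [mf1 mf2]; split; exact: measurable_funS DE _. Qed.

End CMeasurable.

(** * Domination and limits for real-valued integrals *)

Section RealIntegral.
Context {R : realType} d (T : measurableType d) (mu : {measure set T -> \bar R}).
Variables (D : set T) (mD : measurable D).
Implicit Types (f g : T -> R).

Lemma integrable_dom f g : measurable_fun D f ->
  mu.-integrable D (EFin \o g) -> (forall x, D x -> `|f x| <= g x) ->
  mu.-integrable D (EFin \o f).
Proof.
move=> mf ig fg; apply: (le_integrable mD _ _ ig).
  exact/measurable_EFinP.
by move=> x Dx /=; rewrite lee_fin (le_trans (fg _ Dx))// ler_norm.
Qed.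

Lemma normr_Rintegral_le f g : measurable_fun D f ->
  mu.-integrable D (EFin \o g) -> (forall x, D x -> `|f x| <= g x) ->
  `|\int[mu]_(x in D) f x| <= \int[mu]_(x in D) g x.
Proof.
move=> mf ig fg; have jf := integrable_dom mf ig fg.
apply: (le_trans (le_normr_Rintegral mD jf)).
by apply: le_Rintegral => //; exact: integrable_norm.
Qed.

(** Convergence along real [N] tending to +oo is tested on sequences, to which the usual dominated
    convergence theorem applies. *)
Lemma dominated_cvgy (F : R -> T -> R) f g :
  (forall N, 0 < N -> measurable_fun D (F N)) ->
  measurable_fun D f ->
  mu.-integrable D (EFin \o g) ->
  (forall N x, 0 < N -> D x -> `|F N x| <= g x) ->
  (forall x, D x -> F N x @[N --> +oo] --> f x) ->
  (\int[mu]_(x in D) F N x) @[N --> +oo] --> \int[mu]_(x in D) f x.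
Proof.
move=> mF mf ig Fg Ff; apply/cvg_pinftyP => u uoo.
(* The hypotheses speak of positive [N] only, so the finitely many nonpositive terms of the sequence
   are replaced by 1. *)
pose v n := if 0 < u n then u n else 1.
have v0 n : 0 < v n by rewrite /v; case: ifP.
have uv : \forall n \near \oo, u n = v n.
  have : \forall n \near \oo, 0 < u n.
    by move/cvgryPgt : uoo; exact.
  by apply: filterS => n; rewrite /v => ->.
have voo : v n @[n --> \oo] --> +oo.
  by apply: cvg_trans uoo; apply: near_eq_cvg.
have : (\int[mu]_(x in D) F (v n) x) @[n --> \oo] --> \int[mu]_(x in D) f x.
  have [|||||jf _ H] := @dominated_convergence _ _ _ mu D mD
    (fun n => EFin \o F (v n)) (EFin \o f) (EFin \o g).
  - by move=> n; exact/measurable_EFinP/mF.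
  - exact/measurable_EFinP.
  - apply: aeW => x Dx /=; apply: cvg_EFin; first exact: nearW.
    exact: ((cvg_pinftyP _ _).1 (Ff x Dx) v voo).
  - exact: ig.
  - by apply: aeW => x n Dx /=; rewrite lee_fin Fg.
  apply: fine_cvg; rewrite fineK; last exact: integrable_fin_num.
  exact: H.
apply: cvg_trans; apply: near_eq_cvg.
by apply: filterS uv => n ->.
Qed.

End RealIntegral.

Section Fine.
Context {R : realType} d (T : measurableType d) (mu : {measure set T -> \bar R}).
Variables (D : set T) (mD : measurable D).

Lemma integrable_fine (h : T -> \bar R) : mu.-integrable D h ->
  mu.-integrable D (fun x => (fine (h x))%:E).
Proof.
move=> ih; apply: (le_integrable mD _ _ ih).
  apply/measurable_EFinP; apply: (measurableT_comp (fine_measurable measurableT)).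
  exact: measurable_int ih.
by move=> x _; case: (h x) => [r| |]//=; rewrite normr0 leey.
Qed.

(** An integrable function is finite almost everywhere, so [fine] changes it on a null set only.
    This reconciles iterated [Rintegral]s, which apply [fine] to the inner integral, with the
    extended-valued Fubini theorem. *)
Lemma integral_fine (h : T -> \bar R) : mu.-integrable D h ->
  (\int[mu]_(x in D) (fine (h x))%:E = \int[mu]_(x in D) h x)%E.
Proof.
move=> ih; apply: ae_eq_integral => //.
- exact: measurable_int (integrable_fine ih).
- exact: measurable_int ih.
- by apply: filterS (integrable_ae mD ih) => x H Dx; rewrite fineK// H.
Qed.

End Fine.

(** * Fubini for real-valued iterated integrals over subsets *)

Section RFubini.
Context {R : realType} d1 d2 (T1 : measurableType d1) (T2 : measurableType d2).
Variables (m1 : {sigma_finite_measure set T1 -> \bar R})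
          (m2 : {sigma_finite_measure set T2 -> \bar R}).
Variables (D1 : set T1) (D2 : set T2).
Hypotheses (mD1 : measurable D1) (mD2 : measurable D2).
Variable f : T1 -> T2 -> R.

(** Extension by zero to the whole product, on which Fubini is applied; [F1], [F2], [F10], [F20]
    describe its sections. *)
Let F : T1 * T2 -> \bar R := EFin \o ((fun p => f p.1 p.2) \_ (D1 `*` D2)).

Let F1 x y : D1 x -> F (x, y) = ((EFin \o f x) \_ D2) y.
Proof.
move=> D1x; rewrite /F /= !patchE.
have -> : ((x, y) \in D1 `*` D2) = (y \in D2).
  by apply/idP/idP; rewrite !inE => //=; case.
by case: ifP.
Qed.

Let F2 x y : D2 y -> F (x, y) = ((EFin \o f^~ y) \_ D1) x.
Proof.
move=> D2y; rewrite /F /= !patchE.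
have -> : ((x, y) \in D1 `*` D2) = (x \in D1).
  by apply/idP/idP; rewrite !inE => //=; case.
by case: ifP.
Qed.

Let F10 x y : ~ D1 x -> F (x, y) = 0%E.
Proof.
move=> D1x; rewrite /F /= !patchE.
by case: ifP => //; rewrite inE => -[].
Qed.

Let F20 x y : ~ D2 y -> F (x, y) = 0%E.
Proof.
move=> D2y; rewrite /F /= !patchE.
by case: ifP => //; rewrite inE => -[].
Qed.

(** Tonelli's criterion. It serves for the sine integral, whose kernel couples the two variables
    through an exponential, while [integrable_prod_dom] serves where a product bound is at hand. *)
Lemma integrable_prod_iter :
  measurable_fun (D1 `*` D2) (fun p => f p.1 p.2) ->
  (\int[m1]_(x in D1) \int[m2]_(y in D2) (`|f x y|)%:E < +oo)%E ->
  (m1 \x m2)%E.-integrable (D1 `*` D2) (fun p => (f p.1 p.2)%:E).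
Proof.
move=> mf f_fin; apply/integrable_mkcond; first exact: measurableX.
rewrite (_ : _ \_ _ = F); last by rewrite /F -restrict_EFin.
apply/integrable12ltyP.
  apply/measurable_EFinP; apply/(measurable_restrictT _ _).1 => //.
  exact: measurableX.
apply: le_lt_trans f_fin; rewrite le_eqVlt; apply/orP; left; apply/eqP.
rewrite [RHS]integral_mkcond; apply: eq_integral => x _; rewrite patchE.
have [D1x|D1x] := pselect (D1 x); [rewrite ifT ?mem_set//|rewrite ifF ?memNset//].
  rewrite [RHS]integral_mkcond; apply: eq_integral => y _.
  by rewrite F1// !patchE; case: ifP => //=; rewrite normr0.
by under eq_integral do rewrite F10// abse0; rewrite integral0.
Qed.


Lemma integrable_prod_dom (h1 : T1 -> R) (h2 : T2 -> R) :
  measurable_fun (D1 `*` D2) (fun p => f p.1 p.2) ->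
  m1.-integrable D1 (EFin \o h1) -> m2.-integrable D2 (EFin \o h2) ->
  (forall x y, D1 x -> D2 y -> `|f x y| <= h1 x * h2 y) ->
  (m1 \x m2)%E.-integrable (D1 `*` D2) (fun p => (f p.1 p.2)%:E).
Proof.
move=> mf /(integrable_mkcond _ mD1); rewrite restrict_EFin; set g1 := h1 \_ D1 => i1.
move=> /(integrable_mkcond _ mD2); rewrite restrict_EFin; set g2 := h2 \_ D2 => i2 fh.
have mX : measurable (D1 `*` D2) by exact: measurableX.
apply/integrable_mkcond => //.
have mg1 : measurable_fun setT g1 by exact/measurable_EFinP/(measurable_int _ i1).
have mg2 : measurable_fun setT g2 by exact/measurable_EFinP/(measurable_int _ i2).
have : (m1 \x m2)%E.-integrable setT (EFin \o (fun p => g1 p.1 * g2 p.2)).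
  apply/integrable12ltyP.
    apply/measurable_EFinP; apply: measurable_funM.
      exact: (measurableT_comp mg1).
    exact: (measurableT_comp mg2).
  have -> : (\int[m1]_x \int[m2]_y `|(g1 x * g2 y)%:E| =
    \int[m1]_x (`|g1 x|%:E * \int[m2]_y `|g2 y|%:E))%E.
    apply: eq_integral => x _; rewrite -ge0_integralZl_EFin//.
      by apply: eq_integral => y _ /=; rewrite normrM EFinM.
    by apply/measurable_EFinP; exact: measurableT_comp.
  have c2 : (\int[m2]_y `|g2 y|%:E)%E \is a fin_num.
    by apply: integrable_fin_num => //; exact: integrable_norm.
  rewrite -(fineK c2) ge0_integralZr//; last 2 first.
    by apply/measurable_EFinP; exact: measurableT_comp.
    by rewrite lee_fin fine_ge0// integral_ge0.
  rewrite lte_mul_pinfty ?integral_ge0//; last first.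
    by rewrite ltry.
  rewrite ge0_fin_numE ?integral_ge0//.
  by have /integrableP[_] := i1.
apply: le_integrable => //.
  apply: (measurable_restrictT _ mX).1; exact/measurable_EFinP.
move=> [x y] _; rewrite patchE; case: ifPn => [/set_mem[/= D1x D2y]|_].
  rewrite lee_fin /g1 /g2 !patchE !mem_set//.
  by rewrite (le_trans (fh _ _ D1x D2y))// ler_norm.
by rewrite abse0.
Qed.

Hypothesis fi : (m1 \x m2)%E.-integrable (D1 `*` D2) (fun p => (f p.1 p.2)%:E).

Let iF : (m1 \x m2)%E.-integrable setT F.
Proof.
move/integrable_mkcond : fi => /(_ (measurableX mD1 mD2)).
by rewrite (_ : _ \_ _ = F)// /F -restrict_EFin.
Qed.

Lemma Rfubini_integrable1 :
  m1.-integrable D1 (EFin \o (fun x => \int[m2]_(y in D2) f x y)).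
Proof.
apply/(integrable_mkcond _ mD1).
apply: eq_integrable (integrable_fine measurableT (integrable_fubini_F iF)) => //.
move=> x _; rewrite /fubini_F patchE.
have [D1x|D1x] := pselect (D1 x); [rewrite ifT ?mem_set//|rewrite ifF ?memNset//].
  congr (_%:E); rewrite /Rintegral [in RHS]integral_mkcond; congr fine.
  by apply: eq_integral => y _; rewrite F1.
by under eq_integral do rewrite F10//; rewrite integral0.
Qed.


(** The modulus of a section integral is at most the section integral of the modulus, whose integral
    is finite by Tonelli. *)
Let iG : m2.-integrable setT (fubini_G m1 F).
Proof.
have mF := measurable_int _ iF.
apply/integrableP; split; first exact: (measurable_fubini_G iF).
apply: le_lt_trans ((integrable21ltyP _ _ mF).1 iF).
apply: ge0_le_integral => //.
- apply: measurableT_comp => //; exact: (measurable_fubini_G iF).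
- apply: (measurable_fun_fubini_tonelli_G (abse \o F)).
    exact: measurableT_comp.
  by move=> ?; exact: abse_ge0.
- move=> y _; apply: le_abse_integral => //.
  exact: (measurableT_comp mF).
Qed.

Lemma Rfubini_integrable2 :
  m2.-integrable D2 (EFin \o (fun y => \int[m1]_(x in D1) f x y)).
Proof.
apply/(integrable_mkcond _ mD2).
apply: eq_integrable (integrable_fine measurableT iG) => //.
move=> y _; rewrite /fubini_G patchE.
have [D2y|D2y] := pselect (D2 y); [rewrite ifT ?mem_set//|rewrite ifF ?memNset//].
  congr (_%:E); rewrite /Rintegral [in RHS]integral_mkcond; congr fine.
  by apply: eq_integral => x _; rewrite F2.
by under eq_integral do rewrite F20//; rewrite integral0.
Qed.

Lemma Rfubini : \int[m1]_(x in D1) (\int[m2]_(y in D2) f x y) =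
  \int[m2]_(y in D2) (\int[m1]_(x in D1) f x y).
Proof.
rewrite /Rintegral; congr fine.
rewrite [LHS]integral_mkcond [RHS]integral_mkcond.
transitivity (\int[m1]_x (fubini_F m2 F x))%E.
  rewrite -(integral_fine measurableT (integrable_fubini_F iF)).
  apply: eq_integral => x _; rewrite patchE.
  have [D1x|D1x] := pselect (D1 x); [rewrite ifT ?mem_set//|rewrite ifF ?memNset//].
    congr (_%:E); rewrite [in LHS]integral_mkcond; congr fine.
    by apply: eq_integral => y _; rewrite F1.
  by rewrite /fubini_F; under eq_integral do rewrite F10//; rewrite integral0.
rewrite (integral12_prod_meas1 iF) -(integral21_prod_meas1 iF).
rewrite -(integral_fine measurableT iG).
apply: eq_integral => y _; rewrite patchE.
have [D2y|D2y] := pselect (D2 y); [rewrite ifT ?mem_set//|rewrite ifF ?memNset//].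
  congr (_%:E); rewrite [in RHS]integral_mkcond; congr fine.
  by apply: eq_integral => x _; rewrite F2.
by rewrite /fubini_G; under eq_integral do rewrite F20//; rewrite integral0.
Qed.

End RFubini.

(** * Integrals of complex-valued functions *)

Section CIntegral.
Context {R : realType} d (T : measurableType d) (mu : {measure set T -> \bar R}).
Implicit Types (f g : T -> R[i]) (D : set T).

Definition cintegrable D f :=
  mu.-integrable D (EFin \o (fun x => complex.Re (f x))) /\
  mu.-integrable D (EFin \o (fun x => complex.Im (f x))).

Definition cintegral D f : R[i] :=
  (\int[mu]_(x in D) complex.Re (f x)) +i* (\int[mu]_(x in D) complex.Im (f x)).

Lemma cintegrable_dom D f (h : T -> R) : measurable D -> cmeasurable D f ->
  mu.-integrable D (EFin \o h) -> (forall x, D x -> normc (f x) <= h x) ->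
  cintegrable D f.
Proof.
move=> mD [mf1 mf2] ih fh; split; apply: (integrable_dom mD _ ih) => // x Dx.
  exact: le_trans (normc_Re _) (fh _ Dx).
exact: le_trans (normc_Im _) (fh _ Dx).
Qed.

Lemma cintegrable_cmeasurable D f : cintegrable D f -> cmeasurable D f.
Proof. by move=> [/measurable_int/measurable_EFinP ? /measurable_int/measurable_EFinP ?]. Qed.

Lemma integrable_normc D f : measurable D -> cintegrable D f ->
  mu.-integrable D (EFin \o (fun x => `|complex.Re (f x)| + `|complex.Im (f x)|)).
Proof.
move=> mD [i1 i2].
exact: (integrableD mD (integrable_norm i1) (integrable_norm i2)).
Qed.

Lemma eq_cintegral D f g : (forall x, D x -> f x = g x) ->
  cintegral D f = cintegral D g.
Proof.
by move=> fg; congr (_ +i* _); apply: eq_Rintegral => x /[!inE] Dx; rewrite fg.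
Qed.

Lemma eq_cintegrable D f g : measurable D -> (forall x, D x -> f x = g x) ->
  cintegrable D f -> cintegrable D g.
Proof.
by move=> mD fg [i1 i2]; split; [apply: eq_integrable i1|apply: eq_integrable i2] => //
  x /[!inE] Dx /=; rewrite fg.
Qed.

Lemma cintegrableS D E f : measurable D -> measurable E -> D `<=` E ->
  cintegrable E f -> cintegrable D f.
Proof. by move=> mD mE DE [i1 i2]; split; [exact: integrableS i1|exact: integrableS i2]. Qed.

Lemma cintegrableD D f g : measurable D -> cintegrable D f -> cintegrable D g ->
  cintegrable D (fun x => f x + g x).
Proof.
move=> mD [f1 f2] [g1 g2]; split.
  by apply: eq_integrable (integrableD mD f1 g1) => // x _ /=; rewrite Re_addc EFinD.
by apply: eq_integrable (integrableD mD f2 g2) => // x _ /=; rewrite Im_addc EFinD.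
Qed.

Lemma cintegralD D f g : measurable D -> cintegrable D f -> cintegrable D g ->
  cintegral D (fun x => f x + g x) = cintegral D f + cintegral D g.
Proof.
move=> mD [f1 f2] [g1 g2]; apply: complex_ext => /=.
  by rewrite -RintegralD//; apply: eq_Rintegral => x _; rewrite Re_addc.
by rewrite -RintegralD//; apply: eq_Rintegral => x _; rewrite Im_addc.
Qed.

Lemma cintegrableZ D c f : measurable D -> cintegrable D f ->
  cintegrable D (fun x => c * f x).
Proof.
move=> mD [f1 f2]; split.
  apply: eq_integrable (integrableB mD (integrableZl mD (complex.Re c) f1)
    (integrableZl mD (complex.Im c) f2)) => // x _ /=.
  by rewrite Re_mulc EFinB !EFinM.
apply: eq_integrable (integrableD mD (integrableZl mD (complex.Re c) f2)
    (integrableZl mD (complex.Im c) f1)) => // x _ /=.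
by rewrite Im_mulc EFinD !EFinM.
Qed.

Lemma cintegralZ D c f : measurable D -> cintegrable D f ->
  cintegral D (fun x => c * f x) = c * cintegral D f.
Proof.
move=> mD [f1 f2].
have Z1 (k : R) : mu.-integrable D (EFin \o (fun x => k * complex.Re (f x))).
  by apply: eq_integrable (integrableZl mD k f1) => // x _ /=; rewrite EFinM.
have Z2 (k : R) : mu.-integrable D (EFin \o (fun x => k * complex.Im (f x))).
  by apply: eq_integrable (integrableZl mD k f2) => // x _ /=; rewrite EFinM.
apply: complex_ext; rewrite ?Re_mulc ?Im_mulc /= -!RintegralZl// -1?RintegralB// -1?RintegralD//.
  by apply: eq_Rintegral => x _; rewrite Re_mulc.
by apply: eq_Rintegral => x _; rewrite Im_mulc.
Qed.

Lemma cintegrableB D f g : measurable D -> cintegrable D f -> cintegrable D g ->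
  cintegrable D (fun x => f x - g x).
Proof.
move=> mD fi gi.
have := cintegrableD mD fi (cintegrableZ (-1) mD gi).
by apply: eq_cintegrable => // x _; rewrite mulN1r.
Qed.

Lemma cintegralB D f g : measurable D -> cintegrable D f -> cintegrable D g ->
  cintegral D (fun x => f x - g x) = cintegral D f - cintegral D g.
Proof.
move=> mD fi gi; rewrite -[in RHS]mulN1r -cintegralZ// -cintegralD//.
  by apply: eq_cintegral => x _; rewrite mulN1r.
exact: cintegrableZ.
Qed.

Lemma cintegralJ D f : measurable D -> cintegrable D f ->
  cintegral D (fun x => conjc (f x)) = conjc (cintegral D f).
Proof.
move=> mD [f1 f2]; apply: complex_ext; rewrite ?Re_conjc ?Im_conjc /=.
  by apply: eq_Rintegral => x _; rewrite Re_conjc.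
by rewrite -mulN1r -RintegralZl//; apply: eq_Rintegral => x _; rewrite Im_conjc mulN1r.
Qed.

Lemma cintegrable_real D (h : T -> R) : measurable D ->
  mu.-integrable D (EFin \o h) -> cintegrable D (fun x => (h x)%:C).
Proof. by move=> mD ih; split => //; exact: integrable0. Qed.

Lemma cintegral_real D (h : T -> R) :
  cintegral D (fun x => (h x)%:C) = (\int[mu]_(x in D) h x)%:C.
Proof. by apply: complex_ext => //=; rewrite /Rintegral integral0. Qed.

(** The factor 2 comes from bounding the real and imaginary parts separately; it is harmless, since
    these bounds serve only to dominate. *)
Lemma normc_cintegral_le D f (h : T -> R) : measurable D -> cmeasurable D f ->
  mu.-integrable D (EFin \o h) -> (forall x, D x -> normc (f x) <= h x) ->
  normc (cintegral D f) <= 2 * \int[mu]_(x in D) h x.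
Proof.
move=> mD [mf1 mf2] ih fh; rewrite (le_trans (normc_le_ReIm _))//= mulrDl !mul1r lerD//.
  by apply: normr_Rintegral_le => // x Dx; exact: le_trans (normc_Re _) (fh _ Dx).
by apply: normr_Rintegral_le => // x Dx; exact: le_trans (normc_Im _) (fh _ Dx).
Qed.

End CIntegral.

(** * Complex limits at infinity *)

Section Ccvg.
Context {R : realType}.
Implicit Types (f g : R -> R[i]) (a b : R[i]).

(** Taken by components, so that real limit theorems apply directly; [ccvgy_cvg] recovers the
    convergence in [R[i]] that [is_VP_integral] asks for. *)
Definition ccvgy f a :=
  complex.Re (f N) @[N --> +oo%R] --> complex.Re a /\
  complex.Im (f N) @[N --> +oo%R] --> complex.Im a.

Lemma ccvgy_cst a : ccvgy (cst a) a.
Proof. by split; exact: cvg_cst. Qed.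

Lemma ccvgyD f g a b : ccvgy f a -> ccvgy g b -> ccvgy (fun N => f N + g N) (a + b).
Proof.
move=> [f1 f2] [g1 g2]; split.
  by rewrite Re_addc; under eq_fun do rewrite Re_addc; exact: cvgD.
by rewrite Im_addc; under eq_fun do rewrite Im_addc; exact: cvgD.
Qed.

Lemma ccvgyM f g a b : ccvgy f a -> ccvgy g b -> ccvgy (fun N => f N * g N) (a * b).
Proof.
move=> [f1 f2] [g1 g2]; split.
  by rewrite Re_mulc; under eq_fun do rewrite Re_mulc; apply: cvgB; exact: cvgM.
by rewrite Im_mulc; under eq_fun do rewrite Im_mulc; apply: cvgD; exact: cvgM.
Qed.

Lemma ccvgyZ c f a : ccvgy f a -> ccvgy (fun N => c * f N) (c * a).
Proof. by move=> fa; apply: ccvgyM => //; exact: ccvgy_cst. Qed.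

Lemma ccvgyN f a : ccvgy f a -> ccvgy (fun N => - f N) (- a).
Proof.
move=> [f1 f2]; split.
  by rewrite Re_oppc; under eq_fun do rewrite Re_oppc; exact: cvgN.
by rewrite Im_oppc; under eq_fun do rewrite Im_oppc; exact: cvgN.
Qed.

Lemma ccvgyB f g a b : ccvgy f a -> ccvgy g b -> ccvgy (fun N => f N - g N) (a - b).
Proof. by move=> fa gb; apply: ccvgyD => //; exact: ccvgyN. Qed.

Lemma ccvgyX f a n : ccvgy f a -> ccvgy (fun N => f N ^+ n) (a ^+ n).
Proof.
move=> fa; elim: n => [|n IH]; first exact: ccvgy_cst.
by rewrite exprS; under eq_fun do rewrite exprS; exact: ccvgyM.
Qed.

Lemma ccvgyJ f a : ccvgy f a -> ccvgy (fun N => conjc (f N)) (conjc a).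
Proof.
move=> [f1 f2]; split.
  by rewrite Re_conjc; under eq_fun do rewrite Re_conjc.
by rewrite Im_conjc; under eq_fun do rewrite Im_conjc; exact: cvgN.
Qed.

Lemma ccvgy_near f g a : (\forall N \near +oo%R, f N = g N) -> ccvgy f a -> ccvgy g a.
Proof.
move=> fg [f1 f2]; split; [apply: cvg_trans f1|apply: cvg_trans f2];
  by apply: near_eq_cvg; apply: filterS fg => N ->.
Qed.

Lemma ccvgy_norm0 f (h : R -> R) : (\forall N \near +oo%R, normc (f N) <= h N) ->
  h N @[N --> +oo%R] --> 0 -> ccvgy f 0.
Proof.
move=> fh h0.
have hN0 : - h N @[N --> +oo%R] --> 0 by rewrite -oppr0; exact: cvgN.
split; apply: (squeeze_cvgr _ hN0 h0); apply: filterS fh => N fN; rewrite -ler_norml.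
  exact: le_trans (normc_Re _) fN.
exact: le_trans (normc_Im _) fN.
Qed.

Lemma ccvgy_cvg f a : ccvgy f a -> f N @[N --> +oo%R] --> (a : R[i]^o).
Proof.
move=> [f1 f2].
apply: (proj2 (@cvgrPdist_lt R[i] R[i]^o _ (+oo%R : set_system R) _ f a)) => e; rewrite ltcE /= => /andP[/eqP e2 e1].
(* Positivity in [R[i]] forces a zero imaginary part, so the radius is a real number. *)
have eE : e = (complex.Re e)%:C by apply: complex_ext.
have e20 : 0 < complex.Re e / 2 by rewrite divr_gt0.
move/cvgrPdist_lt : f1 => /(_ _ e20) f1; move/cvgrPdist_lt : f2 => /(_ _ e20) f2.
apply: filterS2 f1 f2 => N; rewrite -!Re_oppc -Re_addc -!Im_oppc -Im_addc => h1 h2.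
rewrite eE normr_normc ltcR (le_lt_trans (normc_le_ReIm _))//.
by rewrite (splitr (complex.Re e)) ltrD.
Qed.

End Ccvg.

Lemma dominated_ccvgy {R : realType} d (T : measurableType d)
    (mu : {measure set T -> \bar R}) (D : set T) (F : R -> T -> R[i]) f (g : T -> R) :
  measurable D ->
  (forall N, 0 < N -> cmeasurable D (F N)) ->
  cmeasurable D f ->
  mu.-integrable D (EFin \o g) ->
  (forall N x, 0 < N -> D x -> normc (F N x) <= g x) ->
  (forall x, D x -> ccvgy (F ^~ x) (f x)) ->
  ccvgy (fun N => cintegral mu D (F N)) (cintegral mu D f).
Proof.
move=> mD mF [mf1 mf2] ig Fg Ff; split.
  apply: (dominated_cvgy mD _ mf1 ig) => [N N0|N x N0 Dx|x Dx].
  - by have [] := mF _ N0.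
  - exact: le_trans (normc_Re _) (Fg _ _ N0 Dx).
  - by have [] := Ff _ Dx.
apply: (dominated_cvgy mD _ mf2 ig) => [N N0|N x N0 Dx|x Dx].
- by have [] := mF _ N0.
- exact: le_trans (normc_Im _) (Fg _ _ N0 Dx).
- by have [] := Ff _ Dx.
Qed.

Section CFubini.
Context {R : realType} d1 d2 (T1 : measurableType d1) (T2 : measurableType d2).
Variables (m1 : {sigma_finite_measure set T1 -> \bar R})
          (m2 : {sigma_finite_measure set T2 -> \bar R}).
Variables (D1 : set T1) (D2 : set T2).
Hypotheses (mD1 : measurable D1) (mD2 : measurable D2).
Variables (f : T1 -> T2 -> R[i]) (h1 : T1 -> R) (h2 : T2 -> R).
Hypothesis mf : cmeasurable (D1 `*` D2) (fun p => f p.1 p.2).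
Hypotheses (ih1 : m1.-integrable D1 (EFin \o h1))
           (ih2 : m2.-integrable D2 (EFin \o h2)).
Hypothesis fh : forall x y, D1 x -> D2 y -> normc (f x y) <= h1 x * h2 y.

Let iRe : (m1 \x m2)%E.-integrable (D1 `*` D2) (fun p => (complex.Re (f p.1 p.2))%:E).
Proof.
apply: (@integrable_prod_dom _ _ _ _ _ m1 m2 D1 D2 mD1 mD2
  (fun x y => complex.Re (f x y)) h1 h2) => //.
  by have [] := mf.
by move=> x y Dx Dy; exact: le_trans (normc_Re _) (fh Dx Dy).
Qed.

Let iIm : (m1 \x m2)%E.-integrable (D1 `*` D2) (fun p => (complex.Im (f p.1 p.2))%:E).
Proof.
apply: (@integrable_prod_dom _ _ _ _ _ m1 m2 D1 D2 mD1 mD2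
  (fun x y => complex.Im (f x y)) h1 h2) => //.
  by have [] := mf.
by move=> x y Dx Dy; exact: le_trans (normc_Im _) (fh Dx Dy).
Qed.

Lemma cfubini_integrable1 :
  cintegrable m1 D1 (fun x => cintegral m2 D2 (f x)).
Proof.
split.
  exact: (@Rfubini_integrable1 _ _ _ _ _ m1 m2 D1 D2 mD1 mD2 (fun x y => complex.Re (f x y))).
exact: (@Rfubini_integrable1 _ _ _ _ _ m1 m2 D1 D2 mD1 mD2 (fun x y => complex.Im (f x y))).
Qed.

Lemma cfubini_integrable2 :
  cintegrable m2 D2 (fun y => cintegral m1 D1 (fun x => f x y)).
Proof.
split.
  exact: (@Rfubini_integrable2 _ _ _ _ _ m1 m2 D1 D2 mD1 mD2 (fun x y => complex.Re (f x y))).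
exact: (@Rfubini_integrable2 _ _ _ _ _ m1 m2 D1 D2 mD1 mD2 (fun x y => complex.Im (f x y))).
Qed.

Lemma cfubini : cintegral m1 D1 (fun x => cintegral m2 D2 (f x)) =
  cintegral m2 D2 (fun y => cintegral m1 D1 (fun x => f x y)).
Proof.
apply: complex_ext => /=.
  exact: (@Rfubini _ _ _ _ _ m1 m2 D1 D2 mD1 mD2 (fun x y => complex.Re (f x y))).
exact: (@Rfubini _ _ _ _ _ m1 m2 D1 D2 mD1 mD2 (fun x y => complex.Im (f x y))).
Qed.

End CFubini.

(** * Calculus for complex-valued functions of a real variable *)

Section CDerive.
Context {R : realType}.
Implicit Types (f g : R -> R[i]) (x : R).

Definition is_cderive f x (df : R[i]) :=
  is_derive x 1 (fun t => complex.Re (f t)) (complex.Re df) /\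
  is_derive x 1 (fun t => complex.Im (f t)) (complex.Im df).

Lemma is_cderive_eq f x a b : is_cderive f x a -> a = b -> is_cderive f x b.
Proof. by move=> ? <-. Qed.

Lemma is_cderive_cst c x : is_cderive (cst c) x 0.
Proof. by split; exact: is_derive_cst. Qed.

Lemma is_cderive_real x : is_cderive (fun t => t%:C) x 1.
Proof. by split; [exact: is_derive_id|exact: is_derive_cst]. Qed.

Lemma is_cderiveD f g x df dg : is_cderive f x df -> is_cderive g x dg ->
  is_cderive (fun t => f t + g t) x (df + dg).
Proof.
move=> [f1 f2] [g1 g2]; split.
  by rewrite Re_addc; under eq_fun do rewrite Re_addc; exact: is_deriveD.
by rewrite Im_addc; under eq_fun do rewrite Im_addc; exact: is_deriveD.
Qed.

Lemma is_cderiveN f x df : is_cderive f x df -> is_cderive (fun t => - f t) x (- df).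
Proof.
move=> [f1 f2]; split.
  by rewrite Re_oppc; under eq_fun do rewrite Re_oppc; exact: is_deriveN.
by rewrite Im_oppc; under eq_fun do rewrite Im_oppc; exact: is_deriveN.
Qed.

Lemma is_cderiveM f g x df dg : is_cderive f x df -> is_cderive g x dg ->
  is_cderive (fun t => f t * g t) x (df * g x + f x * dg).
Proof.
move=> [f1 f2] [g1 g2]; split.
  rewrite Re_addc !Re_mulc; under eq_fun do rewrite Re_mulc.
  apply: (is_derive_eq (is_deriveB (is_deriveM f1 g1) (is_deriveM f2 g2))).
  by rewrite /GRing.scale/=; ring.
rewrite Im_addc !Im_mulc; under eq_fun do rewrite Im_mulc.
apply: (is_derive_eq (is_deriveD (is_deriveM f1 g2) (is_deriveM f2 g1))).
by rewrite /GRing.scale/=; ring.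
Qed.

Lemma is_cderiveZ c f x df : is_cderive f x df -> is_cderive (fun t => c * f t) x (c * df).
Proof.
move=> fdf; apply: is_cderive_eq (is_cderiveM (is_cderive_cst c x) fdf) _.
by rewrite mul0r add0r.
Qed.

Lemma is_cderiveX f n x df : is_cderive f x df ->
  is_cderive (fun t => f t ^+ n.+1) x (n.+1%:R * f x ^+ n * df).
Proof.
move=> fdf; elim: n => [|n IH].
  by apply: is_cderive_eq fdf _; rewrite expr0 mulr1 mul1r.
under eq_fun do rewrite exprS.
apply: is_cderive_eq (is_cderiveM fdf IH) _.
by rewrite -(natr1 n.+1) exprS; ring.
Qed.

Lemma is_cderiveV f x df : f x != 0 -> is_cderive f x df ->
  is_cderive (fun t => (f t)^-1) x (- (df * (f x)^-1 ^+ 2)).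
Proof.
move=> fx0 [f1 f2].
have n0 : complex.Re (f x) ^+ 2 + complex.Im (f x) ^+ 2 != 0.
  apply: contra_neq fx0 => /eqP; rewrite paddr_eq0 ?sqr_ge0// !sqrf_eq0 => /andP[/eqP a /eqP b].
  exact: complex_ext.
have dn : is_derive x 1 (fun t => complex.Re (f t) ^+ 2 + complex.Im (f t) ^+ 2)
    (2 * complex.Re (f x) * complex.Re df + 2 * complex.Im (f x) * complex.Im df).
  under eq_fun do rewrite 2!expr2.
  apply: (is_derive_eq (is_deriveD (is_deriveM f1 f1) (is_deriveM f2 f2))).
  by rewrite /GRing.scale/=; ring.
have dV := @is_deriveV _ (fun t => complex.Re (f t) ^+ 2 + complex.Im (f t) ^+ 2)
  _ _ _ n0 dn.
split.
  under eq_fun do rewrite Re_invc.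
  apply: (is_derive_eq (is_deriveM f1 dV)).
  rewrite /GRing.scale/= Re_oppc Re_mulc expr2 Re_mulc Im_mulc !Re_invc !Im_invc.
  by field.
under eq_fun do rewrite Im_invc.
apply: (is_derive_eq (is_deriveN (is_deriveM f2 dV))).
rewrite /GRing.scale/= Im_oppc Im_mulc expr2 Re_mulc Im_mulc !Re_invc !Im_invc.
by field.
Qed.

Lemma is_cderive_shiftVX (z : R[i]) n x : complex.Im z != 0 ->
  is_cderive (fun t => (t%:C + z)^-1 ^+ n.+1) x (- n.+1%:R * (x%:C + z)^-1 ^+ n.+2).
Proof.
move=> z0; have xz : x%:C + z != 0 by exact: real_add_neq0.
have d1 : is_cderive (fun t => t%:C + z) x 1.
  by apply: is_cderive_eq (is_cderiveD (is_cderive_real x) (is_cderive_cst z x)) _; rewrite addr0.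
apply: is_cderive_eq (is_cderiveX n (is_cderiveV xz d1)) _.
by rewrite mul1r mulrN mulNr -mulrA -exprD addn2.
Qed.

Lemma is_cderive_cexp c x : is_cderive (fun t => cexp (c * t%:C)) x (c * cexp (c * x%:C)).
Proof.
have E (t : R) : complex.Re (c * t%:C) = complex.Re c * t by rewrite Re_mulc/= mulr0 subr0.
have E' (t : R) : complex.Im (c * t%:C) = complex.Im c * t by rewrite Im_mulc/= mulr0 add0r.
have d1 (a : R) : is_derive x 1 (fun t => a * t) a.
  by apply: is_derive_eq; rewrite /GRing.scale/= mulr1.
have de := is_derive1_comp (f := expR) (is_derive_expR _) (d1 (complex.Re c)).
have dc := is_derive1_comp (f := cos) (is_derive_cos _) (d1 (complex.Im c)).
have ds := is_derive1_comp (f := sin) (is_derive_sin _) (d1 (complex.Im c)).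
split.
  under eq_fun do rewrite Re_cexp E E'.
  apply: (is_derive_eq (is_deriveM de dc)).
  by rewrite Re_mulc Re_cexp Im_cexp E E' /GRing.scale/=; ring.
under eq_fun do rewrite Im_cexp E E'.
apply: (is_derive_eq (is_deriveM de ds)).
by rewrite Im_mulc Re_cexp Im_cexp E E' /GRing.scale/=; ring.
Qed.

Definition ccontinuous f :=
  continuous (fun t => complex.Re (f t)) /\ continuous (fun t => complex.Im (f t)).

Lemma ccontinuousB f g : ccontinuous f -> ccontinuous g -> ccontinuous (fun t => f t - g t).
Proof.
move=> [f1 f2] [g1 g2]; split => t.
  under eq_fun do rewrite Re_addc Re_oppc.
  by apply: cvgB; [exact: f1|exact: g1].
under eq_fun do rewrite Im_addc Im_oppc.
by apply: cvgB; [exact: f2|exact: g2].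
Qed.

Lemma ccontinuousZ c f : ccontinuous f -> ccontinuous (fun t => c * f t).
Proof.
move=> [f1 f2]; split => t.
  under eq_fun do rewrite Re_mulc.
  by apply: cvgB; apply: cvgM; [exact: cvg_cst|exact: f1|exact: cvg_cst|exact: f2].
under eq_fun do rewrite Im_mulc.
by apply: cvgD; apply: cvgM; [exact: cvg_cst|exact: f2|exact: cvg_cst|exact: f1].
Qed.

Lemma is_cderive_continuous f (df : R -> R[i]) :
  (forall x, is_cderive f x (df x)) -> ccontinuous f.
Proof.
move=> fdf; split => x; apply/differentiable_continuous/derivable1_diffP;
  by have [[]] := fdf x.
Qed.

Lemma ccontinuous_cmeasurable f D : measurable D -> ccontinuous f ->
  cmeasurable D (f : measurableTypeR R -> R[i]).
Proof.
move=> mD [f1 f2]; split; apply: measurable_funTS;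
  exact: continuous_measurable_fun.
Qed.

Lemma ccontinuous_cintegrable f a b : ccontinuous f ->
  cintegrable lebesgue_measure `[a, b] f.
Proof.
move=> [f1 f2]; split; apply: continuous_compact_integrable;
 by [exact: segment_compact|exact: continuous_subspaceT].
Qed.

Lemma is_cderive_cintegral F f a b : a <= b ->
  (forall x, is_cderive F x (f x)) -> ccontinuous f ->
  cintegral lebesgue_measure `[a, b] f = F b - F a.
Proof.
rewrite le_eqVlt => /predU1P[<- _ _|ab dF [f1 f2]].
  by rewrite subrr set_itv1; apply: complex_ext; rewrite /= Rintegral_set1.
have [F1 F2] := is_cderive_continuous dF.
apply: complex_ext; rewrite ?Re_addc ?Re_oppc ?Im_addc ?Im_oppc /= /Rintegral.
  rewrite (@continuous_FTC2 _ _ (fun t => complex.Re (F t)))//.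
  - exact: continuous_subspaceT.
  - split; first by move=> x _; have [[]] := dF x.
      by apply: cvg_at_right_filter; exact: F1.
    by apply: cvg_at_left_filter; exact: F1.
  - by move=> x _; have [H _] := dF x; rewrite derive1E derive_val.
rewrite (@continuous_FTC2 _ _ (fun t => complex.Im (F t)))//.
- exact: continuous_subspaceT.
- split; first by move=> x _; have [_ []] := dF x.
    by apply: cvg_at_right_filter; exact: F2.
  by apply: cvg_at_left_filter; exact: F2.
- by move=> x _; have [_ H] := dF x; rewrite derive1E derive_val.
Qed.

Lemma ccvgy_unique f a b : ccvgy f a -> ccvgy f b -> a = b.
Proof.
move=> [f1 f2] [g1 g2]; apply: complex_ext.
  exact: (cvg_unique _ f1 g1).
exact: (cvg_unique _ f2 g2).
Qed.

(** Truncation is moved from the domain into the integrand, so that dominated convergence applies on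
    the fixed half-line, with |Re f| + |Im f| as dominating function. *)
Lemma cintegral_itvy_cvg f a : cintegrable lebesgue_measure `[a, +oo[ f ->
  ccvgy (fun N => cintegral lebesgue_measure `[a, N] f)
    (cintegral lebesgue_measure `[a, +oo[ f).
Proof.
move=> fi; have fm := cintegrable_cmeasurable fi.
have E (N : R) : cintegral lebesgue_measure `[a, N] f =
    cintegral lebesgue_measure `[a, +oo[ (fun x => if x <= N then f x else 0).
  have S x : (x \in `[a, N]%classic) = (x \in `[a, +oo[%classic) && (x <= N).
    by rewrite !mem_setE !in_itv/= andbT.
  apply: complex_ext => /=; rewrite [LHS]Rintegral_mkcond [RHS]Rintegral_mkcond;
  apply: eq_Rintegral => x _; rewrite !patchE S; case: ifPn => [/andP[->->]//|];
  by rewrite negb_and => /orP[/negbTE->//|/negbTE->]; case: ifP.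
under eq_fun do rewrite E.
have mD : measurable (`[a, +oo[ : set (measurableTypeR R)) by [].
apply: (@dominated_ccvgy R _ _ lebesgue_measure `[a, +oo[%classic
  (fun N x => if x <= N then f x else 0) f _ mD _ fm (integrable_normc mD fi)).
- move=> N _; apply: cmeasurable_if => //.
  apply: measurable_funTS; apply: (measurable_fun_bool true).
  by rewrite setTI (_ : _ @^-1` _ = (`]-oo, N]%classic : set (measurableTypeR R)))//.
- move=> N x _ _; case: ifP => _; first exact: normc_le_ReIm.
  by rewrite Normc.normc0 addr_ge0.
- move=> x _; apply: (ccvgy_near _ (ccvgy_cst (f x))).
  near=> N; rewrite ifT//; near: N; exact: nbhs_pinfty_ge (num_real _).
Unshelve. all: by end_near. Qed.

Lemma is_cderive_cintegral_itvy F f a :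
  (forall x, is_cderive F x (f x)) -> ccontinuous f ->
  cintegrable lebesgue_measure `[a, +oo[ f -> ccvgy F 0 ->
  cintegral lebesgue_measure `[a, +oo[ f = - F a.
Proof.
move=> dF cf fi F0; apply: ccvgy_unique (cintegral_itvy_cvg fi) _.
rewrite -[- F a]add0r; apply: ccvgy_near (ccvgyB F0 (ccvgy_cst (F a))).
near=> N; rewrite (is_cderive_cintegral _ dF cf)//.
Unshelve. all: by end_near. Qed.

End CDerive.

(** * Exponential and Poisson integrals on a half-line *)

Section RealExp.
Context {R : realType}.
Local Notation leb := (@lebesgue_measure R).

Lemma is_derive_expRM (b x : R) : is_derive x 1 (fun t => expR (b * t)) (b * expR (b * x)).
Proof.
have d1 : is_derive x 1 (fun t => b * t) b.
  by apply: is_derive_eq; rewrite /GRing.scale/= mulr1.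
apply: (is_derive_eq (is_derive1_comp (f := expR) (is_derive_expR _) d1)).
by rewrite /GRing.scale/= mulrC.
Qed.

Lemma is_derive_continuous (f df : R -> R) :
  (forall x : R, is_derive x 1 f (df x)) -> continuous f.
Proof.
by move=> fdf x; apply/differentiable_continuous/derivable1_diffP; have [] := fdf x.
Qed.

Lemma cvgy_expRNM (b : R) : 0 < b -> expR (- b * x) @[x --> +oo] --> 0.
Proof.
move=> b0; rewrite (_ : (fun x => expR (- b * x)) =
               (fun z => expR (- z)) \o (fun z => b * z)); last first.
  by apply: eq_fun => x; rewrite mulNr.
apply: (@cvg_comp _ _ _ _ _ _ (pinfty_nbhs R)); last exact: cvgr_expR.
exact: gt0_cvgMry.
Qed.

Lemma ge0_integral_itvy_is_derive (f F : R -> R) (a l : R) :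
  (forall x, a <= x -> 0 <= f x) -> continuous f ->
  (forall x : R, is_derive x 1 F (f x)) -> F x @[x --> +oo%R] --> l ->
  (\int[leb]_(x in `[a, +oo[) (f x)%:E = (l - F a)%:E)%E.
Proof.
move=> f0 cf dF Fl; have cF := is_derive_continuous dF.
rewrite (@ge0_continuous_FTC2y _ _ F _ l)//.
- exact: continuous_subspaceT.
- by apply: cvg_at_right_filter; exact: cF.
- by move=> x _; rewrite derive1E derive_val.
Qed.

Lemma ge0_integrable_itvy_is_derive (f F : R -> R) (a l : R) :
  (forall x, a <= x -> 0 <= f x) -> continuous f ->
  (forall x : R, is_derive x 1 F (f x)) -> F x @[x --> +oo%R] --> l ->
  leb.-integrable `[a, +oo[ (EFin \o f).
Proof.
move=> f0 cf dF Fl; apply/integrableP; split.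
  by apply/measurable_EFinP/measurable_funTS; exact: continuous_measurable_fun.
have -> : (\int[leb]_(x in `[a, +oo[) `|(EFin \o f) x| =
    \int[leb]_(x in `[a, +oo[) (f x)%:E)%E.
  apply: eq_integral => x; rewrite inE/= in_itv/= andbT => ax.
  by rewrite ger0_norm// f0.
by rewrite (ge0_integral_itvy_is_derive f0 cf dF Fl) ltry.
Qed.

Let dexp (b x : R) : 0 < b -> is_derive x 1 (fun t => - b^-1 * expR (- b * t)) (expR (- b * x)).
Proof.
move=> b0; apply: (is_derive_eq (is_deriveM (is_derive_cst (- b^-1) _ _) (is_derive_expRM (- b) x))).
by rewrite /GRing.scale/=; field; rewrite gt_eqF.
Qed.

Let cexpNM (b : R) : continuous (fun t : R => expR (- b * t)).
Proof. exact: is_derive_continuous (is_derive_expRM _). Qed.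

Let lexp (b : R) : 0 < b -> - b^-1 * expR (- b * x) @[x --> +oo%R] --> 0.
Proof.
by move=> b0; rewrite -[X in _ --> X](mulr0 (- b^-1)); apply: cvgM; [exact: cvg_cst|exact: cvgy_expRNM].
Qed.

Lemma integral_expRNM (b a : R) : 0 < b ->
  (\int[leb]_(x in `[a, +oo[) (expR (- b * x))%:E = (b^-1 * expR (- b * a))%:E)%E.
Proof.
move=> b0; rewrite (ge0_integral_itvy_is_derive _ (@cexpNM b) (fun x => dexp x b0) (lexp b0)).
  by rewrite sub0r mulNr opprK.
by move=> x _; exact: expR_ge0.
Qed.

Lemma integrable_expRNM (b a : R) : 0 < b ->
  leb.-integrable `[a, +oo[ (EFin \o (fun x => expR (- b * x))).
Proof.
move=> b0; apply: (ge0_integrable_itvy_is_derive _ (@cexpNM b) (fun x => dexp x b0) (lexp b0)).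
by move=> x _; exact: expR_ge0.
Qed.

(** Half of the decay absorbs the factor x: from 1 + u <= exp u at u = b x / 2 one gets x exp(- b x
    / 2) <= 2 / b. *)
Lemma integrable_mul_expRNM (b : R) : 0 < b ->
  leb.-integrable `[0, +oo[ (EFin \o (fun x => x * expR (- b * x))).
Proof.
move=> b0; have b20 : 0 < b / 2 by rewrite divr_gt0.
apply: (@integrable_dom _ _ _ leb `[0, +oo[%classic _ _ (fun x => 2 / b * expR (- (b / 2) * x))) => //.
- apply: measurable_funTS; apply: continuous_measurable_fun => x.
  by apply: cvgM => //; exact: cexpNM.
- have i2 := @integrableZl _ _ _ leb `[0, +oo[%classic (measurable_itv _) (2 / b) _ (integrable_expRNM 0 b20).
  by apply: eq_integrable i2.
- move=> x /=; rewrite in_itv/= andbT => x0.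
  rewrite ger0_norm ?mulr_ge0 ?expR_ge0//.
  have -> : - b * x = - (b / 2) * x + - (b / 2) * x by field.
  rewrite expRD mulrA ler_wpM2r ?expR_ge0// mulNr expRN.
  rewrite ler_pdivrMr ?expR_gt0// -[2 / b]invf_div ler_pdivlMl//.
  by rewrite (le_trans _ (expR_ge1Dx _))// lerDr.
Qed.

(** The antiderivative is atan(t / y). Its limit at infinity is the source of the value pi / 2 in
    the limit of the sine integrals. *)
Lemma integral_poisson (y : R) : 0 < y ->
  (\int[leb]_(t in `[0%R, +oo[) (y / (y ^+ 2 + t ^+ 2))%:E = (pi / 2)%:E)%E
  /\ leb.-integrable `[0, +oo[ (EFin \o (fun t => y / (y ^+ 2 + t ^+ 2))).
Proof.
move=> y0.
have n0 t : 0 < y ^+ 2 + t ^+ 2 by rewrite ltr_pwDl ?exprn_gt0 ?sqr_ge0.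
have dF (t : R) : is_derive t 1 (fun t => atan (y^-1 * t)) (y / (y ^+ 2 + t ^+ 2)).
  have d1 : is_derive t 1 (fun t => y^-1 * t) y^-1.
    by apply: is_derive_eq; rewrite /GRing.scale/= mulr1.
  apply: (is_derive_eq (is_derive1_comp (f := atan) (is_derive1_atan _) d1)).
  rewrite /GRing.scale/=; field.
  by rewrite !lt0r_neq0.
have cf : continuous (fun t : R => y / (y ^+ 2 + t ^+ 2)).
  move=> t; apply: cvgM; first exact: cvg_cst.
  apply: cvgV; first by rewrite gt_eqF.
  by apply: cvgD; [exact: cvg_cst|exact: exprn_continuous].
have Fl : atan (y^-1 * t) @[t --> +oo%R] --> (pi / 2 : R).
  apply: (@cvg_comp _ _ _ _ _ _ (pinfty_nbhs R)); last exact: cvgy_atan.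
  by apply: gt0_cvgMry; rewrite // invr_gt0.
have f0 t : 0 <= t -> 0 <= y / (y ^+ 2 + t ^+ 2).
  by move=> _; rewrite divr_ge0 ?ltW.
split; last exact: (ge0_integrable_itvy_is_derive f0 cf dF Fl).
by rewrite (ge0_integral_itvy_is_derive f0 cf dF Fl) mulr0 atan0 subr0.
Qed.

Lemma ler_norm_sin (x : R) : `|sin x| <= `|x|.
Proof.
have cs : continuous (@sin R) by exact: continuous_sin.
have H (y : R) : 0 <= y -> `|sin y| <= `|y|.
  move=> y0; have [c _] := @MVT_segment _ _ cos 0 y y0
    (fun x _ => is_derive_sin x) (continuous_subspaceT cs).
  by rewrite sin0 !subr0 => ->; rewrite normrM ler_piMl// ?normr_ge0// cos_max.
have [x0|/ltW x0] := leP 0 x; first exact: H.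
by rewrite -normrN -sinN -[leRHS]normrN H// oppr_ge0.
Qed.

End RealExp.

(** * Truncated sine integrals *)

Section SineIntegral.
Context {R : realType}.
Local Notation leb := (@lebesgue_measure R).
Implicit Types (N y : R).

Definition sine_integral N y := \int[leb]_(l in `]0, N]) (sin (y * l) / l).

Lemma sine_integral0 N : sine_integral N 0 = 0.
Proof.
rewrite /sine_integral; under eq_Rintegral do rewrite mul0r sin0 mul0r.
by rewrite /Rintegral integral0.
Qed.

Let sin_div_bound y l : 0 < l -> `|sin (y * l) / l| <= `|y|.
Proof.
move=> l0; rewrite normrM normfV (ger0_norm (ltW l0)) ler_pdivrMr//.
by rewrite (le_trans (ler_norm_sin _))// normrM (ger0_norm (ltW l0)).
Qed.

Let msin y : measurable_fun setT (fun l : R => sin (y * l)).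
Proof.
apply: continuous_measurable_fun => l; apply: continuous_comp.
  by apply: cvgM; [exact: cvg_cst|exact: cvg_id].
exact: continuous_sin.
Qed.

Let msin_div y N : measurable_fun `]0, N] (fun l : R => sin (y * l) / l).
Proof.
apply: measurable_funM; first exact: measurable_funTS.
exact: measurable_funV.
Qed.

Let icst N (c : R) : leb.-integrable `]0, N] (EFin \o cst c).
Proof.
apply: (@integrableS _ _ _ leb `[0, N]) => //; first exact: subset_itv_oc_cc.
apply: continuous_compact_integrable; first exact: segment_compact.
by apply: continuous_subspaceT => x; exact: cvg_cst.
Qed.

Lemma integrable_sin_div N y :
  leb.-integrable `]0, N] (EFin \o (fun l => sin (y * l) / l)).
Proof.
apply: (@integrable_dom _ _ _ leb _ (measurable_itv _) _ _ (@msin_div y N) (icst N `|y|)) => //= l.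
by rewrite in_itv/= => /andP[l0 _]; exact: sin_div_bound.
Qed.

Lemma sine_integralN N y : sine_integral N (- y) = - sine_integral N y.
Proof.
rewrite /sine_integral -[RHS]mulN1r -RintegralZl//; last exact: integrable_sin_div.
by apply: eq_Rintegral => l _; rewrite mulNr sinN mulNr mulN1r.
Qed.

(** A crude bound, meant for small |y| N, where [sine_integral_dist] is useless. *)
Lemma sine_integral_le N y : 0 <= N -> `|sine_integral N y| <= `|y| * N.
Proof.
move=> N0.
have /le_trans -> // := @normr_Rintegral_le _ _ _ leb _ (measurable_itv _) _ _
    (@msin_div y N) (icst N `|y|)
    (fun l lN => @sin_div_bound y l (proj1 (andP (etrans (esym (in_itv _ _)) lN)))).
rewrite Rintegral_cst//= lebesgue_measure_itv/= lte_fin.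
have [->|N1] := eqVneq N 0; first by rewrite ltxx mulr0.
by rewrite lt_neqAle eq_sym N1 N0/= subr0.
Qed.

(** The integrand is the imaginary part of exp(c l) with c = - t + i y, whose antiderivative is
    exp(c l) / c. *)
Lemma integral_expR_sin N y t : 0 < y -> 0 <= N ->
  \int[leb]_(l in `]0, N]) (expR (- t * l) * sin (y * l)) =
  (y - expR (- t * N) * (y * cos (y * N) + t * sin (y * N))) / (y ^+ 2 + t ^+ 2).
Proof.
move=> y0 N0; pose c : R[i] := - t +i* y.
have n0 : 0 < y ^+ 2 + t ^+ 2 by rewrite ltr_pwDl ?exprn_gt0 ?sqr_ge0.
have c0 : c != 0 by apply: complex_neq0; rewrite lt0r_neq0.
have E (l : R) : complex.Im (cexp (c * l%:C)) = expR (- t * l) * sin (y * l).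
  by rewrite Im_cexp Re_mulc Im_mulc /= !mulr0 subr0 add0r.
have E' (l : R) : complex.Re (cexp (c * l%:C)) = expR (- t * l) * cos (y * l).
  by rewrite Re_cexp Re_mulc Im_mulc /= !mulr0 subr0 add0r.
have dF (x : R) : is_cderive (fun l => c^-1 * cexp (c * l%:C)) x (cexp (c * x%:C)).
  by apply: is_cderive_eq (is_cderiveZ c^-1 (is_cderive_cexp c x)) _; rewrite mulKf.
have cf : ccontinuous (fun l : R => cexp (c * l%:C)).
  exact: is_cderive_continuous (is_cderive_cexp c).
have H : \int[leb]_(l in `[0, N]) (expR (- t * l) * sin (y * l)) =
    complex.Im (c^-1 * cexp (c * N%:C) - c^-1 * cexp (c * 0%:C)).
  rewrite -(is_cderive_cintegral N0 dF cf).
  by apply: eq_Rintegral => l _; rewrite E.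
rewrite Rintegral_itv_obnd_cbnd; last first.
  have [_ iE] := ccontinuous_cintegrable 0 N cf.
  have i2 : leb.-integrable `[0, N] (EFin \o (fun l => expR (- t * l) * sin (y * l))).
    by apply: eq_integrable iE => // x _; rewrite /comp E.
  by apply: integrableS i2 => //; exact: subset_itv_oc_cc.
rewrite H -mulrBr Im_mulc Re_addc Im_addc Re_oppc Im_oppc !E !E' Re_invc Im_invc.
by rewrite !mulr0 expR0 sin0 cos0 /=; field; rewrite lt0r_neq0// addrC.
Qed.

(* Fubini, with [1 / l] written as the integral of [expR (- l * t)] over [t >= 0]. *)
Lemma sine_integralE N y : 0 < y -> 0 <= N -> sine_integral N y =
  \int[leb]_(t in `[0, +oo[)
    ((y - expR (- t * N) * (y * cos (y * N) + t * sin (y * N))) / (y ^+ 2 + t ^+ 2)).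
Proof.
move=> y0 N0.
pose D1 : set (measurableTypeR R) := `]0, N]%classic.
pose D2 : set (measurableTypeR R) := `[0, +oo[%classic.
pose f (l t : measurableTypeR R) : R := expR (- l * t) * sin (y * l).
have mD1 : measurable D1 by exact: measurable_itv.
have mD2 : measurable D2 by exact: measurable_itv.
have mf : measurable_fun (D1 `*` D2) (fun p => f p.1 p.2).
  apply: measurable_funTS; apply: measurable_funM.
    apply: measurableT_comp => //; apply: measurable_funM => //.
    exact: measurable_funN.
  exact: (measurableT_comp (@msin y)).
have D1_gt0 l : D1 l -> 0 < l by rewrite /D1/= in_itv/= => /andP[].
(* The factor [g] is left arbitrary: it is the absolute value of the sine for integrability on the
   product, and the sine itself for the value. *)
have inner (g : R) l : D1 l -> (\int[leb]_(t in D2) (expR (- l * t) * g)%:E = (g / l)%:E)%E.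
  move=> /D1_gt0 l0; have i0 := integrable_expRNM 0 l0.
  under eq_integral do rewrite mulrC EFinM.
  by rewrite integralZl// integral_expRNM// mulr0 expR0 mulr1 -EFinM.
have isd := integrable_sin_div N y.
have fi : (leb \x leb)%E.-integrable (D1 `*` D2) (fun p => (f p.1 p.2)%:E).
  apply: integrable_prod_iter => //.
  rewrite (_ : (\int[_]_(_ in _) _)%E = (\int[leb]_(l in D1) `|(sin (y * l) / l)%R%:E|)%E); last first.
    apply: eq_integral => l /[!inE] D1l; rewrite /= normrM normfV (ger0_norm (ltW (D1_gt0 _ D1l))).
    rewrite -inner//; apply: eq_integral => t _.
    by rewrite /f normrM (ger0_norm (expR_ge0 _)).
  by have /integrableP[] := isd.
have := Rfubini mD1 mD2 fi.
rewrite (_ : Rintegral _ _ _ = sine_integral N y); last first.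
  by apply: eq_Rintegral => l /[!inE] D1l; rewrite {1}/Rintegral inner.
move=> ->; apply: eq_Rintegral => t _.
rewrite -integral_expR_sin//; apply: eq_Rintegral => l _.
by rewrite /f; congr (expR _ * _); rewrite !mulNr [in LHS]mulrC.
Qed.

(** In [sine_integralE] the undamped part is the Poisson integral, equal to pi / 2. What remains is
    the damped part [g], at most (2 / y) exp(- N t), which integrates to 2 / (y N). *)
Lemma sine_integral_dist N y : 0 < y -> 0 < N ->
  `|sine_integral N y - pi / 2| <= 2 / (y * N).
Proof.
move=> y0 N0; have [poi ipoi] := integral_poisson y0.
have n0 t : 0 < y ^+ 2 + t ^+ 2 by rewrite ltr_pwDl ?exprn_gt0 ?sqr_ge0.
have -> : pi / 2 = \int[leb]_(t in `[0, +oo[) (y / (y ^+ 2 + t ^+ 2)).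
  by rewrite /Rintegral poi.
pose g (t : R) := expR (- N * t) * ((y * cos (y * N) + t * sin (y * N)) / (y ^+ 2 + t ^+ 2)).
have cg : continuous g.
  move=> t; apply: cvgM; first exact: is_derive_continuous (is_derive_expRM _) _.
  apply: cvgM; first by apply: cvgD; [exact: cvg_cst|apply: cvgM; [exact: cvg_id|exact: cvg_cst]].
  apply: cvgV; first by rewrite lt0r_neq0.
  by apply: cvgD; [exact: cvg_cst|exact: exprn_continuous].
have mg : measurable_fun (`[0, +oo[ : set (measurableTypeR R)) g.
  by apply: measurable_funTS; exact: continuous_measurable_fun.
have ih : leb.-integrable `[0, +oo[ (EFin \o (fun t => 2 / y * expR (- N * t))).
  have ie := @integrableZl _ _ _ leb `[0, +oo[%classic (measurable_itv _) (2 / y) _ (integrable_expRNM 0 N0).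
  by apply: eq_integrable ie.
have gh t : `[0, +oo[%classic t -> `|g t| <= 2 / y * expR (- N * t).
  rewrite /= in_itv/= andbT => t0.
  rewrite /g normrM (ger0_norm (expR_ge0 _)) [leRHS]mulrC ler_wpM2l ?expR_ge0//.
  rewrite normrM normfV (gtr0_norm (n0 _)) ler_pdivrMr//.
  apply: (@le_trans _ _ (y + t)).
    rewrite (le_trans (ler_normD _ _))// !normrM (gtr0_norm y0) (ger0_norm t0) lerD//.
      by rewrite ler_piMr ?cos_max// ltW.
    by rewrite ler_piMr ?sin_max.
  rewrite mulrAC ler_pdivlMr// -subr_ge0.
  (* The claim (y + t) / (y^2 + t^2) <= 2 / y becomes the nonnegativity of a sum of squares. *)
  have -> : 2 * (y ^+ 2 + t ^+ 2) - (y + t) * y = (y - t) ^+ 2 / 2 + y ^+ 2 / 2 + 3 / 2 * t ^+ 2 by field.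
  by have := sqr_ge0 (y - t); have := sqr_ge0 y; have := sqr_ge0 t; lra.
have ig := @integrable_dom _ _ _ leb _ (measurable_itv _) _ _ mg ih gh.
rewrite (sine_integralE y0 (ltW N0)) distrC.
have -> : \int[leb]_(t in `[0, +oo[) ((y - expR (- t * N) * (y * cos (y * N) + t * sin (y * N))) / (y ^+ 2 + t ^+ 2))
   = \int[leb]_(t in `[0, +oo[) (y / (y ^+ 2 + t ^+ 2) - g t).
  apply: eq_Rintegral => t _; rewrite /g mulrA -mulrBl; congr ((_ - expR _ * _) / _).
  by rewrite !mulNr [in LHS]mulrC.
rewrite RintegralB// opprB addrC subrK.
apply: (le_trans (@normr_Rintegral_le _ _ _ leb _ (measurable_itv _) _ _ mg ih gh)).
rewrite RintegralZl//; last exact: integrable_expRNM.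
by rewrite /Rintegral integral_expRNM//= mulr0 expR0 mulr1 -mulrA -invfM.
Qed.

(** Uniformity in both variables comes from splitting at y N = 1: below it the crude bound is at
    most 1, above it the distance to pi / 2 is at most 2. Oddness in [y] does the rest. *)
Lemma sine_integral_bound N y : 0 < N -> `|sine_integral N y| <= pi / 2 + 2.
Proof.
have pi0 : 0 <= pi / 2 :> R by rewrite divr_ge0// pi_ge0.
have H z : 0 < z -> 0 < N -> `|sine_integral N z| <= pi / 2 + 2.
  move=> z0 N0; have [zN|zN] := leP (z * N) 1.
    rewrite (le_trans (sine_integral_le _ (ltW N0)))// (gtr0_norm z0) (le_trans zN)//.
    by move: pi0; lra.
  rewrite -[X in `|X|](subrK (pi / 2)) (le_trans (ler_normD _ _))//.
  rewrite addrC (ger0_norm pi0) lerD2l (le_trans (sine_integral_dist z0 N0))//.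
  by rewrite ler_pdivrMr ?mulr_gt0// ler_peMr// ltW.
move=> N0; have [y0|y0|<-] := ltgtP 0 y; first exact: H.
  by rewrite -[y]opprK sine_integralN normrN H// oppr_gt0.
by rewrite sine_integral0 normr0 addr_ge0.
Qed.

Lemma cvg_sine_integral y : sine_integral N y @[N --> +oo%R] --> Num.sg y * (pi / 2).
Proof.
have H z : 0 < z -> sine_integral N z @[N --> +oo%R] --> pi / 2.
  move=> z0; apply/cvgrPdist_le => e e0.
  apply: filterS2 (nbhs_pinfty_gt (num_real 0)) (nbhs_pinfty_ge (num_real ((z * e)^-1 * 2))).
  move=> N N0 Ne; rewrite distrC (le_trans (sine_integral_dist z0 N0))//.
  by rewrite ler_pdivrMr ?mulr_gt0// mulrA (mulrC e) -ler_pdivrMl ?mulr_gt0.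
have [y0|y0|<-] := ltgtP 0 y.
- by rewrite gtr0_sg// mul1r; exact: H.
- rewrite ltr0_sg// mulN1r -[y]opprK; under eq_fun do rewrite sine_integralN.
  by apply: cvgN; apply: H; rewrite oppr_gt0.
- by rewrite sgr0 mul0r; under eq_fun do rewrite sine_integral0; exact: cvg_cst.
Qed.

End SineIntegral.

(** * The oscillatory integral of order zero *)

Section HalfLineExp.
Context {R : realType}.
Local Notation leb := (@lebesgue_measure R).
Implicit Types (w z : R[i]) (a x u : R).

Lemma normc_cexpi w u : normc (cexp ('i * w * u%:C)) = expR (- complex.Im w * u).
Proof.
by rewrite normc_cexp; congr expR; case: w => p q /=; ring.
Qed.

Lemma ccontinuous_cexp w : ccontinuous (fun u : R => cexp (w * u%:C)).
Proof. exact: is_cderive_continuous (is_cderive_cexp w). Qed.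

Lemma cintegrable_cexpi w a : 0 < complex.Im w ->
  cintegrable leb `[a, +oo[ (fun u : R => cexp ('i * w * u%:C)).
Proof.
move=> w0; apply: (cintegrable_dom _ _ (integrable_expRNM a w0)) => //.
  exact: ccontinuous_cmeasurable (ccontinuous_cexp _).
by move=> u _; rewrite normc_cexpi.
Qed.

Lemma cintegral_cexpi w a : 0 < complex.Im w ->
  cintegral leb `[a, +oo[ (fun u : R => cexp ('i * w * u%:C)) = 'i / w * cexp ('i * w * a%:C).
Proof.
move=> w0; have wn0 : w != 0 by apply: complex_neq0; rewrite lt0r_neq0.
have i0 : ('i : R[i]) != 0 by rewrite -normr_gt0 normr_normc normc_i ltcR.
have iw0 : 'i * w != 0 by rewrite mulf_neq0.
have dF (u : R) : is_cderive (fun u => ('i * w)^-1 * cexp ('i * w * u%:C)) u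
    (cexp ('i * w * u%:C)).
  by apply: is_cderive_eq (is_cderiveZ _ (is_cderive_cexp _ u)) _; rewrite mulKf.
rewrite (is_cderive_cintegral_itvy dF (ccontinuous_cexp _) (cintegrable_cexpi _ w0)).
  rewrite -mulNr; congr (_ * _); rewrite invfM -mulNr; congr (_ / _).
  by apply: (mulfI i0); rewrite mulrN mulfV// -expr2 sqr_i.
apply: (@ccvgy_norm0 _ _ (fun u => normc ('i * w)^-1 * expR (- complex.Im w * u))).
  by apply: nearW => u; rewrite Normc.normcM normc_cexpi.
by rewrite -[X in _ --> X](mulr0 (normc ('i * w)^-1)); apply: cvgM; [exact: cvg_cst|exact: cvgy_expRNM].
Qed.

End HalfLineExp.

Section Symmetrize.
Context {R : realType}.
Local Notation leb := (@lebesgue_measure R).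

Lemma Rintegral_sym (f : R -> R) (N : R) : 0 <= N -> continuous f ->
  \int[leb]_(l in `[- N, N]) f l = \int[leb]_(l in `]0, N]) (f l + f (- l)).
Proof.
move=> N0 cf.
have ci (g : R -> R) a b : continuous g -> leb.-integrable `[a, b] (EFin \o g).
  move=> cg; apply: continuous_compact_integrable; first exact: segment_compact.
  exact: continuous_subspaceT.
have cfN : continuous (fun l => f (- l)).
  by move=> l; apply: continuous_comp; [exact: cvgN|exact: cf].
rewrite (_ : `[- N, N]%classic = `[- N, 0]%classic `|` `]0, N]%classic); last first.
  by rewrite -itv_bndbnd_setU// bnd_simp ?oppr_le0.
rewrite Rintegral_setU//; last 2 first.
- rewrite -itv_bndbnd_setU ?bnd_simp ?oppr_le0//; exact: ci.
- apply/disj_set2P; rewrite -subset0 => x [] /=; rewrite !in_itv/= => /andP[_ x0] /andP[].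
  by rewrite ltNge x0.
rewrite Rintegral_itv_obnd_cbnd; last by apply: integrableS (ci _ 0 N cf) => //; exact: subset_itv_oc_cc.
rewrite Rintegral_itv_obnd_cbnd; last first.
  by apply: integrableS (ci _ 0 N (fun l => cvgD (cf l) (cfN l))) => //; exact: subset_itv_oc_cc.
rewrite RintegralD//; [|exact: ci|exact: ci].
rewrite addrC; congr (_ + _).
rewrite /Rintegral -{1}oppr0 integration_by_substitution_oppr//.
exact: continuous_subspaceT.
Qed.

Lemma cintegral_sym (f : R -> R[i]) (N : R) : 0 <= N -> ccontinuous f ->
  cintegral leb `[- N, N] f = cintegral leb `]0, N] (fun l => f l + f (- l)).
Proof.
move=> N0 [f1 f2]; apply: complex_ext => /=; rewrite Rintegral_sym//;
  by apply: eq_Rintegral => l _; rewrite ?Re_addc ?Im_addc.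
Qed.

(** Nothing is asked at the point [c], which is null: it will be the jump of the limit of the sine
    integrals, where the sign function takes the value 0. *)
Lemma Rintegral_tail (f g : R -> R) (a c : R) : a <= c ->
  measurable_fun (`[a, +oo[ : set (measurableTypeR R)) f ->
  measurable_fun (`[c, +oo[ : set (measurableTypeR R)) g ->
  (forall u, a <= u -> u < c -> f u = 0) -> (forall u, c < u -> f u = g u) ->
  \int[leb]_(u in `[a, +oo[) f u = \int[leb]_(u in `[c, +oo[) g u.
Proof.
move=> ac mf mg f0 fg; rewrite [LHS]Rintegral_mkcond [RHS]Rintegral_mkcond.
rewrite /Rintegral; congr fine; apply: ae_eq_integral => //.
- by apply/measurable_EFinP; exact: (measurable_restrictT f _).1.
- by apply/measurable_EFinP; exact: (measurable_restrictT g _).1.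
exists [set c]; split => //; first exact: lebesgue_measure_set1.
move=> u /= H; apply: contrapT => uc; apply: H => _; rewrite !patchE !mem_setE !in_itv/= !andbT.
have [cu|uc'|cu] := ltgtP c u.
- by rewrite (le_trans ac (ltW cu)) fg.
- by case: ifP => // au; rewrite f0.
- by case: uc; rewrite cu.
Qed.

End Symmetrize.

(** * The limit in the upper half-plane, and conjugation *)

Section Oscillatory.
Context {R : realType}.
Local Notation leb := (@lebesgue_measure R).
Implicit Types (z : R[i]) (x N l u : R).

(** This is [J_0 N x]. The integrand decays only like 1/|l|, so neither its boundedness nor its
    convergence follows from absolute estimates. *)
Definition oscillatory z x N : R[i] :=
  cintegral leb `[- N, N] (fun l => cexp (- 'i * x%:C * l%:C) / (l%:C + z)).

(* The value at [0] accounts for the half atom removed in [carleman_transform]. *)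
Definition carleman_kernel z x : R[i] :=
  if 0 < complex.Im z then
    if 0 < x then cexp ('i * x%:C * z) else if x == 0 then 2^-1 else 0
  else
    if x < 0 then - cexp ('i * x%:C * z) else if x == 0 then - 2^-1 else 0.

Lemma ler_sinB (a b : R) : `|sin a - sin b| <= `|a - b|.
Proof.
wlog ab : a b / b <= a.
  by move=> H; have /orP[/H//|/H] := le_total b a; rewrite distrC [leRHS]distrC.
have cs : continuous (@sin R) by exact: continuous_sin.
have [c _ ->] := @MVT_segment _ _ cos b a ab
    (fun x _ => is_derive_sin x) (continuous_subspaceT cs).
by rewrite normrM ler_piMl// ?normr_ge0// cos_max.
Qed.

Lemma cexpi_sub (a : R) : cexp ('i * a%:C) - cexp (- ('i * a%:C)) = 2 * 'i * (sin a)%:C.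
Proof.
apply: complex_ext.
  rewrite Re_addc Re_oppc !Re_cexp /= !(mul0r, mul1r, mulr0, subr0, addr0, add0r, oppr0, sub0r).
  by rewrite cosN; ring.
rewrite Im_addc Im_oppc !Im_cexp /= !(mul0r, mul1r, mulr0, subr0, addr0, add0r, oppr0, sub0r).
by rewrite sinN expR0; ring.
Qed.

Section UpperHalfPlane.
Variables (z : R[i]) (x : R).
Hypothesis z0 : 0 < complex.Im z.

Let zn0 : complex.Im z != 0. Proof. by rewrite lt0r_neq0. Qed.

Let D2 : set (measurableTypeR R) := `[0, +oo[%classic.
Let D1 N : set (measurableTypeR R) := `]0, N]%classic.

(* From [1 / (l + z) = - z * int_0^oo e^(iuz) (e^(iul) - 1) / (il) du], symmetrized
   under [l -> - l] so that the singularity at [l = 0] cancels. *)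
Let f (l u : measurableTypeR R) : R[i] := (- 2 * z * cexp ('i * z * u%:C)) *
  ((sin ((u - x) * l) + sin (x * l)) / l)%:C.

Let D1_gt0 N l : D1 N l -> 0 < l.
Proof. by rewrite /D1/= in_itv/= => /andP[]. Qed.

Let mf N : cmeasurable (D1 N `*` D2) (fun p => f p.1 p.2).
Proof.
apply: (cmeasurableS measurableT) => //; apply: cmeasurableM.
  apply: cmeasurableM; first exact: cmeasurable_cst.
  apply: cmeasurable_cexp; apply: cmeasurableM; first exact: cmeasurable_cst.
  exact: cmeasurable_real.
have msin : measurable_fun [set: R] (@sin R).
  by apply: continuous_measurable_fun; exact: continuous_sin.
apply: cmeasurable_real; apply: measurable_funM; last exact: measurable_funV.
apply: measurable_funD; apply: (measurableT_comp msin); apply: measurable_funM => //.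
exact: measurable_funB.
Qed.

Let h (u : R) := 2 * normc z * (u * expR (- complex.Im z * u)).

Let ih : leb.-integrable D2 (EFin \o h).
Proof.
have mD2 : measurable D2 by exact: measurable_itv.
have i1 := @integrableZl _ _ _ leb D2 mD2 (2 * normc z) _ (integrable_mul_expRNM z0).
by apply: eq_integrable i1.
Qed.

Let i1 N : leb.-integrable (D1 N) (EFin \o cst (1 : R)).
Proof.
rewrite /D1; apply: (@integrableS _ _ _ leb `[0, N]) => //; first exact: subset_itv_oc_cc.
apply: continuous_compact_integrable; first exact: segment_compact.
by apply: continuous_subspaceT => t; exact: cvg_cst.
Qed.

(** The two sines must be estimated together: their sum is sin((u - x) l) - sin(- x l), at most u l
    in modulus. Dividing by l leaves a bound free of both [l] and [x]. *)
Let fh N l u : D1 N l -> D2 u -> normc (f l u) <= cst (1 : R) l * h u.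
Proof.
move=> /D1_gt0 l0; rewrite /D2/= in_itv/= andbT => u0.
rewrite /f Normc.normcM normc_real Normc.normcM normc_cexpi Normc.normcM /cst mul1r /h normcN.
rewrite (_ : Normc.normc (2 : R[i]) = 2); last first.
  by rewrite -[2 : R[i]](rmorph_nat (real_complex R)) normc_real ger0_norm.
rewrite [u * _]mulrC !mulrA ler_wpM2l//.
  by rewrite !mulr_ge0// ?normc_ge0 ?expR_ge0.
rewrite normrM normfV (gtr0_norm l0) ler_pdivrMr//.
rewrite -[X in _ + X]opprK -sinN -mulNr (le_trans (ler_sinB _ _))//.
by rewrite mulNr opprK -mulrDl subrK normrM (gtr0_norm l0) (ger0_norm u0).
Qed.

(** With the sines written as exponentials, [f l] combines [E] at l + z, - l + z and z, all of
    imaginary part Im z > 0. The result follows from - (z / l) (1 / (l + z) - 1 / z) = 1 / (l + z),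
    and from the same identity at - l. *)
Let inner_u l : 0 < l -> cintegral leb D2 (f l) =
  cexp (- 'i * x%:C * l%:C) / (l%:C + z) + cexp (- 'i * x%:C * (- l)%:C) / ((- l)%:C + z).
Proof.
move=> l0; have mD2 : measurable D2 by exact: measurable_itv.
have ln0 : l%:C != 0 by rewrite eq_complex/= eqxx andbT gt_eqF.
have zl : l%:C + z != 0 by exact: real_add_neq0.
have zl' : (- l)%:C + z != 0 by exact: real_add_neq0.
have zz : z != 0 by exact: complex_neq0.
have in0 : ('i : R[i]) != 0 by rewrite -normr_gt0 normr_normc normc_i ltcR.
pose e : R[i] := cexp (- 'i * x%:C * l%:C).
pose e' : R[i] := cexp (- 'i * x%:C * (- l)%:C).
pose E (w : R[i]) (u : R) := cexp ('i * w * u%:C).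
pose c : R[i] := - z / ('i * l%:C).
have fE u : f l u = c * e * E (l%:C + z) u - c * e' * E ((- l)%:C + z) u
    + c * (e' - e) * E z u.
  rewrite /f (_ : ((sin ((u - x) * l) + sin (x * l)) / l)%:C =
    (2 * 'i * (sin ((u - x) * l))%:C + 2 * 'i * (sin (x * l))%:C) / (2 * 'i * l%:C)); last first.
    rewrite -mulrDr -rmorphD/= -mulf_div divff ?mul1r; last by rewrite mulf_neq0 ?pnatr_eq0.
    by rewrite -fmorphV -rmorphM.
  rewrite -!cexpi_sub.
  have -> : cexp ('i * ((u - x) * l)%:C) = e * cexp ('i * (u * l)%:C).
    by rewrite /e -cexpD !rmorphM rmorphB/=; congr cexp; ring.
  have -> : cexp (- ('i * ((u - x) * l)%:C)) = e' * cexp (- ('i * (u * l)%:C)).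
    by rewrite /e' -cexpD !rmorphM rmorphB rmorphN/=; congr cexp; ring.
  have -> : cexp ('i * (x * l)%:C) = e'.
    by rewrite /e' !rmorphM rmorphN/=; congr cexp; ring.
  have -> : cexp (- ('i * (x * l)%:C)) = e.
    by rewrite /e !rmorphM/=; congr cexp; ring.
  have -> : E (l%:C + z) u = cexp ('i * (u * l)%:C) * E z u.
    by rewrite /E -cexpD !rmorphM/=; congr cexp; ring.
  have -> : E ((- l)%:C + z) u = cexp (- ('i * (u * l)%:C)) * E z u.
    by rewrite /E -cexpD !rmorphM rmorphN/=; congr cexp; ring.
  rewrite -/(E z u) /c; field.
  by rewrite in0 ln0.
have iE w : complex.Im w = complex.Im z -> cintegrable leb D2 (E w).
  by move=> wz; apply: cintegrable_cexpi; rewrite wz.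
have Ezl : complex.Im (l%:C + z) = complex.Im z by rewrite Im_addc /= add0r.
have Ezl' : complex.Im ((- l)%:C + z) = complex.Im z by rewrite Im_addc /= add0r.
have -> : cintegral leb D2 (f l) = cintegral leb D2 (fun u =>
    c * e * E (l%:C + z) u - c * e' * E ((- l)%:C + z) u + c * (e' - e) * E z u).
  by apply: eq_cintegral => u _; exact: fE.
rewrite cintegralD//; last 2 first.
- apply: cintegrableD => //; first by apply: cintegrableZ => //; exact: iE.
  under eq_fun do rewrite -mulNr.
  by apply: cintegrableZ => //; exact: iE.
- by apply: cintegrableZ => //; exact: iE.
rewrite cintegralB//; last 2 first.
- by apply: cintegrableZ => //; exact: iE.
- by apply: cintegrableZ => //; exact: iE.
rewrite !cintegralZ//; last 3 first.
- exact: iE.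
- exact: iE.
- exact: iE.
have V w : complex.Im w = complex.Im z -> cintegral leb D2 (E w) = 'i / w.
  by move=> wz; rewrite cintegral_cexpi ?wz// mulr0 cexp0 mulr1.
rewrite !V// -/e -/e' /c rmorphN/=; rewrite rmorphN/= in zl'; field.
by rewrite in0 ln0 zz zl zl'.
Qed.

Let inner_l N u : 0 < N -> cintegral leb (D1 N) (f ^~ u) =
  - 2 * z * cexp ('i * z * u%:C) * (sine_integral N (u - x) + sine_integral N x)%:C.
Proof.
move=> N0; have mD1 : measurable (D1 N) by exact: measurable_itv.
have is1 := integrable_sin_div N (u - x); have is2 := integrable_sin_div N x.
have is12 : leb.-integrable (D1 N) (EFin \o (fun l => (sin ((u - x) * l) + sin (x * l)) / l)).
  apply: eq_integrable (integrableD mD1 is1 is2) => // l _.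
  by rewrite /= -EFinD -mulrDl.
rewrite cintegralZ//; last exact: cintegrable_real.
rewrite cintegral_real; congr (_ * _%:C).
by rewrite -RintegralD//; apply: eq_Rintegral => l _; rewrite mulrDl.
Qed.

Lemma oscillatoryE N : 0 < N -> oscillatory z x N = cintegral leb D2 (fun u =>
  - 2 * z * cexp ('i * z * u%:C) * (sine_integral N (u - x) + sine_integral N x)%:C).
Proof.
move=> N0; have cf : ccontinuous (fun l => cexp (- 'i * x%:C * l%:C) / (l%:C + z)).
  apply: is_cderive_continuous => l.
  exact: is_cderiveM (is_cderive_cexp _ l) (is_cderive_shiftVX 0 l zn0).
rewrite /oscillatory (cintegral_sym (ltW N0) cf).
have mD1 : measurable (D1 N) by exact: measurable_itv.
have mD2 : measurable D2 by exact: measurable_itv.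
transitivity (cintegral leb (D1 N) (fun l => cintegral leb D2 (f l))).
  by apply: eq_cintegral => l D1l; rewrite inner_u//; exact: D1_gt0 D1l.
rewrite (cfubini mD1 mD2 (@mf N) (@i1 N) ih (@fh N)).
by apply: eq_cintegral => u _; exact: inner_l.
Qed.

Let sine_bound : R := 2 * (pi / 2 + 2).

Let F_bound N u : 0 < N ->
  normc (- 2 * z * cexp ('i * z * u%:C) * (sine_integral N (u - x) + sine_integral N x)%:C)
  <= 2 * normc z * sine_bound * expR (- complex.Im z * u).
Proof.
move=> N0; rewrite Normc.normcM normc_real Normc.normcM normc_cexpi Normc.normcM normcN.
rewrite (_ : Normc.normc (2 : R[i]) = 2); last first.
  by rewrite -[2 : R[i]](rmorph_nat (real_complex R)) normc_real ger0_norm.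
rewrite mulrAC ler_wpM2r ?expR_ge0// ler_wpM2l ?mulr_ge0 ?normc_ge0//.
rewrite (le_trans (ler_normD _ _))// /sine_bound mulrDl mul1r lerD//; exact: sine_integral_bound.
Qed.

Let iF_bound : leb.-integrable D2
  (EFin \o (fun u => 2 * normc z * sine_bound * expR (- complex.Im z * u))).
Proof.
have mD2 : measurable D2 by exact: measurable_itv.
have i2 := @integrableZl _ _ _ leb D2 mD2 (2 * normc z * sine_bound) _ (integrable_expRNM 0 z0).
by apply: eq_integrable i2.
Qed.

(** Measurability in [u] of the sine integrals is read off from Fubini, without studying their
    regularity. *)
Let mF N : 0 < N -> cmeasurable D2 (fun u =>
  - 2 * z * cexp ('i * z * u%:C) * (sine_integral N (u - x) + sine_integral N x)%:C).
Proof.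
move=> N0; have mD1 : measurable (D1 N) by exact: measurable_itv.
have mD2 : measurable D2 by exact: measurable_itv.
have := cintegrable_cmeasurable (cfubini_integrable2 mD1 mD2 (@mf N) (@i1 N) ih (@fh N)).
by under eq_fun do rewrite inner_l//.
Qed.

Lemma oscillatory_bound_upper N : 0 < N -> normc (oscillatory z x N) <=
  2 * (2 * normc z * (2 * (pi / 2 + 2)) * (complex.Im z)^-1).
Proof.
move=> N0; have mD2 : measurable D2 by exact: measurable_itv.
rewrite oscillatoryE//.
apply: (le_trans (normc_cintegral_le mD2 (mF N0) iF_bound (fun u _ => F_bound u N0))).
rewrite RintegralZl//; last exact: integrable_expRNM.
by rewrite /Rintegral integral_expRNM//= mulr0 expR0 mulr1.
Qed.

(** In the limit the sine integrals leave (pi / 2) (sg(u - x) + sg x). For x > 0 this is 0 on u < x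
    and pi on u > x; for x < 0 it vanishes for every u >= 0; for x = 0 only sg u survives, which is
    the origin of the half atom. *)
Lemma cvg_oscillatory_upper :
  ccvgy (oscillatory z x) (- 2 * 'i * pi%:C * carleman_kernel z x).
Proof.
have mD2 : measurable D2 by exact: measurable_itv.
have zz : z != 0 by exact: complex_neq0.
pose E (u : R) := cexp ('i * z * u%:C).
pose phi (u : R) := - 2 * z * E u * (Num.sg (u - x) * (pi / 2) + Num.sg x * (pi / 2))%:C.
have mE : cmeasurable setT (E : measurableTypeR R -> R[i]).
  exact: ccontinuous_cmeasurable (ccontinuous_cexp _).
have msg : measurable_fun setT (fun u : R => Num.sg (u - x)).
  rewrite /Num.sg; apply: measurable_fun_if => //.
    apply: (measurable_fun_bool true).
    rewrite setTI (_ : _ @^-1` _ = [set x])//.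
    by apply/seteqP; split => u /=; rewrite subr_eq0 => /eqP.
  apply: measurable_funTS; apply: measurable_fun_if => //.
  apply: (measurable_fun_bool true).
  rewrite setTI (_ : _ @^-1` _ = `]-oo, x[%classic)//.
  by apply/seteqP; split => u /=; rewrite in_itv/= subr_lt0.
have mphi : cmeasurable setT (phi : measurableTypeR R -> R[i]).
  apply: cmeasurableM.
    by apply: cmeasurableM => //; exact: cmeasurable_cst.
  apply: cmeasurable_real; apply: measurable_funD => //.
  exact: measurable_funM.
have iE a c : cintegral leb `[a, +oo[ (fun u => c * E u) = c * ('i / z) * cexp ('i * z * a%:C).
  by rewrite cintegralZ ?cintegral_cexpi ?mulrA//; exact: cintegrable_cexpi.
(* Common form of the three cases: [phi] is 0 before [c] and a multiple of [E] after it. Here [k] is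
   that complex multiple. *)
have tail c k : 0 <= c -> (forall u, 0 <= u -> u < c -> phi u = 0) ->
    (forall u, c < u -> phi u = k * E u) ->
    cintegral leb D2 phi = k * ('i / z) * cexp ('i * z * c%:C).
  move=> c0 phi0 phik; rewrite -iE.
  have [m1 m2] := cmeasurableS (E := setT) measurableT (@subsetT _ D2) mphi.
  have [n1 n2] : cmeasurable (`[c, +oo[%classic : set (measurableTypeR R)) (fun u => k * E u).
    apply: (cmeasurableS (E := setT)) => //.
    by apply: cmeasurableM => //; exact: cmeasurable_cst.
  by apply: complex_ext => /=; apply: Rintegral_tail => // u; [move=> u0 uc; rewrite phi0
    |move=> cu; rewrite phik|move=> u0 uc; rewrite phi0|move=> cu; rewrite phik].
have -> : - 2 * 'i * pi%:C * carleman_kernel z x = cintegral leb D2 phi.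
  rewrite /carleman_kernel z0; case: ltgtP => x0.
  - rewrite (@tail x (- 2 * z * pi%:C)) ?ltW//.
    + rewrite (_ : 'i * z * x%:C = 'i * x%:C * z); last by ring.
      by set e := cexp _; field.
    + by move=> u u0 ux; rewrite /phi (gtr0_sg x0) ltr0_sg ?subr_lt0// mulN1r mul1r addNr mulr0.
    + move=> u xu; rewrite /phi (gtr0_sg x0) gtr0_sg ?subr_gt0// !mul1r -splitr; ring.
  - rewrite mulr0 (@tail 0 0) ?mul0r//.
    + by move=> u u0 /(le_lt_trans u0); rewrite ltxx.
    + by move=> u u0; rewrite /phi (ltr0_sg x0) gtr0_sg ?subr_gt0 ?(lt_trans x0)// mulN1r mul1r subrr mulr0 mul0r.
  - rewrite (@tail 0 (- 2 * z * (pi / 2)%:C))//.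
    + by rewrite mulr0 cexp0 rmorphM fmorphV rmorph_nat/=; field.
    + by move=> u u0 /(le_lt_trans u0); rewrite ltxx.
    + move=> u u0; rewrite /phi -x0 subr0 (gtr0_sg u0) sgr0 mul1r mul0r addr0; ring.
apply: (@ccvgy_near _ (fun N => cintegral leb D2 (fun u =>
    - 2 * z * cexp ('i * z * u%:C) * (sine_integral N (u - x) + sine_integral N x)%:C))).
  by apply: filterS (nbhs_pinfty_gt (num_real 0)) => N N0; rewrite oscillatoryE.
apply: (dominated_ccvgy mD2 mF _ iF_bound) => //.
- exact: (cmeasurableS (E := setT)).
- by move=> N u N0 _; exact: F_bound.
- move=> u _; apply: ccvgyM; first exact: ccvgy_cst.
  split => /=; last exact: cvg_cst.
  by apply: cvgD; exact: cvg_sine_integral.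
Qed.

End UpperHalfPlane.

Lemma oscillatoryJ z x N : complex.Im z != 0 -> oscillatory z x N = conjc (oscillatory (conjc z) (- x) N).
Proof.
move=> zn0; rewrite /oscillatory -cintegralJ//.
  apply: eq_cintegral => l _; rewrite conjcM conjcV conjcD conjcK conjc_real conjc_cexp.
  by congr (cexp _ / _); rewrite !conjcM conjcN !conjc_real conjc_i rmorphN; ring.
apply: ccontinuous_cintegrable; apply: is_cderive_continuous => l.
apply: is_cderiveM (is_cderive_cexp _ l) (is_cderive_shiftVX 0 l _).
by rewrite Im_conjc oppr_eq0.
Qed.

(** The minus sign compensates the conjugation of the factor - 2 i pi in the limit; it is the sign
    in the definition of [F_-]. *)
Lemma carleman_kernelJ z x : complex.Im z != 0 ->
  carleman_kernel z x = - conjc (carleman_kernel (conjc z) (- x)).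
Proof.
move=> zn0; rewrite /carleman_kernel Im_conjc oppr_gt0 oppr_gt0 oppr_lt0 oppr_eq0.
have E : conjc (cexp ('i * (- x)%:C * conjc z)) = cexp ('i * x%:C * z).
  by rewrite conjc_cexp !conjcM conjcK conjc_real conjc_i rmorphN/= mulrNN.
have E2 : (conjc (2^-1 : R[i])) = 2^-1 by rewrite conjcV conjc_nat.
have [z0|z0|z0] := ltgtP 0 (complex.Im z); last by rewrite -z0 eqxx in zn0.
- by case: ltgtP => x0; rewrite ?conjcN ?opprK ?E ?E2 ?conjc0 ?oppr0.
- by case: ltgtP => x0; rewrite ?conjcN ?opprK ?E ?E2 ?conjc0 ?oppr0.
Qed.

Lemma oscillatory_bound z : complex.Im z != 0 ->
  exists C, forall x N, 0 < N -> normc (oscillatory z x N) <= C.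
Proof.
move=> zn0; have [z0|z0|z0] := ltgtP 0 (complex.Im z).
- by eexists => x N; exact: oscillatory_bound_upper.
- eexists => x N N0; rewrite oscillatoryJ// normc_conjc.
  by apply: oscillatory_bound_upper; rewrite // Im_conjc oppr_gt0.
- by rewrite -z0 eqxx in zn0.
Qed.

Lemma cvg_oscillatory z x : complex.Im z != 0 ->
  ccvgy (oscillatory z x) (- 2 * 'i * pi%:C * carleman_kernel z x).
Proof.
move=> zn0; have [z0|z0|z0] := ltgtP 0 (complex.Im z).
- exact: cvg_oscillatory_upper.
- have z'0 : 0 < complex.Im (conjc z) by rewrite Im_conjc oppr_gt0.
  have := ccvgyJ (cvg_oscillatory_upper (- x) z'0).
  under eq_fun do rewrite -oscillatoryJ//.
  rewrite (carleman_kernelJ x zn0) !conjcM conjcN conjc_i conjc_real conjc_nat.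
  by rewrite mulrN !mulNr !mulrN !opprK.
- by rewrite -z0 eqxx in zn0.
Qed.

End Oscillatory.

(** * Bochner kernels *)

Section BochnerKernel.
Context {R : realType}.
Local Notation leb := (@lebesgue_measure R).
Implicit Types (z : R[i]) (x N l : R) (k : nat).

Lemma fact_neq0 k : (k`!%:R : R[i]) != 0.
Proof. by rewrite pnatr_eq0 -lt0n fact_gt0. Qed.

Lemma mulNi_neq0 x : x != 0 -> (- 'i * x%:C : R[i]) != 0.
Proof.
move=> x0; rewrite mulf_neq0 ?oppr_eq0//; first by rewrite -normr_gt0 normr_normc normc_i ltcR.
by rewrite eq_complex/= eqxx andbT.
Qed.

Lemma normc_cexpNi x l : normc (cexp (- 'i * x%:C * l%:C)) = 1.
Proof. by rewrite normc_cexp -expR0; congr expR => /=; ring. Qed.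

Lemma normc_Ni x : normc (- 'i * x%:C) = `|x|.
Proof. by rewrite Normc.normcM normcN normc_i mul1r normc_real. Qed.

Lemma bochner_kernel0 x l : bochner_kernel 0 x l = cexp (- 'i * x%:C * l%:C).
Proof.
rewrite /bochner_kernel /bochner_poly big_nil if_same subr0 !expr0 divr1.
case: ifP => [/eqP ->|_]; last by rewrite divr1.
by rewrite mulr0 mul0r cexp0.
Qed.

Lemma is_cderive_bochner_poly k x l :
  is_cderive (bochner_poly k.+1 x) l (- 'i * x%:C * bochner_poly k x l).
Proof.
rewrite /bochner_poly; case: ifP => _; last by rewrite mulr0; exact: is_cderive_cst.
elim: k => [|k IH].
  rewrite big_nil mulr0; under eq_fun do rewrite big_nat1 expr0.
  exact: is_cderive_cst.
rewrite big_nat_recr//= mulrDr; under eq_fun do rewrite big_nat_recr//=.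
apply: is_cderiveD => //.
under eq_fun do rewrite mulrC.
have d1 := is_cderiveX k (is_cderiveZ (- 'i * x%:C) (is_cderive_real l)).
apply: is_cderive_eq (is_cderiveZ (k.+1`!%:R)^-1 d1) _.
by rewrite factS natrM; field; rewrite fact_neq0 addrC natr1 pnatr_eq0.
Qed.

Lemma is_cderive_bochner_kernel k x l :
  is_cderive (bochner_kernel k.+1 x) l (bochner_kernel k x l).
Proof.
rewrite /bochner_kernel; have [x0|x0] := eqVneq x 0.
  have d1 := is_cderiveX k (is_cderive_real l).
  rewrite (_ : (fun _ => _) = fun t : R => (k.+1`!%:R)^-1 * t%:C ^+ k.+1); last first.
    by apply/funext => t; rewrite rmorphM fmorphV rmorph_nat rmorphXn mulrC.
  apply: is_cderive_eq (is_cderiveZ (k.+1`!%:R)^-1 d1) _.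
  rewrite rmorphM fmorphV rmorph_nat rmorphXn/= factS natrM.
  by field; rewrite fact_neq0 addrC natr1 pnatr_eq0.
have c0 := mulNi_neq0 x0.
under eq_fun do rewrite mulrC.
have d1 := is_cderiveD (is_cderive_cexp (- 'i * x%:C) l)
  (is_cderiveN (is_cderive_bochner_poly k x l)).
apply: is_cderive_eq (is_cderiveZ ((- 'i * x%:C) ^+ k.+1)^-1 d1) _.
move: (bochner_poly k x l) (cexp _) c0 => p e; move: (- 'i * x%:C) => c c0.
by rewrite exprS; field; rewrite expf_neq0 ?c0.
Qed.

(** Initial value from which the derivative rule is integrated in [bochner_kernel_small]. For |x| >
    1 no polynomial is subtracted and the value at 0 is not 0. *)
Lemma bochner_kernelS_at0 k x : `|x| <= 1 -> bochner_kernel k.+1 x 0 = 0.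
Proof.
move=> x1; rewrite /bochner_kernel; case: eqP => _; first by rewrite expr0n mul0r.
rewrite mulr0 cexp0 /bochner_poly x1 big_nat_recl//= expr0 fact0 divr1 big1 ?addr0 ?subrr ?mul0r//.
by move=> i _; rewrite mulr0 expr0n/= mul0r.
Qed.

(** For a fixed nonzero x this shows that the kernel of order k + 1 grows only like |l|^k, at the
    price of a factor 1/|x|. *)
Lemma bochner_kernelS k x l : x != 0 -> `|x| <= 1 ->
  bochner_kernel k.+1 x l = (bochner_kernel k x l - (l ^+ k / k`!%:R)%:C) / (- 'i * x%:C).
Proof.
move=> x0 x1; have c0 := mulNi_neq0 x0.
rewrite /bochner_kernel (negbTE x0) /bochner_poly x1 big_nat_recr//=.
rewrite rmorphM fmorphV rmorph_nat rmorphXn/= exprMn exprS.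
move: (index_iota _ _) (cexp _) c0 => s e; move: (- 'i * x%:C) => c c0.
by field; rewrite fact_neq0 expf_neq0 ?c0.
Qed.

(** Mean value theorem between 0 and [t]. The factor 1 / (k + 1) that integration would give is
    abandoned. *)
Lemma is_derive_norm_le (f df : R -> R) k : (forall t : R, is_derive t 1 f (df t)) ->
  f 0 = 0 -> (forall t, `|df t| <= `|t| ^+ k) -> forall t, `|f t| <= `|t| ^+ k.+1.
Proof.
move=> dF f0 dfk t; have cf := is_derive_continuous dF.
have [t0|/ltW t0] := leP 0 t.
  have [c /[!in_itv]/= /andP[c0 ct] E] := @MVT_segment _ f df 0 t t0
    (fun x _ => dF x) (continuous_subspaceT cf).
  move: E; rewrite f0 !subr0 => ->; rewrite normrM exprSr ler_wpM2r//.
  rewrite (le_trans (dfk _))// lerXn2r ?nnegrE//.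
  by rewrite (ger0_norm c0) (ger0_norm t0).
have [c /[!in_itv]/= /andP[ct c0] E] := @MVT_segment _ f df t 0 t0
  (fun x _ => dF x) (continuous_subspaceT cf).
move: E; rewrite f0 !sub0r => /eqP; rewrite eqr_oppLR => /eqP ->.
rewrite normrN normrM normrN exprSr ler_wpM2r//.
rewrite (le_trans (dfk _))// lerXn2r ?nnegrE//.
by rewrite (ler0_norm c0) (ler0_norm t0) lerN2.
Qed.

(** The mean value theorem is a real statement, so the induction runs on the real and imaginary
    parts; the factor 2 appears only when they are put together. *)
Lemma bochner_kernel_small k x l : `|x| <= 1 -> normc (bochner_kernel k x l) <= 2 * `|l| ^+ k.
Proof.
move=> x1; suff H : forall l, `|complex.Re (bochner_kernel k x l)| <= `|l| ^+ k /\
    `|complex.Im (bochner_kernel k x l)| <= `|l| ^+ k.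
  have [H1 H2] := H l; rewrite (le_trans (normc_le_ReIm _))//.
  by rewrite mulrDl !mul1r lerD.
elim: k => [|k IH] {l} => [l|].
  rewrite expr0 bochner_kernel0 -(normc_cexpNi x l).
  by split; [exact: normc_Re|exact: normc_Im].
have d1 l := is_cderive_bochner_kernel k x l.
have K0 := bochner_kernelS_at0 k x1.
move=> l; split.
  apply: (@is_derive_norm_le (fun t => complex.Re (bochner_kernel k.+1 x t))
    (fun t => complex.Re (bochner_kernel k x t)) k) => [t||t].
  - by have [] := d1 t.
  - by rewrite K0.
  - by have [] := IH t.
apply: (@is_derive_norm_le (fun t => complex.Im (bochner_kernel k.+1 x t))
    (fun t => complex.Im (bochner_kernel k x t)) k) => [t||t].
- by have [] := d1 t.
- by rewrite K0.
- by have [] := IH t.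
Qed.

Lemma bochner_kernel_large k x l : 1 < `|x| -> normc (bochner_kernel k x l) = `|x| ^- k.
Proof.
move=> x1; rewrite /bochner_kernel /bochner_poly leNgt x1/= subr0.
case: eqP => [x0|_]; first by move: x1; rewrite x0 normr0 ltr10.
by rewrite Normc.normcM Normc.normcV normcX normc_Ni normc_cexpNi mul1r.
Qed.

Lemma bochner_weight k x : 0 < 1 + `|x| ^+ k.
Proof. by rewrite ltr_pwDl// exprn_ge0. Qed.

(** The term 4 |l|^k covers |x| <= 1, where 1 + |x|^k <= 2; the term 2 covers |x| > 1, where |x|^-k
    (1 + |x|^k) <= 2. *)
Lemma bochner_kernel_bound k x l :
  normc (bochner_kernel k x l) <= (1 + `|x| ^+ k)^-1 * (4 * `|l| ^+ k + 2).
Proof.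
have w0 := bochner_weight k x.
rewrite mulrC ler_pdivlMr//; have [x1|x1] := leP `|x| 1.
  have : `|x| ^+ k <= 1 by exact: exprn_ile1.
  have := bochner_kernel_small k l x1.
  have := normc_ge0 (bochner_kernel k x l).
  have : 0 <= `|l| ^+ k by exact: exprn_ge0.
  by nra.
rewrite bochner_kernel_large// mulrDr mulr1 mulVf; last first.
  by rewrite expf_neq0// gt_eqF// (lt_trans _ x1).
have : `|x| ^- k <= 1 by rewrite invf_le1 ?exprn_gt0 ?exprn_ege1 ?ltW// (lt_trans _ x1).
have : 0 <= `|l| ^+ k by exact: exprn_ge0.
by lra.
Qed.

(** Stated for arbitrary arguments [f] and [g] so as to give measurability in one variable and, with
    the two projections, joint measurability for Fubini. *)
Lemma cmeasurable_bochner_kernel d (T : measurableType d) k (f g : T -> R) :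
  measurable_fun setT f -> measurable_fun setT g ->
  cmeasurable setT (fun t => bochner_kernel k (f t) (g t)).
Proof.
move=> mf mg; have mc : cmeasurable setT (fun t => - 'i * (f t)%:C).
  by apply: cmeasurableM; [exact: cmeasurable_cst|exact: cmeasurable_real].
have mcg : cmeasurable setT (fun t => - 'i * (f t)%:C * (g t)%:C).
  by apply: cmeasurableM => //; exact: cmeasurable_real.
apply: cmeasurable_if => //.
- apply: (measurable_fun_bool true).
  rewrite (_ : _ @^-1` _ = f @^-1` [set 0]); last first.
    by apply/seteqP; split => t /= /eqP.
  exact: mf.
- by apply: cmeasurable_real; apply: measurable_funM => //; exact: measurable_funX.
- apply: cmeasurableM; last by apply: cmeasurableV => //; exact: cmeasurableX.
  apply: cmeasurableB; first exact: cmeasurable_cexp.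
  apply: cmeasurable_if => //.
  + apply: (measurable_fun_bool true).
    rewrite (_ : _ @^-1` _ = f @^-1` `[-1, 1]%classic); last first.
      by apply/seteqP; split => t /=; rewrite in_itv/= -ler_norml.
    by apply: mf => //; exact: measurable_itv.
  + apply: cmeasurable_sum => i.
    by apply: cmeasurableM; [exact: cmeasurableX|exact: cmeasurable_cst].
Qed.

End BochnerKernel.

(** * Truncated integrals of Bochner kernels: recursion, bounds and limit *)

Section KernelIntegral.
Context {R : realType}.
Local Notation leb := (@lebesgue_measure R).
Variable z : R[i].
Hypothesis zn0 : complex.Im z != 0.
Implicit Types (x N l : R) (k : nat).

Definition kernel_integral k x N : R[i] := cintegral leb `[- N, N]
  (fun l => bochner_kernel k x l / (l%:C + z) ^+ k.+1).

Let b := `|complex.Im z|.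
Let rho := normc z / b.

Let b0 : 0 < b. Proof. by rewrite normr_gt0. Qed.

Let rho_ge0 : 0 <= rho. Proof. by rewrite divr_ge0 ?normc_ge0 ?ltW. Qed.

Lemma Im_le_normc_shift l : b <= normc (l%:C + z).
Proof. by apply: le_trans (normc_Im _); rewrite Im_addc/= add0r. Qed.

Let shift_gt0 l : 0 < normc (l%:C + z).
Proof. exact: lt_le_trans b0 (Im_le_normc_shift l). Qed.

(** The imaginary part of conj(z) (l + z) is - l Im z, whence |l| |Im z| <= |z| |l + z|. *)
Lemma ratio_shift_le l : `|l| / normc (l%:C + z) <= rho.
Proof.
rewrite ler_pdivrMr// /rho mulrAC ler_pdivlMr//.
have := normc_Im (conjc z * (l%:C + z)).
rewrite Normc.normcM normc_conjc; apply: le_trans.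
rewrite Im_mulc Im_addc Re_addc Re_conjc Im_conjc /= add0r /b -normrM -normrN le_eqVlt.
by apply/orP; left; apply/eqP; congr (`|_|); ring.
Qed.

Let ratio_shift_leX l n : `|l| ^+ n <= (rho * normc (l%:C + z)) ^+ n.
Proof.
have r : `|l| <= rho * normc (l%:C + z) by rewrite -ler_pdivrMr// ratio_shift_le.
by apply: lerXn2r => //; rewrite nnegrE (le_trans _ r).
Qed.

Lemma normc_shiftV_le l : normc (l%:C + z)^-1 <= b^-1.
Proof. by rewrite Normc.normcV lef_pV2 ?posrE// Im_le_normc_shift. Qed.

(** The product whose values at N and - N form the boundary term of the integration by parts. *)
Let B k x l := bochner_kernel k x l * (l%:C + z)^-1 ^+ k.

Lemma ccontinuous_kernel_quotient k x :
  ccontinuous (fun l => bochner_kernel k x l / (l%:C + z) ^+ k.+1).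
Proof.
rewrite (_ : (fun _ => _) = fun l => bochner_kernel k x l * (l%:C + z)^-1 ^+ k.+1); last first.
  by apply/funext => l; rewrite exprVn.
case: k => [|k]; apply: is_cderive_continuous => l; last first.
  exact: is_cderiveM (is_cderive_bochner_kernel k x l) (is_cderive_shiftVX k.+1 l zn0).
apply: is_cderiveM (is_cderive_shiftVX 0 l zn0).
rewrite (_ : bochner_kernel 0 x = fun l => cexp (- 'i * x%:C * l%:C)).
  exact: is_cderive_cexp.
by apply/funext => t; exact: bochner_kernel0.
Qed.

Lemma kernel_integralS k x N : 0 <= N ->
  k.+1%:R * kernel_integral k.+1 x N = kernel_integral k x N - (B k.+1 x N - B k.+1 x (- N)).
Proof.
move=> N0; have mI : measurable (`[- N, N]%classic : set (measurableTypeR R)) by [].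
have iJ j : cintegrable leb `[- N, N] (fun l => bochner_kernel j x l / (l%:C + z) ^+ j.+1).
  by apply: ccontinuous_cintegrable; exact: ccontinuous_kernel_quotient.
have dB l : is_cderive (B k.+1 x) l
    (bochner_kernel k x l / (l%:C + z) ^+ k.+1 -
     k.+1%:R * (bochner_kernel k.+1 x l / (l%:C + z) ^+ k.+2)).
  apply: is_cderive_eq (is_cderiveM (is_cderive_bochner_kernel k x l) (is_cderive_shiftVX k l zn0)) _.
  by rewrite -!exprVn mulNr mulrN mulrCA.
rewrite -(is_cderive_cintegral _ dB); last 2 first.
- by rewrite (le_trans _ N0)// oppr_le0.
- apply: ccontinuousB; first exact: ccontinuous_kernel_quotient.
  by apply: ccontinuousZ; exact: ccontinuous_kernel_quotient.
rewrite cintegralB//; last by apply: cintegrableZ.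
by rewrite cintegralZ// opprB addrC subrK.
Qed.

Lemma kernel_integral0 x N : kernel_integral 0 x N = oscillatory z x N.
Proof. by apply: eq_cintegral => l _; rewrite bochner_kernel0 expr1. Qed.

Let B_small k x l : `|x| <= 1 -> normc (B k x l) <= 2 * rho ^+ k.
Proof.
move=> x1; rewrite /B Normc.normcM normcX Normc.normcV exprVn.
rewrite ler_pdivrMr ?exprn_gt0//.
rewrite (le_trans (bochner_kernel_small k l x1))// -mulrA ler_wpM2l// -exprMn.
exact: ratio_shift_leX.
Qed.

Let normc_nat n : normc (n%:R : R[i]) = n%:R.
Proof. by rewrite -[n%:R](rmorph_nat (real_complex R)) normc_real ger0_norm. Qed.

(** Integrating the modulus would give a logarithm of N. The cancellation is inherited from order 0
    through the recursion, whose boundary terms are bounded by [B_small]. *)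
Lemma kernel_integral_small k : exists C, forall x N, `|x| <= 1 -> 0 < N ->
  normc (kernel_integral k x N) <= C.
Proof.
elim: k => [|k [C IH]].
  have [C HC] := oscillatory_bound zn0; exists C => x N _ N0.
  by rewrite kernel_integral0 HC.
exists (C + 2 * (2 * rho ^+ k.+1)) => x N x1 N0.
have k0 : 0 < (k.+1%:R : R) by [].
have H : normc (k.+1%:R * kernel_integral k.+1 x N) <= C + 2 * (2 * rho ^+ k.+1).
  rewrite (kernel_integralS _ _ (ltW N0)).
  rewrite (le_trans (le_normcD _ _))// lerD ?IH// normcN.
  by rewrite (le_trans (le_normcD _ _))// normcN mulrDl mul1r lerD// B_small.
apply: le_trans H; rewrite Normc.normcM normc_nat ler_peMl ?normc_ge0//.
by rewrite ler1n.
Qed.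

(** The modulus of the kernel is exactly |x|^-k, so for positive order the bound is absolute and
    rests on the integrability of |l + z|^-2. At order 0 no decay in x is claimed. *)
Lemma kernel_integral_large k : exists C, forall x N, 1 < `|x| -> 0 < N ->
  normc (kernel_integral k x N) <= `|x| ^- k * C.
Proof.
case: k => [|k].
  have [C HC] := oscillatory_bound zn0; exists C => x N _ N0.
  by rewrite kernel_integral0 expr0 invr1 mul1r HC.
have [C HC] := oscillatory_bound zn0.
(* The 2 is that of [normc_cintegral_le], b^-k bounds the k surplus factors of the denominator, and
   b^-1 C bounds the integral of |l + z|^-2. *)
exists (2 * (b ^- k * (b^-1 * C))) => x N x1 N0.
have mI : measurable (`[- N, N]%classic : set (measurableTypeR R)) by [].
(* [|l + z|^-2] is a multiple of [Im (l + z)^-1], so [oscillatory z 0 N] bounds its integral. *)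
pose q (l : R) := - (complex.Im z)^-1 * complex.Im (l%:C + z)^-1.
have qE l : q l = normc (l%:C + z) ^- 2.
  rewrite /q Im_invc Im_addc Re_addc/= add0r.
  have n0 : 0 < (l + complex.Re z) ^+ 2 + complex.Im z ^+ 2.
    by rewrite ltr_wpDl ?sqr_ge0// exprn_even_gt0.
  have -> : normc (l%:C + z) ^+ 2 = (l + complex.Re z) ^+ 2 + complex.Im z ^+ 2.
    by case: (z) => p r /=; rewrite add0r sqr_sqrtr// addr_ge0 ?sqr_ge0.
  by field; rewrite lt0r_neq0.
have cV : ccontinuous (fun l => (l%:C + z)^-1).
  apply: is_cderive_continuous => l; exact: is_cderive_shiftVX 0 l zn0.
have [_ iV] := ccontinuous_cintegrable (- N) N cV.
have iq : leb.-integrable `[- N, N] (EFin \o q).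
  have i1 := integrableZl mI (- (complex.Im z)^-1) iV.
  by apply: eq_integrable i1.
have iqE : \int[leb]_(l in `[- N, N]) q l <= b^-1 * C.
  rewrite RintegralZl//.
  have -> : \int[leb]_(l in `[- N, N]) complex.Im (l%:C + z)^-1 = complex.Im (oscillatory z 0 N).
    by apply: eq_Rintegral => l _; rewrite mulr0 mul0r cexp0 mul1r.
  rewrite (le_trans (ler_norm _))// normrM normrN normfV ler_wpM2l ?invr_ge0//.
  exact: le_trans (normc_Im _) (HC _ _ N0).
have ih : leb.-integrable `[- N, N] (EFin \o (fun l => (`|x| ^- k.+1 * b ^- k) * q l)).
  have i1 := integrableZl mI (`|x| ^- k.+1 * b ^- k) iq.
  by apply: eq_integrable i1.
have xk0 : 0 <= `|x| ^- k.+1 by rewrite invr_ge0 exprn_ge0.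
have mK : cmeasurable (`[- N, N]%classic : set (measurableTypeR R))
    (fun l => bochner_kernel k.+1 x l / (l%:C + z) ^+ k.+2).
  by apply: ccontinuous_cmeasurable => //; exact: ccontinuous_kernel_quotient.
apply: (le_trans (normc_cintegral_le mI mK ih _)).
  move=> l _; rewrite Normc.normcM bochner_kernel_large// -mulrA ler_wpM2l//.
  rewrite qE Normc.normcV normcX -addn2 exprD invfM ler_wpM2r//.
    by rewrite invr_ge0 exprn_ge0// normc_ge0.
  by rewrite lef_pV2 ?posrE ?exprn_gt0// lerXn2r ?nnegrE ?Im_le_normc_shift ?normc_ge0 ?ltW.
rewrite RintegralZl// [leRHS]mulrCA ler_wpM2l// -mulrA ler_wpM2l//.
by rewrite ler_wpM2l// invr_ge0 exprn_ge0// ltW.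
Qed.

Lemma kernel_integral_bound k : exists C, forall x N, 0 < N ->
  normc (kernel_integral k x N) <= (1 + `|x| ^+ k)^-1 * C.
Proof.
have [C1 H1] := kernel_integral_small k; have [C2 H2] := kernel_integral_large k.
(* The weight satisfies 1 + |x|^k <= 2 for |x| <= 1 and 1 + |x|^k <= 2 |x|^k otherwise. Absolute
   values are taken because the signs of [C1] and [C2] are unknown. *)
exists (2 * `|C1| + 2 * `|C2|) => x N N0.
have w0 := bochner_weight k x.
rewrite mulrC ler_pdivlMr//; have [x1|x1] := leP `|x| 1.
  have xk : `|x| ^+ k <= 1 by exact: exprn_ile1.
  have J0 := normc_ge0 (kernel_integral k x N).
  have := H1 _ _ x1 N0; have := ler_norm C1; have := normr_ge0 C2.
  move: (normc _) J0 => J J0 ? ? ?.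
  have : J * (1 + `|x| ^+ k) <= J * 2 by rewrite ler_wpM2l// -lerBrDl (le_trans xk)//; lra.
  lra.
have xk : 1 <= `|x| ^+ k by rewrite exprn_ege1// ltW.
have xk0 : 0 < `|x| ^+ k by rewrite (lt_le_trans _ xk).
have := H2 _ _ x1 N0; rewrite mulrC ler_pdivlMr// mulrDr mulr1 => HJ.
have J0 := normc_ge0 (kernel_integral k x N).
have : normc (kernel_integral k x N) <= normc (kernel_integral k x N) * `|x| ^+ k.
  by rewrite ler_peMr.
have := ler_norm C2; have := normr_ge0 C1.
lra.
Qed.

Let cvg_div c : c / N @[N --> +oo%R] --> (0 : R).
Proof.
rewrite -[X in _ --> X](mulr0 c); apply: cvgM; first exact: cvg_cst.
by apply/gtr0_cvgV0; [exact: nbhs_pinfty_gt (num_real _)|exact: cvg_id].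
Qed.

(** The numerator grows at most like |l|^k by [bochner_kernelS], or is bounded when |x| > 1, against
    a denominator of degree k + 1. The constant may depend on x: only a pointwise limit is
    wanted. *)
Let B_decay k x : x != 0 -> exists C, forall l, 0 < `|l| -> normc (B k.+1 x l) <= C / `|l|.
Proof.
move=> x0; have [x1|x1] := leP `|x| 1.
  (* The 3 is 2 from [bochner_kernel_small] plus 1 for the monomial split off by
     [bochner_kernelS]. *)
  exists (3 / `|x| * rho ^+ k.+1) => l l0.
  rewrite /B Normc.normcM normcX Normc.normcV exprVn.
  rewrite ler_pdivrMr ?exprn_gt0// bochner_kernelS// Normc.normcM Normc.normcV normc_Ni.
  have : normc (bochner_kernel k x l - (l ^+ k / k`!%:R)%:C) <= 3 * `|l| ^+ k.
    rewrite (le_trans (le_normcD _ _))// normcN normc_real.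
    have h : `|l ^+ k / k`!%:R| <= `|l| ^+ k.
      rewrite normrM normrX ler_piMr ?exprn_ge0//.
      by rewrite normfV ger0_norm// invf_le1 ?ltr0n ?fact_gt0// ler1n fact_gt0.
    by have := bochner_kernel_small k l x1; move: h; lra.
  move=> H; rewrite ler_pdivrMr ?normr_gt0//; apply: (le_trans H).
  have -> : 3 / `|x| * rho ^+ k.+1 / `|l| * normc (l%:C + z) ^+ k.+1 * `|x|
    = 3 * ((rho * normc (l%:C + z)) ^+ k.+1 / `|l|).
    rewrite [(rho * _) ^+ _]exprMn; move: (rho ^+ _) (normc _ ^+ _) => p q; field; by rewrite (lt0r_neq0 l0) normr_eq0 x0.
  rewrite ler_wpM2l// ler_pdivlMr// -exprSr.
  exact: ratio_shift_leX.
exists (b ^- k * rho) => l l0; rewrite /B Normc.normcM bochner_kernel_large//.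
rewrite normcX Normc.normcV [_^-1 ^+ k.+1]exprSr mulrA -[leRHS]mulrA.
have h1 : `|x| ^- k.+1 <= 1.
  by rewrite invf_le1 ?exprn_gt0 ?normr_gt0// exprn_ege1// ltW.
have h2 : (normc (l%:C + z))^-1 ^+ k <= b ^- k.
  by rewrite -exprVn lerXn2r ?nnegrE ?invr_ge0 ?normc_ge0 ?(ltW b0)// -Normc.normcV normc_shiftV_le.
have h3 : (normc (l%:C + z))^-1 <= rho / `|l|.
  by rewrite ler_pdivlMr// mulrC ratio_shift_le.
have p1 : 0 <= `|x| ^- k.+1 by rewrite invr_ge0 exprn_ge0.
have p2 : 0 <= (normc (l%:C + z))^-1 ^+ k by rewrite exprn_ge0// invr_ge0 normc_ge0.
have p3 : 0 <= (normc (l%:C + z))^-1 by rewrite invr_ge0 normc_ge0.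
have p4 : `|x| ^- k.+1 * (normc (l%:C + z))^-1 ^+ k <= 1 * b ^- k by rewrite ler_pM.
rewrite mul1r in p4.
by rewrite ler_pM// mulr_ge0.
Qed.

(** At x = 0 the two boundary values do not vanish in the limit: both tend to 1 / (k + 1)!, and only
    their difference disappears. Elsewhere each of them decays. *)
Let B_cvg0 k x : ccvgy (fun N => B k.+1 x N - B k.+1 x (- N)) 0.
Proof.
have [->|x0] := eqVneq x 0; last first.
  have [C HC] := B_decay k x0.
  apply: (@ccvgy_norm0 _ _ (fun N => (C + C) / N)); last exact: cvg_div.
  apply: filterS (nbhs_pinfty_gt (num_real 0)) => N N0.
  rewrite (le_trans (le_normcD _ _))// normcN mulrDl.
  have NN : `|N| = N by rewrite gtr0_norm.
  have := HC N; have := HC (- N); rewrite normrN NN => /(_ N0) h2 /(_ N0) h1.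
  exact: lerD.
have E l : B k.+1 0 l = (k.+1`!%:R)^-1 * (l%:C / (l%:C + z)) ^+ k.+1.
  rewrite /B /bochner_kernel eqxx rmorphM fmorphV rmorph_nat rmorphXn/= exprMn; ring.
have H s : `|s| = 1 -> ccvgy (fun N => (s * N)%:C / ((s * N)%:C + z)) 1.
  move=> s1; have : ccvgy (fun N => 1 - (1 - (s * N)%:C / ((s * N)%:C + z))) (1 - 0); last first.
    by rewrite subr0; under eq_fun do rewrite subKr.
  apply: ccvgyB; first exact: ccvgy_cst.
  apply: (@ccvgy_norm0 _ _ (fun N => (normc z * rho) / N)); last exact: cvg_div.
  apply: filterS (nbhs_pinfty_gt (num_real 0)) => N N0.
  have -> : 1 - (s * N)%:C / ((s * N)%:C + z) = z / ((s * N)%:C + z).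
    by have := real_add_neq0 (s * N) zn0; move: (s * N)%:C => c nz; field.
  rewrite Normc.normcM Normc.normcV -mulrA ler_wpM2l ?normc_ge0//.
  rewrite ler_pdivlMr// mulrC.
  have := ratio_shift_le (s * N); rewrite normrM s1 mul1r gtr0_norm//.
under eq_fun do rewrite !E.
rewrite -(subrr ((k.+1`!%:R : R[i])^-1 * 1 ^+ k.+1)).
apply: ccvgyB; apply: ccvgyZ; apply: ccvgyX.
  have := H 1 (normr1 _); under eq_fun do rewrite mul1r; exact.
have := H (-1); rewrite normrN normr1 => /(_ erefl).
by under eq_fun do rewrite mulN1r.
Qed.

Lemma cvg_kernel_integral k x : ccvgy (kernel_integral k x)
  ((k`!%:R)^-1 * (- 2 * 'i * pi%:C * carleman_kernel z x)).
Proof.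
elim: k => [|k IH].
  rewrite fact0 invr1 mul1r; rewrite (_ : kernel_integral 0 x = oscillatory z x).
    exact: cvg_oscillatory.
  by apply/funext => N; exact: kernel_integral0.
have := ccvgyZ (k.+1%:R)^-1 (ccvgyB IH (B_cvg0 k x)).
rewrite subr0 mulrA -invfM -natrM -factS; apply: ccvgy_near.
apply: filterS (nbhs_pinfty_gt (num_real 0)) => N N0.
by rewrite -kernel_integralS ?ltW// mulKf// pnatr_eq0.
Qed.

End KernelIntegral.

(** * Inversion for positive measures *)

Section PositiveMeasure.
Context {R : realType}.
Local Notation leb := (@lebesgue_measure R).
Local Notation T := (measurableTypeR R).
Variables (m : {sigma_finite_measure set T -> \bar R}) (k : nat) (z : R[i]).
Hypothesis zn0 : complex.Im z != 0.
Hypothesis iw : m.-integrable setT (EFin \o (fun x : T => (1 + `|x : R| ^+ k)^-1)).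

Lemma cintegrable_bochner_kernel (l : R) :
  cintegrable m setT (fun x : T => bochner_kernel k x l).
Proof.
have i1 := integrableZr measurableT (4 * `|l| ^+ k + 2) iw.
apply: (@cintegrable_dom R _ _ m setT _ (fun x : T => (1 + `|x : R| ^+ k)^-1 * (4 * `|l| ^+ k + 2))) => //.
- exact: cmeasurable_bochner_kernel.
- by move=> x _; exact: bochner_kernel_bound.
Qed.

Let mI N : measurable (`[- N, N]%classic : set T). Proof. exact: measurable_itv. Qed.

Let f (x l : T) : R[i] := bochner_kernel k x l / (l%:C + z) ^+ k.+1.

Let mf : cmeasurable setT (fun p : T * T => f p.1 p.2).
Proof.
apply: cmeasurableM; first exact: cmeasurable_bochner_kernel.
apply: cmeasurableV => //; apply: cmeasurableX; apply: cmeasurableD; last exact: cmeasurable_cst.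
exact: cmeasurable_real.
Qed.

Let h (l : R) := (4 * `|l| ^+ k + 2) * `|complex.Im z| ^- k.+1.

Let ih N : leb.-integrable `[- N, N] (EFin \o h).
Proof.
apply: continuous_compact_integrable; first exact: segment_compact.
apply: continuous_subspaceT => l; apply: cvgM; last exact: cvg_cst.
apply: cvgD; last exact: cvg_cst.
apply: cvgM; first exact: cvg_cst.
apply: (@cvg_comp _ _ _ (fun l : R => `|l|) (fun x : R => x ^+ k) _ (nbhs `|l|)).
  exact: norm_continuous.
exact: exprn_continuous.
Qed.

Let fh x l : normc (f x l) <= (1 + `|x : R| ^+ k)^-1 * h l.
Proof.
have b0 : 0 < `|complex.Im z| by rewrite normr_gt0.
rewrite /f Normc.normcM /h mulrA ler_pM ?normc_ge0 ?bochner_kernel_bound//.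
rewrite -exprVn normcX -exprVn lerXn2r ?nnegrE ?normc_ge0 ?invr_ge0 ?(ltW b0)//.
exact: normc_shiftV_le.
Qed.

Let mfN (N : R) : cmeasurable ([set: T] `*` (`[- N, N]%classic : set T)) (fun p : T * T => f p.1 p.2).
Proof. exact: cmeasurableS mf. Qed.

Let fE l : cintegral m setT (fun x => f x l) =
  cintegral m setT (fun x : T => bochner_kernel k x l) / (l%:C + z) ^+ k.+1.
Proof.
rewrite mulrC -cintegralZ//; last exact: cintegrable_bochner_kernel.
by apply: eq_cintegral => x _; rewrite mulrC.
Qed.

Lemma cintegrable_bochner_quotient N : cintegrable leb `[- N, N] (fun l : T =>
  cintegral m setT (fun x : T => bochner_kernel k x l) / (l%:C + z) ^+ k.+1).
Proof.
have := cfubini_integrable2 measurableT (@mI N) (@mfN N) iw (@ih N) (fun x l _ _ => fh x l).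
by apply: (eq_cintegrable (@mI N)) => l _; exact: fE.
Qed.

Lemma bochner_quotient_fubini N : cintegral leb `[- N, N] (fun l : T =>
    cintegral m setT (fun x : T => bochner_kernel k x l) / (l%:C + z) ^+ k.+1) =
  cintegral m setT (fun x : T => kernel_integral z k x N).
Proof.
rewrite /kernel_integral (cfubini measurableT (@mI N) (@mfN N) iw (@ih N) (fun x l _ _ => fh x l)).
by apply: eq_cintegral => l _; exact/esym/fE.
Qed.

(** Passing to the limit by components costs a factor 2, which is irrelevant for integrability. *)
Lemma ccvgy_normc_le (u : R -> R[i]) a (B : R) : (forall N, 0 < N -> normc (u N) <= B) ->
  ccvgy u a -> normc a <= 2 * B.
Proof.
move=> uB [u1 u2]; rewrite (le_trans (normc_le_ReIm _))// mulrDl !mul1r.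
have F : ProperFilter (+oo%R : set_system R) by exact: proper_pinfty_nbhs.
have H (v : R -> R) (c : R) : (forall N, 0 < N -> `|v N| <= B) -> v N @[N --> +oo%R] --> c -> `|c| <= B.
  move=> vB vc; have vB' : \forall N \near +oo%R, - B <= v N <= B.
    by apply: filterS (nbhs_pinfty_gt (num_real 0)) => N /vB; rewrite ler_norml.
  rewrite ler_norml; apply/andP; split.
    by apply: (cvgr_to_ge vc); apply: filterS vB' => N /andP[].
  by apply: (cvgr_to_le vc); apply: filterS vB' => N /andP[].
apply: lerD.
  by apply: (H _ _ _ u1) => N /uB; apply: le_trans; exact: normc_Re.
by apply: (H _ _ _ u2) => N /uB; apply: le_trans; exact: normc_Im.
Qed.

Lemma cmeasurable_carleman_kernel : cmeasurable setT (carleman_kernel z : T -> R[i]).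
Proof.
have mE : cmeasurable setT (fun x : T => cexp ('i * x%:C * z)).
  apply: cmeasurable_cexp; apply: cmeasurableM; last exact: cmeasurable_cst.
  by apply: cmeasurableM; [exact: cmeasurable_cst|exact: cmeasurable_real].
have m0 : measurable_fun setT (fun x : T => (x : R) == 0).
  apply: (measurable_fun_bool true); rewrite setTI (_ : _ @^-1` _ = [set 0])//.
  by apply/seteqP; split => x /= /eqP.
have [zp|zp] := boolP (0 < complex.Im z).
  rewrite (_ : carleman_kernel z = fun x : T =>
      if 0 < x then cexp ('i * x%:C * z) else if x == 0 then 2^-1 else 0); last first.
    by apply/funext => x; rewrite /carleman_kernel zp.
  apply: cmeasurable_if => //; last by apply: cmeasurable_if => //; exact: cmeasurable_cst.
  apply: (measurable_fun_bool true); rewrite setTI (_ : _ @^-1` _ = `]0, +oo[%classic)//.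
  by apply/seteqP; split => x /=; rewrite in_itv/= andbT.
rewrite (_ : carleman_kernel z = fun x : T =>
    if x < 0 then - cexp ('i * x%:C * z) else if x == 0 then - 2^-1 else 0); last first.
  by apply/funext => x; rewrite /carleman_kernel (negbTE zp).
apply: cmeasurable_if => //.
- by apply: (measurable_fun_bool true); rewrite setTI (_ : _ @^-1` _ = `]-oo, 0[%classic).
- exact: cmeasurableN.
- by apply: cmeasurable_if => //; exact: cmeasurable_cst.
Qed.

Let c : R[i] := (k`!%:R)^-1 * (- 2 * 'i * pi%:C).

Let c0 : c != 0.
Proof.
rewrite /c !mulf_neq0 ?invr_eq0 ?fact_neq0 ?oppr_eq0 ?pnatr_eq0//.
  by rewrite -normr_gt0 normr_normc normc_i ltcR.
by rewrite eq_complex/= eqxx andbT gt_eqF// pi_gt0.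
Qed.

(** The uniform bound on [kernel_integral] passes to its limit, a nonzero multiple of
    [carleman_kernel]; the exponential is never compared directly with the weight. *)
Lemma cintegrable_carleman_kernel : cintegrable m setT (carleman_kernel z : T -> R[i]).
Proof.
have [C HC] := kernel_integral_bound zn0 k.
have i2 := integrableZr measurableT (2 * C) iw.
have H : cintegrable m setT (fun x : T => c * carleman_kernel z x).
  apply: (@cintegrable_dom R _ _ m setT _ (fun x : T => (1 + `|x : R| ^+ k)^-1 * (2 * C))) => //.
  - apply: cmeasurableM; first exact: cmeasurable_cst.
    exact: cmeasurable_carleman_kernel.
  - move=> x _; rewrite mulrCA -[c * _]mulrA.
    by apply: (ccvgy_normc_le _ (cvg_kernel_integral zn0 k x)) => N N0; exact: HC.
have := cintegrableZ c^-1 measurableT H.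
by under eq_fun do rewrite mulKf//.
Qed.

Lemma cvg_bochner_quotient : ccvgy (fun N => cintegral leb `[- N, N] (fun l : T =>
    cintegral m setT (fun x : T => bochner_kernel k x l) / (l%:C + z) ^+ k.+1))
  (c * cintegral m setT (carleman_kernel z : T -> R[i])).
Proof.
under eq_fun do rewrite bochner_quotient_fubini.
rewrite -cintegralZ//; last exact: cintegrable_carleman_kernel.
have [C HC] := kernel_integral_bound zn0 k.
have iC := integrableZr measurableT C iw.
apply: (@dominated_ccvgy R _ _ m setT (fun N x => kernel_integral z k x N) _
  (fun x : T => (1 + `|x : R| ^+ k)^-1 * C)) => //.
- move=> N N0; exact: cintegrable_cmeasurable
    (cfubini_integrable1 measurableT (@mI N) (@mfN N) iw (@ih N) (fun x l _ _ => fh x l)).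
- by apply: cmeasurableM; [exact: cmeasurable_cst|exact: cmeasurable_carleman_kernel].
- by move=> N x N0 _; exact: HC.
- by move=> x _; rewrite -[c * _]mulrA; exact: cvg_kernel_integral.
Qed.

(** Covers both half-planes: [D] is to be the closed half-line of [carleman_transform] and [s] the
    sign in front of its integral. The indicator of {0} turns the value 1 of the exponential at 0
    into 1/2, and its integral is the mass of the atom. *)
Lemma cintegral_carleman_kernel (D : set T) (s : R[i]) : measurable D -> D 0 ->
  m [set 0] \is a fin_num -> s != 0 ->
  (forall x, D x -> carleman_kernel z x = s * (cexp ('i * x%:C * z) - 2^-1 * (\1_[set (0 : R)] x)%:C)) ->
  (forall x, ~ D x -> carleman_kernel z x = 0) ->
  cintegrable m D (fun x : T => cexp ('i * x%:C * z)) /\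
  cintegral m setT (carleman_kernel z : T -> R[i]) =
    s * (cintegral m D (fun x : T => cexp ('i * x%:C * z)) - 2^-1 * (fine (m [set 0]))%:C).
Proof.
move=> mD D0 m0 s0 kD kN; have ik := cintegrableS mD measurableT (@subsetT _ D) cintegrable_carleman_kernel.
have m1 : measurable ([set 0] : set T) by exact: measurable_set1.
have ind : m.-integrable D (EFin \o (\1_([set 0] : set T) : T -> R)).
  apply/integrableP; split.
    by apply/measurable_EFinP; apply: measurable_funTS; exact: measurable_indic.
  rewrite (_ : (\int[_]_(_ in _) _)%E = (\int[m]_(x in D) (\1_([set 0] : set T) x)%:E)%E).
    rewrite integral_indic// (_ : [set 0] `&` D = [set 0]); last by apply: setIidl => x ->.
    by rewrite -ge0_fin_numE.
  by apply: eq_integral => x _; rewrite /= ger0_norm.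
have ci := cintegrable_real mD ind.
have iE : cintegrable m D (fun x : T => cexp ('i * x%:C * z)).
  have := cintegrableD mD (cintegrableZ s^-1 mD ik) (cintegrableZ 2^-1 mD ci).
  apply: eq_cintegrable => // x Dx.
  by rewrite kD// mulKf// subrK.
split => //.
transitivity (cintegral m D (carleman_kernel z : T -> R[i])).
  apply: complex_ext => /=; rewrite [RHS]Rintegral_mkcond; apply: eq_Rintegral => x _;
  by rewrite patchE; case: ifPn => //; rewrite notin_setE => /kN ->.
rewrite (eq_cintegral _ kD).
rewrite cintegralZ// ?cintegralB ?cintegralZ ?cintegral_real//; last 2 first.
- exact: cintegrableZ.
- by apply: cintegrableB => //; exact: cintegrableZ.
congr (_ * (_ - _ * _%:C)); rewrite /Rintegral integral_indic//.
by rewrite setIidl// => x ->.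
Qed.

End PositiveMeasure.

(** * Jordan decomposition of locally finite signed measures *)

Section BoundedBorel.
Context {R : realType}.
Local Notation T := (measurableTypeR R).
Implicit Types (A B : set T).

Lemma bounded_borelP A :
  bounded_borel A <-> measurable A /\ exists M : R, forall x, A x -> `|x : R| <= M.
Proof.
split=> -[mA bA]; split => //.
  have [M [_ HM]] := bA; exists (M + 1); apply: (HM (M + 1)).
  by rewrite ltrDl.
have [M HM] := bA; exists M; split; first exact: num_real.
by move=> N MN x Ax /=; rewrite (le_trans (HM x Ax))// ltW.
Qed.

Lemma bounded_borelS A B : measurable A -> A `<=` B -> bounded_borel B -> bounded_borel A.
Proof.
move=> mA AB /bounded_borelP[_ [M HM]]; apply/bounded_borelP; split => //.
by exists M => x /AB; exact: HM.
Qed.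

Lemma bounded_borelU A B : bounded_borel A -> bounded_borel B -> bounded_borel (A `|` B).
Proof.
move=> /bounded_borelP[mA [M HM]] /bounded_borelP[mB [M' HM']]; apply/bounded_borelP; split.
  exact: measurableU.
by exists (Num.max M M') => x [/HM|/HM'] h; rewrite le_max h ?orbT.
Qed.

Lemma bounded_borel0 : bounded_borel (set0 : set T).
Proof. by apply/bounded_borelP; split => //; exists 0. Qed.

Definition annulus n : set T := [set x | n%:R <= `|x : R| < n.+1%:R].

Lemma measurable_annulus n : measurable (annulus n).
Proof.
have -> : annulus n = (fun x : R => `|x|) @^-1` `[n%:R, n.+1%:R[%classic.
  by apply/seteqP; split => x /=; rewrite in_itv.
have mn : measurable_fun (setT : set T) (fun x : R => `|x|) by exact: measurableT_comp.
rewrite -[X in measurable X]setTI; apply: mn => //; exact: measurable_itv.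
Qed.

Lemma bounded_annulus n : bounded_borel (annulus n).
Proof.
apply/bounded_borelP; split; first exact: measurable_annulus.
by exists n.+1%:R => x /andP[_ /ltW].
Qed.

Lemma trivIset_annulus : trivIset setT annulus.
Proof.
apply/trivIsetP => i j _ _ ij; apply/seteqP; split => // x [/andP[i1 i2] /andP[j1 j2]].
have h1 : (i < j.+1)%N by rewrite -(ltr_nat R) (le_lt_trans i1).
have h2 : (j < i.+1)%N by rewrite -(ltr_nat R) (le_lt_trans j1).
by move/eqP : ij; apply; apply/eqP; rewrite eqn_leq -ltnS h1 -ltnS h2.
Qed.

Lemma bigcup_annulus : \bigcup_n annulus n = setT.
Proof.
apply/seteqP; split => // x _; exists (Num.truncn `|x : R|) => //.
exact: truncn_itv.
Qed.

End BoundedBorel.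

(** * Hahn decomposition of a locally finite signed measure *)

Section LocalCharge.
Context {R : realType}.
Local Notation T := (measurableTypeR R).
Implicit Types (A B P : set T) (s : set T -> R).

Definition locally_sigma_additive s := forall F : nat -> set T,
  (forall n, bounded_borel (F n)) -> trivIset setT F -> bounded_borel (\bigcup_n F n) ->
  (fun n => \sum_(0 <= i < n) s (F i)) @ \oo --> s (\bigcup_n F n).

Lemma locally_sigma_additiveN s : locally_sigma_additive s ->
  locally_sigma_additive (fun A => - s A).
Proof.
move=> hs F bF tF bU; under eq_fun do rewrite sumrN.
exact: (cvgN (hs F bF tF bU)).
Qed.

Variable s : set T -> R.
Hypothesis hs : locally_sigma_additive s.

(** With every set empty the partial sums are n s(set0); they converge, so their consecutive
    differences, all equal to s(set0), tend to 0. *)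
Lemma local_charge0 : s set0 = 0.
Proof.
have H : (fun n => \sum_(0 <= i < n) s (set0 : set T)) @ \oo --> s set0.
  have := hs (F := fun _ => set0) (fun _ => bounded_borel0).
  rewrite bigcup0//; apply; last exact: bounded_borel0.
  by apply/trivIsetP => i j _ _ _; rewrite setI0.
have H' := H; rewrite -cvg_shiftS in H'.
have H0 := cvgB H' H; rewrite subrr in H0.
have H1 : (fun _ : nat => s (set0 : set T)) @ \oo --> (0 : R).
  rewrite (_ : (fun _ => _) = fun n => \sum_(0 <= i < n.+1) s (set0 : set T) -
    \sum_(0 <= i < n) s (set0 : set T)); first exact: H0.
  by apply/funext => n; rewrite big_nat_recr//= addrAC subrr add0r.
exact: (cvg_unique _ (cvg_cst _) H1).
Qed.

Lemma local_chargeU A B : bounded_borel A -> bounded_borel B -> A `&` B = set0 ->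
  s (A `|` B) = s A + s B.
Proof.
move=> bA bB AB.
have H : (fun n => \sum_(0 <= i < n) s (bigcup2 A B i)) @ \oo --> s (A `|` B).
  rewrite -bigcup2E; apply: hs.
  - by move=> [|[|n]] //=; exact: bounded_borel0.
  - by rewrite -trivIset_bigcup2.
  - by rewrite bigcup2E; exact: bounded_borelU.
rewrite -(cvg_shiftn 2) /= in H.
have E n : \sum_(0 <= i < n + 2) s (bigcup2 A B i) = s A + s B.
  rewrite addn2 big_nat_recl// big_nat_recl//= big1 ?addr0// => i _.
  exact: local_charge0.
rewrite (_ : (fun _ => _) = cst (s A + s B)) in H; last by apply/funext => n; exact: E.
exact: (cvg_unique _ H (cvg_cst _)).
Qed.

Let nu n A : \bar R := (s (A `&` annulus n))%:E.

Let bI n A : measurable A -> bounded_borel (A `&` annulus n).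
Proof.
move=> mA; apply: bounded_borelS (bounded_annulus n) => //.
by apply: measurableI => //; exact: measurable_annulus.
Qed.

(* [s] need not have a finite value on unbounded sets, so it is a charge in the
   sense of the library only after restriction to an annulus. *)
Section AnnulusCharge.
Variable n : nat.

Let nu0 : nu n set0 = 0%E.
Proof. by rewrite /nu set0I local_charge0. Qed.

Let nufin A : measurable A -> nu n A \is a fin_num.
Proof. by []. Qed.

Let nuadd : semi_sigma_additive (nu n).
Proof.
move=> F mF tF mU; rewrite /nu setI_bigcupl.
under eq_fun do rewrite sumEFin.
apply: cvg_EFin; first exact: nearW.
apply: hs.
- by move=> i; exact: bI.
- apply/trivIsetP => i j _ _ ij; rewrite setIACA.
  by move/trivIsetP : tF => /(_ i j I I ij) ->; rewrite set0I.
- by rewrite -setI_bigcupl; exact: bI.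
Qed.

Definition annulus_charge : {charge set T -> \bar R} :=
  HB.pack (nu n) (isCharge.Build _ T R (nu n) nu0 nufin nuadd).

Lemma annulus_hahn : exists P, measurable P /\
  forall A, measurable A -> (A `<=` P -> 0 <= s (A `&` annulus n)) /\
    (A `<=` ~` P -> s (A `&` annulus n) <= 0).
Proof.
have [P [N [[mP pP] [mN nN] PN PN0]]] := Hahn_decomposition annulus_charge.
exists P; split => // A mA; split => AP.
  by have := pP A mA AP; rewrite lee_fin.
have AN : A `<=` N.
  by move=> x /AP nP; have : [set: T] x by []; rewrite -PN => -[].
by have := nN A mA AN; rewrite lee_fin.
Qed.

End AnnulusCharge.

Definition positive_part_set P := measurable P /\ forall B, bounded_borel B ->
  (B `<=` P -> 0 <= s B) /\ (B `<=` ~` P -> s B <= 0).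

(** The positive sets of the annuli are cut to their annuli and united. The sign of s B is then that
    of the limit of the partial sums of s over the pieces of B in the annuli. *)
Lemma local_hahn : exists P, positive_part_set P.
Proof.
have /choice[P HP] := annulus_hahn.
exists (\bigcup_n (P n `&` annulus n)); split.
  by apply: bigcup_measurable => n _; apply: measurableI; [have [] := HP n|exact: measurable_annulus].
move=> B bB; have [mB _] := bB.
have H : (fun n => \sum_(0 <= i < n) s (B `&` annulus i)) @ \oo --> s B.
  have {2}-> : B = \bigcup_n (B `&` annulus n) by rewrite -setI_bigcupr bigcup_annulus setIT.
  apply: hs; last by rewrite -setI_bigcupr bigcup_annulus setIT.
    by move=> n; exact: bI.
  apply/trivIsetP => i j _ _ ij; rewrite setIACA.
  by move/trivIsetP : (@trivIset_annulus R) => /(_ i j I I ij) ->; rewrite setI0.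
have mBi i : measurable (B `&` annulus i) by apply: measurableI => //; exact: measurable_annulus.
split => BP.
- apply: (cvgr_to_ge H); apply: nearW => n; apply: sumr_ge0 => i _.
  (* The annulus is doubled so that the sign condition, stated for sets cut by it, applies to the
     part of [B] already lying in it. *)
  rewrite -[annulus i]setIid setIA.
  apply: ((HP i).2 _ (mBi i)).1 => x [/BP[j _ [Pj aj]] ai].
  have [ji|ji] := eqVneq j i; first by rewrite -ji.
  move/trivIsetP : (@trivIset_annulus R) => /(_ j i I I ji) /seteqP[+ _].
  by move=> /(_ x (conj aj ai)).
- apply: (cvgr_to_le H); apply: nearW => n; apply: sumr_le0 => i _.
  rewrite -[annulus i]setIid setIA.
  apply: ((HP i).2 _ (mBi i)).2 => x [/BP nP ai] Pi; apply: nP.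
  by exists i.
Qed.

End LocalCharge.

(** * The upper variation is a sigma-finite measure *)

Section UpperVariation.
Context {R : realType}.
Local Notation T := (measurableTypeR R).
Implicit Types (A B P : set T) (s : set T -> R).

Lemma positive_part_setN s P : positive_part_set s P ->
  positive_part_set (fun A => - s A) (~` P).
Proof.
move=> [mP sP]; split; first exact: measurableC.
by move=> B bB; rewrite setCK oppr_ge0 oppr_le0; split; apply sP.
Qed.

Section PositivePart.
Variable s : set T -> R.
Hypothesis hs : locally_sigma_additive s.
Variable P : set T.
Hypothesis hP : positive_part_set s P.

Let mP : measurable P. Proof. by have [] := hP. Qed.

Let bIP A : bounded_borel A -> bounded_borel (A `&` P).
Proof.
by move=> bA; have [mA _] := bA; apply: bounded_borelS bA => //; exact: measurableI.
Qed.

Lemma local_charge_splitE A B : measurable B -> bounded_borel A ->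
  s A = s (A `&` B) + s (A `&` ~` B).
Proof.
move=> mB bA; have [mA _] := bA.
rewrite -local_chargeU//.
- by rewrite -setIUr setUv setIT.
- by apply: bounded_borelS bA => //; exact: measurableI.
- by apply: bounded_borelS bA => //; apply: measurableI => //; exact: measurableC.
- by rewrite setIACA setICr setI0.
Qed.

(** Discarding the part of B outside P can only increase s, and so can adding the part of A in P
    outside B. Hence the supremum defining the variation of a bounded A is attained at its part in
    P. *)
Lemma local_charge_le A B : bounded_borel A -> measurable B -> B `<=` A ->
  s B <= s (A `&` P).
Proof.
move=> bA mB BA; have bB : bounded_borel B by exact: bounded_borelS bA.
have [_ hP2] := hP; have [mA _] := bA.
rewrite (local_charge_splitE mP bB).
apply: (@le_trans _ _ (s (B `&` P))).
  rewrite -[leRHS]addr0 lerD2l.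
  have b2 : bounded_borel (B `&` ~` P).
    by apply: bounded_borelS bB => //; apply: measurableI => //; exact: measurableC.
  by apply: (hP2 _ b2).2.
rewrite (local_charge_splitE mB (bIP bA)) (_ : A `&` P `&` B = B `&` P); last first.
  by rewrite setIAC (setIidr BA).
rewrite lerDl.
have b2 : bounded_borel (A `&` P `&` ~` B).
  by apply: bounded_borelS (bIP bA) => //; apply: measurableI; [exact: measurableI|exact: measurableC].
by apply: (hP2 _ b2).1 => x [[]].
Qed.

Lemma upper_variation_bounded A : bounded_borel A ->
  upper_variation s A = (s (A `&` P))%:E.
Proof.
move=> bA; apply/eqP; rewrite eq_le; apply/andP; split.
  apply: ge_ereal_sup => _ [B [bB BA] <-]; rewrite lee_fin local_charge_le//.
  by have [] := bB.
by apply: ereal_sup_ubound; exists (A `&` P) => //; split; [exact: bIP|].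
Qed.

(** One set [P] serves for all annuli, so the positive parts summed next are all restrictions to
    [P]. *)
Let hahnP n : hahn_decomposition (annulus_charge hs n) P (~` P).
Proof.
have [_ hP2] := hP.
have bI A : measurable A -> bounded_borel (A `&` annulus n).
  move=> mA; apply: bounded_borelS (bounded_annulus n) => //.
  by apply: measurableI => //; exact: measurable_annulus.
split; [split => //|split; first exact: measurableC|exact: setUv|exact: setICr].
- move=> A mA AP; rewrite lee_fin; apply: (hP2 _ (bI _ mA)).1.
  exact: subset_trans AP.
- move=> A mA AP; rewrite lee_fin; apply: (hP2 _ (bI _ mA)).2.
  exact: subset_trans AP.
Qed.

(** A measure by construction, assembled from the positive parts on the annuli; countable additivity
    of [upper_variation s] is obtained by identifying it with [m]. *)
Let m : {measure set T -> \bar R} := mseries (fun n => jordan_pos (hahnP n)) 0.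

Let mE A : bounded_borel A -> m A = (s (A `&` P))%:E.
Proof.
move=> bA; have [mA _] := bA.
apply: cvg_lim => //; rewrite /series/=.
under eq_fun do (under eq_bigr do rewrite jordan_posE cjordan_posE /crestr0 mem_set//= /crestr).
under eq_fun do rewrite sumEFin.
apply: cvg_EFin; first exact: nearW.
have E : A `&` P = \bigcup_n (A `&` P `&` annulus n).
  by rewrite -setI_bigcupr bigcup_annulus setIT.
rewrite {2}E; apply: hs; last by rewrite -E; exact: bIP.
  move=> n; apply: bounded_borelS (bounded_annulus n) => //.
  by apply: measurableI; [exact: measurableI|exact: measurable_annulus].
apply/trivIsetP => i j _ _ ij; rewrite setIACA.
by move/trivIsetP : (@trivIset_annulus R) => /(_ i j I I ij) ->; rewrite setI0.
Qed.

(** A bounded subset B of A satisfies s B <= m B <= m A. Conversely m A is the limit of m over A cut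
    to [-n, n], and each of these values is taken by s on a bounded subset of A. *)
Let upper_variationE A : measurable A -> upper_variation s A = m A.
Proof.
move=> mA; apply/eqP; rewrite eq_le; apply/andP; split.
  apply: ge_ereal_sup => _ [B [bB BA] <-]; have [mB _] := bB.
  apply: (@le_trans _ _ (m B)); last by apply: le_measure; rewrite ?inE.
  by rewrite mE// lee_fin local_charge_le.
pose D n : set T := `[- n%:R, n%:R]%classic.
have bD n : bounded_borel (A `&` D n).
  apply/bounded_borelP; split; first by apply: measurableI => //; exact: measurable_itv.
  by exists n%:R => x [_]; rewrite /D/= in_itv/= ler_norml.
have AD : A = \bigcup_n (A `&` D n).
  rewrite -setI_bigcupr (_ : \bigcup_n D n = setT) ?setIT//.
  apply/seteqP; split => // x _; exists (Num.truncn `|x : R|).+1 => //.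
  rewrite /D/= in_itv/= -ler_norml ltW//.
  by have /andP[] := truncn_itv (normr_ge0 (x : R)).
have H : m (A `&` D n) @[n --> \oo] --> m A.
  rewrite {2}AD; apply: nondecreasing_cvg_mu.
  - by move=> n; have [] := bD n.
  - by rewrite -AD.
  - apply/nondecreasing_seqP => n; apply/subsetPset; apply: setIS => x.
    rewrite /D/= !in_itv/= -!ler_norml => /le_trans; apply; rewrite ler_nat//.
rewrite -(cvg_lim _ H)//; apply: lime_le; first by apply/cvg_ex; eexists; exact: H.
apply: nearW => n; rewrite mE//; apply: ereal_sup_ubound.
by exists (A `&` D n `&` P) => //; split; [exact: bIP|move=> x [[]]].
Qed.

Let uv0 : upper_variation s set0 = 0%E.
Proof. by rewrite upper_variationE// measure0. Qed.

Let uv_ge0 A : (0 <= upper_variation s A)%E.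
Proof.
apply: ereal_sup_ubound; exists set0; last by rewrite local_charge0.
by split => //; exact: bounded_borel0.
Qed.

Let uv_add : semi_sigma_additive (upper_variation s).
Proof.
move=> F mF tF mU; rewrite upper_variationE//.
under eq_fun do (under eq_bigr do rewrite upper_variationE//).
exact: measure_semi_sigma_additive.
Qed.

Let uv_measure : {measure set T -> \bar R} :=
  HB.pack (upper_variation s) (isMeasure.Build _ T R _ uv0 uv_ge0 uv_add).

Let uv_sigma : sigma_finite setT (upper_variation s).
Proof.
exists (fun n => `[- n%:R, n%:R]%classic) => [|n].
  apply/esym/seteqP; split => // x _; exists (Num.truncn `|x : R|).+1 => //.
  rewrite /= in_itv/= -ler_norml ltW//.
  by have /andP[] := truncn_itv (normr_ge0 (x : R)).
split; first exact: measurable_itv.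
rewrite upper_variation_bounded ?ltry//; apply/bounded_borelP; split; first exact: measurable_itv.
by exists n%:R => x; rewrite /= in_itv/= ler_norml.
Qed.

(** Given as equality with a bundled measure, so that the bare set function in [signed_integral] can
    be replaced by one to which the integration theorems apply. *)
Lemma upper_variation_sigma_finite :
  exists m : {sigma_finite_measure set T -> \bar R}, upper_variation s = m :> (set T -> \bar R).
Proof.
pose m' : {sigma_finite_measure set T -> \bar R} :=
  HB.pack (upper_variation s) (isMeasure.Build _ T R _ uv0 uv_ge0 uv_add)
    (@Measure_isSigmaFinite.Build _ T R uv_measure uv_sigma).
by exists m'.
Qed.

End PositivePart.

End UpperVariation.

(** * Integration against locally finite signed measures *)

Section SignedIntegral.
Context {R : realType}.
Local Notation T := (measurableTypeR R).
Implicit Types (A B D P : set T) (f w : T -> R).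

Lemma local_charge_jordan (s : set T -> R) A : locally_sigma_additive s -> bounded_borel A ->
  [/\ upper_variation s A \is a fin_num,
    upper_variation (fun B => - s B) A \is a fin_num &
    s A = fine (upper_variation s A) - fine (upper_variation (fun B => - s B) A)].
Proof.
move=> hs bA; have [P hP] := local_hahn hs; have [mP _] := hP.
rewrite (upper_variation_bounded hs hP bA).
rewrite (upper_variation_bounded (locally_sigma_additiveN hs) (positive_part_setN hP) bA).
by split => //=; rewrite opprK; exact: local_charge_splitE.
Qed.

Definition symmetric_interval n : set T := `[- n%:R, n%:R]%classic.

Lemma measurable_symmetric_interval n : measurable (symmetric_interval n).
Proof. exact: measurable_itv. Qed.

Lemma bigcup_symmetric_interval : \bigcup_n symmetric_interval n = setT.
Proof.
apply/seteqP; split => // x _; exists (Num.truncn `|x : R|).+1 => //.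
rewrite /symmetric_interval/= in_itv/= -ler_norml ltW//.
by have /andP[] := truncn_itv (normr_ge0 (x : R)).
Qed.

Lemma nondecreasing_symmetric_interval : nondecreasing_seq symmetric_interval.
Proof.
apply/nondecreasing_seqP => n; apply/subsetPset => x.
by rewrite /symmetric_interval/= !in_itv/= -!ler_norml => /le_trans; apply; rewrite ler_nat.
Qed.

Lemma bounded_symmetric_interval A n : measurable A -> bounded_borel (A `&` symmetric_interval n).
Proof.
move=> mA; apply/bounded_borelP; split.
  by apply: measurableI => //; exact: measurable_symmetric_interval.
by exists n%:R => x [_]; rewrite /symmetric_interval/= in_itv/= ler_norml.
Qed.

Lemma eq_measure_bounded (m1 m2 : {measure set T -> \bar R}) :
  (forall A, bounded_borel A -> m1 A = m2 A) -> forall A, measurable A -> m1 A = m2 A.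
Proof.
move=> m12 A mA.
have AD : A = \bigcup_n (A `&` symmetric_interval n).
  by rewrite -setI_bigcupr bigcup_symmetric_interval setIT.
have H (m : {measure set T -> \bar R}) :
    m (A `&` symmetric_interval n) @[n --> \oo] --> m A.
  rewrite {2}AD; apply: nondecreasing_cvg_mu; last 2 first.
  - by rewrite -AD.
  - move=> i j ij; apply/subsetPset; apply: setIS; apply/subsetPset.
    exact: nondecreasing_symmetric_interval.
  by move=> n; have [] := bounded_symmetric_interval n mA.
apply: (cvg_unique _ (H m1)) => //.
rewrite (_ : (fun n => _) = fun n => m2 (A `&` symmetric_interval n)); first exact: H.
by apply/funext => n; apply: m12; exact: bounded_symmetric_interval.
Qed.

Lemma le_measure_integrable (m1 m2 : {measure set T -> \bar R}) D f : measurable D ->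
  (forall A, measurable A -> (m1 A <= m2 A)%E) ->
  m2.-integrable D (EFin \o f) -> m1.-integrable D (EFin \o f).
Proof.
move=> mD m12 i2; apply/integrable_mkcond => //; move/integrable_mkcond : i2 => /(_ mD) i2.
have mf := measurable_int _ i2.
have /integrableP[_ fin] := i2; apply/integrableP; split => //.
apply: le_lt_trans fin; apply: ge0_le_measure_integral => //.
exact: measurableT_comp.
Qed.

(** Minimality of the Jordan decomposition: for a bounded B inside A, s B = p B - q B <= p B <= p
    A. *)
Lemma upper_variation_le (s : set T -> R) (p q : {measure set T -> \bar R}) A :
  (forall A, bounded_borel A -> p A \is a fin_num /\ q A \is a fin_num) ->
  (forall A, bounded_borel A -> s A = fine (p A) - fine (q A)) ->
  measurable A -> (upper_variation s A <= p A)%E.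
Proof.
move=> fin_pq spq mA; apply: ge_ereal_sup => _ [B [bB BA] <-].
have [mB _] := bB; have [pB qB] := fin_pq _ bB.
apply: (@le_trans _ _ (p B)); last by apply: le_measure; rewrite ?inE.
by rewrite -(fineK pB) lee_fin spq// lerBlDr lerDl fine_ge0.
Qed.

Lemma variation_measures (s : set T -> R) : locally_sigma_additive s ->
  exists m1 m2 : {sigma_finite_measure set T -> \bar R},
    upper_variation s = m1 :> (set T -> \bar R) /\
    upper_variation (fun A => - s A) = m2 :> (set T -> \bar R).
Proof.
move=> hs; have [P hP] := local_hahn hs.
have [m1 E1] := upper_variation_sigma_finite hs hP.
have [m2 E2] := upper_variation_sigma_finite (locally_sigma_additiveN hs) (positive_part_setN hP).
by exists m1, m2.
Qed.

Lemma signed_integralE (s : set T -> R) (m1 m2 : {measure set T -> \bar R}) D f :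
  upper_variation s = m1 :> (set T -> \bar R) ->
  upper_variation (fun A => - s A) = m2 :> (set T -> \bar R) ->
  signed_integral s D f = \int[m1]_(x in D) f x - \int[m2]_(x in D) f x.
Proof. by rewrite /signed_integral => -> ->. Qed.

(** Integrability passes from [p] and [q] to the Jordan parts by minimality. This gives linearity in
    the measure, which the definition through variations does not provide. *)
Lemma signed_integral_diff (s : set T -> R) (p q : {measure set T -> \bar R}) D f :
  locally_sigma_additive s ->
  (forall A, bounded_borel A -> p A \is a fin_num /\ q A \is a fin_num) ->
  (forall A, bounded_borel A -> s A = fine (p A) - fine (q A)) ->
  measurable D -> p.-integrable D (EFin \o f) -> q.-integrable D (EFin \o f) ->
  signed_integral s D f = \int[p]_(x in D) f x - \int[q]_(x in D) f x.
Proof.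
move=> hs fin_pq spq mD ip iq.
have [m1 [m2 [E1 E2]]] := variation_measures hs.
have le1 A : measurable A -> (m1 A <= p A)%E.
  by move=> mA; rewrite -E1; exact: (upper_variation_le fin_pq spq).
have le2 A : measurable A -> (m2 A <= q A)%E.
  move=> mA; rewrite -E2; apply: (@upper_variation_le _ q p) => // B bB.
    by have [] := fin_pq _ bB.
  by rewrite spq// opprB.
have i1 := le_measure_integrable mD le1 ip.
have i2 := le_measure_integrable mD le2 iq.
(* The identity [p - q = m1 - m2] moved to sums, as all four may be infinite. *)
have eqm A : measurable A -> measure_add m1 q A = measure_add p m2 A.
  apply: eq_measure_bounded => B bB; have [pB qB] := fin_pq _ bB.
  have [f1 f2] := local_charge_jordan hs bB; rewrite E1 E2 in f1 f2 *.
  rewrite spq// => /eqP; rewrite subr_eq addrAC eq_sym subr_eq => /eqP H.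
  transitivity (m1 B + q B)%E; first exact: measure_addE.
  transitivity (p B + m2 B)%E; last by rewrite [RHS]measure_addE.
  rewrite -(fineK f1) -(fineK f2) -(fineK pB) -(fineK qB) -!EFinD.
  by congr (_%:E); rewrite H.
have mf := measurable_int _ ip.
have := @eq_measure_integral _ _ _ D (measure_add p m2) (measure_add m1 q) (EFin \o f)
  (fun A mA _ => eqm A mA).
rewrite !integral_measure_add// => /(congr1 fine).
have n1 := integrable_fin_num mD i1; have n2 := integrable_fin_num mD i2.
have np := integrable_fin_num mD ip; have nq := integrable_fin_num mD iq.
rewrite (fineD n1 nq) (fineD np n2) => H.
rewrite (signed_integralE _ _ E1 E2) /Rintegral; move: H; rewrite /comp; lra.
Qed.

Lemma Rintegral_mscale_dirac (c : {nonneg R}) D f : measurable D -> D 0 -> measurable_fun D f ->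
  (mscale c (dirac (0 : T))).-integrable D (EFin \o f) /\
  \int[mscale c (dirac (0 : T))]_(x in D) f x = c%:num * f 0.
Proof.
move=> mD D0 mf.
have mEf : measurable_fun D (EFin \o f) by exact/measurable_EFinP.
have pos (g : T -> \bar R) : measurable_fun D g -> (forall x, D x -> (0 <= g x)%E) ->
    (\int[mscale c (dirac (0%R : T))]_(x in D) g x = c%:num%:E * g (0%R : T))%E.
  by move=> mg g0; rewrite ge0_integral_mscale// integral_dirac//= diracE mem_set// mul1e.
split.
  apply/integrableP; split => //; rewrite pos//; last exact: measurableT_comp.
  by rewrite /= -EFinM ltry.
rewrite /Rintegral integralE !pos//.
- rewrite funepos.unlock funeneg.unlock /= -!EFin_max -!EFinM /= -mulrBr; congr (_ * _).
  by rewrite /Num.max; case: ltP => h1; case: ltP => h2; move: h1 h2; lra.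
- exact: measurable_funeneg.
- exact: measurable_funepos.
Qed.

(** The Jordan parts of the modified measure are not computed. Instead the negative part of [a] is
    added as a point mass to [m1] and its positive part to [m2], and [signed_integral_diff] accepts
    this representation. *)
Lemma signed_integral_sub_dirac (s : set T -> R) (a : R) (m1 m2 : {measure set T -> \bar R}) D f :
  locally_sigma_additive s ->
  upper_variation s = m1 :> (set T -> \bar R) ->
  upper_variation (fun A => - s A) = m2 :> (set T -> \bar R) ->
  measurable D -> D 0 -> m1.-integrable D (EFin \o f) -> m2.-integrable D (EFin \o f) ->
  locally_sigma_additive (fun A => s A - a * \1_A (0 : R)) ->
  signed_integral (fun A => s A - a * \1_A (0 : R)) D f = signed_integral s D f - a * f 0.
Proof.
move=> hs E1 E2 mD D0 i1 i2 hs'.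
have a1 : 0 <= Num.max a 0 by rewrite le_max lexx orbT.
have a2 : 0 <= Num.max (- a) 0 by rewrite le_max lexx orbT.
have aE : a = Num.max a 0 - Num.max (- a) 0.
  have [h|/ltW h] := leP a 0.
    by rewrite (@max_l _ _ (- a)) ?oppr_ge0// sub0r opprK.
  by rewrite (@max_r _ _ (- a)) ?oppr_le0// subr0.
have mf : measurable_fun D f by apply/measurable_EFinP; exact: (measurable_int _ i1).
have [j1 J1] := Rintegral_mscale_dirac (NngNum a2) mD D0 mf.
have [j2 J2] := Rintegral_mscale_dirac (NngNum a1) mD D0 mf.
pose d1 : {measure set T -> \bar R} := mscale (NngNum a2) (dirac (0 : T)).
pose d2 : {measure set T -> \bar R} := mscale (NngNum a1) (dirac (0 : T)).
have d1E A : d1 A = (Num.max (- a) 0 * \1_A (0 : R))%:E by rewrite /d1/= /mscale/= diracE indicE EFinM.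
have d2E A : d2 A = (Num.max a 0 * \1_A (0 : R))%:E by rewrite /d2/= /mscale/= diracE indicE EFinM.
have addE (u v : {measure set T -> \bar R}) A : measure_add u v A = (u A + v A)%E by exact: measure_addE.
have addI (u v : {measure set T -> \bar R}) : u.-integrable D (EFin \o f) -> v.-integrable D (EFin \o f) ->
    (measure_add u v).-integrable D (EFin \o f) /\
    \int[measure_add u v]_(x in D) f x = \int[u]_(x in D) f x + \int[v]_(x in D) f x.
  move=> iu iv; have mEf := measurable_int _ iu; split; last first.
    rewrite /Rintegral (integral_measure_add mD iu iv).
    exact: fineD (integrable_fin_num mD iu) (integrable_fin_num mD iv).
  apply/integrableP; split => //; rewrite ge0_integral_measure_add//; last exact: measurableT_comp.
  by rewrite lte_add_pinfty//; [have /integrableP[] := iu|have /integrableP[] := iv].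
have [k1 K1] := addI m1 d1 i1 j1; have [k2 K2] := addI m2 d2 i2 j2.
rewrite (@signed_integral_diff _ (measure_add m1 d1) (measure_add m2 d2))//.
- rewrite K1 K2 J1 J2 (signed_integralE _ _ E1 E2) /= {3}aE; ring.
- move=> A bA; have [f1 f2 _] := local_charge_jordan hs bA; rewrite E1 E2 in f1 f2.
  split.
    by rewrite [X in X \is a fin_num](_ : _ = (m1 A + d1 A)%E) ?d1E ?fin_numD ?f1//; exact: addE.
  by rewrite [X in X \is a fin_num](_ : _ = (m2 A + d2 A)%E) ?d2E ?fin_numD ?f2//; exact: addE.
- move=> A bA; have [f1 f2 sE] := local_charge_jordan hs bA; rewrite E1 E2 in f1 f2 sE.
  rewrite [X in fine X - _](_ : _ = (m1 A + d1 A)%E); last exact: addE.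
  rewrite [X in _ - fine X](_ : _ = (m2 A + d2 A)%E); last exact: addE.
  rewrite d1E d2E (fineD f1)// (fineD f2)//= sE {1}aE; ring.
Qed.

(** The uniform bound is tested on the part in P of [-n, n], and monotone convergence in n extends
    it to the whole line. *)
Lemma weight_integrable (s : set T -> R) (m1 m2 : {measure set T -> \bar R}) w (C : R) :
  locally_sigma_additive s ->
  upper_variation s = m1 :> (set T -> \bar R) ->
  upper_variation (fun A => - s A) = m2 :> (set T -> \bar R) ->
  measurable_fun setT w -> (forall x, 0 <= w x <= 1) ->
  (forall A, bounded_borel A -> `|signed_integral s A w| <= C) ->
  m1.-integrable setT (EFin \o w).
Proof.
move=> hs E1 E2 mw w01 wC; have [P hP] := local_hahn hs; have [mP _] := hP.
have w0 x : 0 <= w x by have /andP[] := w01 x.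
have mwE D : measurable_fun D (EFin \o w) by apply/measurable_EFinP; exact: measurable_funTS.
have key n : (\int[m1]_(x in symmetric_interval n) (w x)%:E <= C%:E)%E.
  pose A := symmetric_interval n.
  have bA : bounded_borel A by rewrite -[A]setTI; exact: bounded_symmetric_interval.
  have [mA _] := bA.
  have mAP : measurable (A `&` P) by exact: measurableI.
  have mAN : measurable (A `&` ~` P) by apply: measurableI => //; exact: measurableC.
  have bAP : bounded_borel (A `&` P) by apply: bounded_borelS bA.
  have bAN : bounded_borel (A `&` ~` P) by apply: bounded_borelS bA.
  have s0 := local_charge0 hs.
  have z1 : m1 (A `&` ~` P) = 0%E.
    by rewrite -E1 (upper_variation_bounded hs hP bAN) -setIA setICl setI0 s0.
  have z2 : m2 (A `&` P) = 0%E.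
    rewrite -E2 (upper_variation_bounded (locally_sigma_additiveN hs) (positive_part_setN hP) bAP).
    by rewrite -setIA setICr setI0 s0 oppr0.
  (* On the positive set [P] the signed integral is the [m1]-integral alone. *)
  have := wC _ bAP; rewrite (signed_integralE _ _ E1 E2) /Rintegral.
  rewrite (null_set_integral mAP (mwE _) z2)/= subr0.
  (* [fine] sends an infinite integral to 0, so the bound says something only once finiteness is
     known; on a bounded set it follows from w <= 1. *)
  have fin : (\int[m1]_(x in A `&` P) (w x)%:E)%E \is a fin_num.
    rewrite ge0_fin_numE; last by apply: integral_ge0 => x _; rewrite lee_fin.
    apply: (@le_lt_trans _ _ (\int[m1]_(x in A `&` P) 1%:E)%E).
      by apply: ge0_le_integral => // x _; rewrite lee_fin; have /andP[] := w01 x.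
    rewrite integral_cst// mul1e -E1 (upper_variation_bounded hs hP bAP) ltry//.
  move=> HC; rewrite -/A (_ : A = (A `&` P) `|` (A `&` ~` P)); last by rewrite -setIUr setUv setIT.
  rewrite ge0_integral_setU//; last 2 first.
  - by move=> x _; rewrite lee_fin.
  - by apply/disj_set2P; rewrite setIACA setICr setI0.
  rewrite (null_set_integral mAN (mwE _) z1) adde0 -(fineK fin) lee_fin.
  exact: le_trans (ler_norm _) HC.
apply/integrableP; split => //.
rewrite (_ : (\int[_]_(_ in _) _)%E = (\int[m1]_(x in setT) (w x)%:E)%E); last first.
  by apply: eq_integral => x _; rewrite /= ger0_norm.
apply: (@le_lt_trans _ _ C%:E); last exact: ltry.
rewrite -bigcup_symmetric_interval.
have H := @ge0_nondecreasing_set_cvg_integral _ _ _ symmetric_interval (EFin \o w) m1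
  nondecreasing_symmetric_interval measurable_symmetric_interval (fun i => mwE _) (fun i x _ => w0 x).
rewrite -(cvg_lim _ H)//; apply: lime_le; first by apply/cvg_ex; eexists; exact: H.
by apply: nearW => n; exact: key.
Qed.


End SignedIntegral.

(** * Complex measures *)

Section ComplexMeasure.
Context {R : realType}.
Local Notation T := (measurableTypeR R).
Implicit Types (A B D : set T) (mu : set T -> R[i]).

Lemma cvg_ReIm (u : nat -> R[i]) (l : R[i]) : u n @[n --> \oo] --> (l : R[i]^o) ->
  complex.Re (u n) @[n --> \oo] --> complex.Re l /\
  complex.Im (u n) @[n --> \oo] --> complex.Im l.
Proof.
move=> ul; have H := proj1 (@cvgrPdist_lt R[i] R[i]^o _ (\oo : set_system nat) _ u l) ul.
have small (e : R) : 0 < e -> \forall n \near \oo, normc (l - u n) < e.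
  move=> e0; have := H eventually_filter e%:C; rewrite ltcR => /(_ e0); apply: filterS => n.
  by rewrite normr_normc ltcR.
split; apply/cvgrPdist_lt => e e0; apply: filterS (small _ e0) => n; apply: le_lt_trans.
  by rewrite -Re_oppc -Re_addc; exact: normc_Re.
by rewrite -Im_oppc -Im_addc; exact: normc_Im.
Qed.

Lemma countably_additive_ReIm (E : set (set T)) mu : countably_additive_on E mu ->
  forall F : nat -> set T, (forall n, E (F n)) -> trivIset setT F -> E (\bigcup_n F n) ->
  (fun n => \sum_(0 <= i < n) complex.Re (mu (F i))) @ \oo --> complex.Re (mu (\bigcup_n F n)) /\
  (fun n => \sum_(0 <= i < n) complex.Im (mu (F i))) @ \oo --> complex.Im (mu (\bigcup_n F n)).
Proof.
move=> hE F EF tF EU; have [H1 H2] := cvg_ReIm (hE F EF tF EU); split.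
  rewrite (_ : (fun _ => _) = fun n => complex.Re (\sum_(0 <= i < n) mu (F i)))//.
  by apply/funext => n; rewrite (big_morph _ (@Re_addc R) erefl).
rewrite (_ : (fun _ => _) = fun n => complex.Im (\sum_(0 <= i < n) mu (F i)))//.
by apply/funext => n; rewrite (big_morph _ (@Im_addc R) erefl).
Qed.

(** A finite charge has Jordan parts of finite total mass, and their sum bounds it on every Borel
    set. Applied to the parts of [mu1], this makes the bound over bounded sets uniform. *)
Lemma sigma_additive_bounded (t : set T -> R) :
  (forall F : nat -> set T, (forall n, measurable (F n)) -> trivIset setT F ->
    (fun n => \sum_(0 <= i < n) t (F i)) @ \oo --> t (\bigcup_n F n)) ->
  exists C, forall A, measurable A -> `|t A| <= C.
Proof.
move=> ht; have lt : locally_sigma_additive t.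
  by move=> F bF tF _; apply: ht => // n; have [] := bF n.
pose nu A : \bar R := (t A)%:E.
have nu0 : nu set0 = 0%E by rewrite /nu local_charge0.
have nufin A : measurable A -> nu A \is a fin_num by [].
have nuadd : semi_sigma_additive nu.
  move=> F mF tF mU; rewrite /nu; under eq_fun do rewrite sumEFin.
  by apply: cvg_EFin; [exact: nearW|exact: ht].
pose c : {charge set T -> \bar R} := HB.pack nu (isCharge.Build _ T R nu nu0 nufin nuadd).
have [P [N PN]] := Hahn_decomposition c.
exists (fine (jordan_pos PN setT) + fine (jordan_neg PN setT)) => A mA.
have pA : jordan_pos PN A \is a fin_num by exact: fin_num_measure.
have nA : jordan_neg PN A \is a fin_num by exact: fin_num_measure.
have pT : jordan_pos PN setT \is a fin_num by exact: fin_num_measure.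
have nT : jordan_neg PN setT \is a fin_num by exact: fin_num_measure.
have H : t A = fine (jordan_pos PN A) - fine (jordan_neg PN A).
  have := jordan_decomp PN mA; rewrite /cadd /= /cscale EFinN mulN1e.
  by move/(congr1 fine) => /= ->; rewrite fineB.
have hp : fine (jordan_pos PN A) <= fine (jordan_pos PN setT).
  by apply: fine_le => //; apply: le_measure; rewrite ?inE.
have hn : fine (jordan_neg PN A) <= fine (jordan_neg PN setT).
  by apply: fine_le => //; apply: le_measure; rewrite ?inE.
by rewrite H (le_trans (ler_normB _ _))// !ger0_norm ?fine_ge0// lerD.
Qed.

Lemma signed_integral0 (s : set T -> R) D : locally_sigma_additive s ->
  signed_integral s D (fun _ => 0) = 0.
Proof.
move=> hs; have [m1 [m2 [E1 E2]]] := variation_measures hs.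
by rewrite (signed_integralE _ _ E1 E2) /Rintegral !integral0 subrr.
Qed.

Variables (k : nat) (mu : set T -> R[i]).
Hypothesis hmu : class_M k mu.

Let sRe A := complex.Re (mu A).
Let sIm A := complex.Im (mu A).

Lemma class_M_ReIm : locally_sigma_additive sRe /\ locally_sigma_additive sIm.
Proof.
have [lmu _] := hmu; split=> F bF tF bU; have [H1 H2] := countably_additive_ReIm lmu bF tF bU.
  exact: H1.
exact: H2.
Qed.

Let w (x : T) : R := (1 + `|x : R| ^+ k)^-1.

Lemma class_M_weight (m1 m2 m3 m4 : {measure set T -> \bar R}) :
  upper_variation sRe = m1 :> (set T -> \bar R) ->
  upper_variation (fun A => - sRe A) = m2 :> (set T -> \bar R) ->
  upper_variation sIm = m3 :> (set T -> \bar R) ->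
  upper_variation (fun A => - sIm A) = m4 :> (set T -> \bar R) ->
  [/\ m1.-integrable setT (EFin \o w), m2.-integrable setT (EFin \o w),
      m3.-integrable setT (EFin \o w) & m4.-integrable setT (EFin \o w)].
Proof.
move=> E1 E2 E3 E4; have [hRe hIm] := class_M_ReIm.
have [_ [mu1 [fmu1 mu1E]]] := hmu.
have mw : measurable_fun setT w.
  apply: measurable_funV => //; apply: measurable_funD.
    exact: measurable_cst.
  by apply: measurable_funX; exact: normr_measurable.
have w01 x : 0 <= w x <= 1.
  have h : 1 <= 1 + `|x : R| ^+ k by rewrite lerDl exprn_ge0.
  by rewrite /w invr_ge0 (le_trans _ h)//= invf_le1// (lt_le_trans _ h).
have ReImE A : bounded_borel A -> complex.Re (mu1 A) = signed_integral sRe A w /\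
    complex.Im (mu1 A) = signed_integral sIm A w.
  move=> bA; rewrite mu1E// /complex_integral /=.
  rewrite (signed_integral0 _ hRe) (signed_integral0 _ hIm) subr0 add0r.
  by split.
have [C1 HC1] : exists C, forall A, measurable A -> `|complex.Re (mu1 A)| <= C.
  apply: sigma_additive_bounded => F mF tF.
  by have [] := countably_additive_ReIm fmu1 mF tF (bigcup_measurable (fun n _ => mF n)).
have [C2 HC2] : exists C, forall A, measurable A -> `|complex.Im (mu1 A)| <= C.
  apply: sigma_additive_bounded => F mF tF.
  by have [] := countably_additive_ReIm fmu1 mF tF (bigcup_measurable (fun n _ => mF n)).
have b1 A : bounded_borel A -> `|signed_integral sRe A w| <= C1.
  by move=> bA; have [<- _] := ReImE _ bA; apply: HC1; have [] := bA.
have b2 A : bounded_borel A -> `|signed_integral sIm A w| <= C2.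
  by move=> bA; have [_ <-] := ReImE _ bA; apply: HC2; have [] := bA.
(* The negative variations are handled as the positive ones of - s, whose own negative variation is
   that of - - s. *)
have NN (s : set T -> R) : (fun A => - - s A) = s by apply/funext => A; rewrite opprK.
have sN (s : set T -> R) A : signed_integral (fun A => - s A) A w = - signed_integral s A w.
  by rewrite /signed_integral NN opprB.
split.
- exact: (weight_integrable hRe E1 E2 mw w01 b1).
- apply: (weight_integrable (locally_sigma_additiveN hRe) E2 (m2 := m1) _ mw w01 (C := C1)); first by rewrite NN.
  by move=> A bA; rewrite sN normrN b1.
- exact: (weight_integrable hIm E3 E4 mw w01 b2).
- apply: (weight_integrable (locally_sigma_additiveN hIm) E4 (m2 := m3) _ mw w01 (C := C2)); first by rewrite NN.
  by move=> A bA; rewrite sN normrN b2.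
Qed.

Section Variations.
Variables (m1 m2 m3 m4 : {sigma_finite_measure set T -> \bar R}).
Hypothesis E1 : upper_variation sRe = m1 :> (set T -> \bar R).
Hypothesis E2 : upper_variation (fun A => - sRe A) = m2 :> (set T -> \bar R).
Hypothesis E3 : upper_variation sIm = m3 :> (set T -> \bar R).
Hypothesis E4 : upper_variation (fun A => - sIm A) = m4 :> (set T -> \bar R).

Lemma complex_integralE D f : complex_integral mu D f =
  (cintegral m1 D f - cintegral m2 D f) + 'i * (cintegral m3 D f - cintegral m4 D f).
Proof.
apply: complex_ext; rewrite /complex_integral /= (signed_integralE _ _ E1 E2)
  (signed_integralE _ _ E3 E4) /=; ring.
Qed.

Lemma class_M_atom : [/\ m1 [set 0] \is a fin_num, m2 [set 0] \is a fin_num,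
  m3 [set 0] \is a fin_num, m4 [set 0] \is a fin_num & mu [set 0] =
  ((fine (m1 [set 0]))%:C - (fine (m2 [set 0]))%:C) +
  'i * ((fine (m3 [set 0]))%:C - (fine (m4 [set 0]))%:C)].
Proof.
have [hRe hIm] := class_M_ReIm.
have b0 : bounded_borel ([set 0] : set T).
  by apply/bounded_borelP; split; [exact: measurable_set1|exists 0 => x ->; rewrite normr0].
have [f1 f2 H1] := local_charge_jordan hRe b0; have [f3 f4 H2] := local_charge_jordan hIm b0.
rewrite E1 E2 in f1 f2 H1; rewrite E3 E4 in f3 f4 H2; split => //.
apply: complex_ext; rewrite /= -/(sRe _) -/(sIm _) ?H1 ?H2; ring.
Qed.

(** The complex mass of the half atom contributes a real point mass to each of the real and
    imaginary parts; both are removed by [signed_integral_sub_dirac]. *)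
Lemma complex_integral_half_atom D f : measurable D -> D 0 ->
  cintegrable m1 D f -> cintegrable m2 D f -> cintegrable m3 D f -> cintegrable m4 D f ->
  complex_integral (half_atom_removed mu) D f =
    complex_integral mu D f - 2^-1 * mu [set 0] * f 0.
Proof.
move=> mD D0 [i1 j1] [i2 j2] [i3 j3] [i4 j4]; have [hRe hIm] := class_M_ReIm.
pose a1 := complex.Re (2^-1 * mu [set 0]); pose a2 := complex.Im (2^-1 * mu [set 0]).
have R1 : (fun A => complex.Re (half_atom_removed mu A)) = fun A => sRe A - a1 * \1_A (0 : R).
  by apply/funext => A; rewrite /half_atom_removed Re_addc Re_oppc Re_mulc /= mulr0 subr0.
have R2 : (fun A => complex.Im (half_atom_removed mu A)) = fun A => sIm A - a2 * \1_A (0 : R).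
  by apply/funext => A; rewrite /half_atom_removed Im_addc Im_oppc Im_mulc /= mulr0 add0r.
have hd (s : set T -> R) a : locally_sigma_additive s ->
    locally_sigma_additive (fun A => s A - a * \1_A (0 : R)).
  move=> hs F bF tF bU; under eq_fun do rewrite sumrB -mulr_sumr.
  apply: cvgB; first exact: hs.
  apply: cvgM; first exact: cvg_cst.
  have := @measure_semi_sigma_additive _ _ _ (dirac (0 : T) : {measure set T -> \bar R}) F
    (fun n => (bF n).1) tF (bU.1).
  under eq_fun do (under eq_bigr do rewrite /dirac); under eq_fun do rewrite sumEFin.
  by move/fine_cvg.
rewrite /complex_integral R1 R2.
rewrite !(signed_integral_sub_dirac hRe E1 E2 mD D0 _ _ (hd _ _ hRe))//.
rewrite !(signed_integral_sub_dirac hIm E3 E4 mD D0 _ _ (hd _ _ hIm))//.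
apply: complex_ext.
  rewrite [RHS]Re_addc Re_oppc [in RHS]Re_mulc -/a1 -/a2 /=; ring.
rewrite [RHS]Im_addc Im_oppc [in RHS]Im_mulc -/a1 -/a2 /=; ring.
Qed.

End Variations.

End ComplexMeasure.

(** * Assembling the inversion formula *)

Section Inversion.
Context {R : realType}.
Local Notation T := (measurableTypeR R).
Local Notation leb := (@lebesgue_measure R).

Lemma carleman_kernel_half_line (z : R[i]) (x : R) : complex.Im z != 0 ->
  let D : set T := if 0 < complex.Im z then `[0, +oo[%classic else `]-oo, 0]%classic in
  let s : R[i] := if 0 < complex.Im z then 1 else -1 in
  (D x -> carleman_kernel z x = s * (cexp ('i * x%:C * z) - 2^-1 * (\1_[set (0:R)] x)%:C)) /\
  (~ D x -> carleman_kernel z x = 0).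
Proof.
move=> zn0; rewrite /carleman_kernel indicE in_set1 /=.
have half : 2^-1 = 1 - 2^-1 * 1 :> R[i] by field.
by case: ifPn => _ /=; rewrite in_itv /= ?andbT; have [x0|x0|->] := ltgtP (x : R) 0; split => //;
  rewrite ?mulr0 ?subr0 ?mul1r ?mulN1r ?mul0r ?cexp0 ?eqxx -?half.
Qed.

(** The two factors 1 / sqrt(2 pi) cancel the 2 pi of the limit, k! cancels 1 / k!, and - i^2 = 1.
    Stated over an abstract field so that the complex unit and the square root are opaque to
    [field]. *)
Lemma inversion_constant (F : numFieldType) (i n u p l1 l2 l3 l4 : F) :
  i * i = -1 -> n != 0 -> u != 0 -> u * u = 2 * p ->
  let c := n^-1 * (- 2 * i * p) in
  i * n / u * (u^-1 * ((c * l1 - c * l2) + i * (c * l3 - c * l4))) = (l1 - l2) + i * (l3 - l4).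
Proof.
move=> ii n0 u0 uu c; have pE : p = u * u / 2 by rewrite uu mulrC mulKf.
transitivity (- (i * i) * ((l1 - l2) + i * (l3 - l4))); last by rewrite ii opprK mul1r.
by rewrite /c pE; field; rewrite n0 u0.
Qed.

End Inversion.

Theorem mainTheorem12 (R : realType) (k : nat)
    (mu : set (measurableTypeR R) -> R[i]) (z : R[i])
    (hmu : class_M k mu) (hz : complex.Im z != 0) :
  exists I : R[i],
    is_VP_integral
      (fun l : R => bochner_transform mu k l / (l%:C + z) ^+ k.+1) I /\
    'i%C * (k`!)%:R / (Num.sqrt (2 * pi))%:C * I = carleman_transform mu z.
Proof.
have [hRe hIm] := class_M_ReIm hmu.
have [m1 [m2 [E1 E2]]] := variation_measures hRe.
have [m3 [m4 [E3 E4]]] := variation_measures hIm.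
have [w1 w2 w3 w4] := class_M_weight hmu E1 E2 E3 E4.
have [a1 a2 a3 a4 a0] := class_M_atom hmu E1 E2 E3 E4.
pose L (m : {sigma_finite_measure set (measurableTypeR R) -> \bar R}) :=
  cintegral m setT (carleman_kernel z : measurableTypeR R -> R[i]).
pose q (m : {sigma_finite_measure set (measurableTypeR R) -> \bar R}) (l : measurableTypeR R) : R[i] :=
  cintegral m setT (fun x : measurableTypeR R => bochner_kernel k x l) / (l%:C + z) ^+ k.+1.
pose c : R[i] := (k`!%:R)^-1 * (- 2 * 'i * pi%:C).
pose r : R[i] := ((Num.sqrt (2 * pi))^-1)%:C.
have qE l : bochner_transform mu k l / (l%:C + z) ^+ k.+1 =
    r * ((q m1 l - q m2 l) + 'i * (q m3 l - q m4 l)).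
  rewrite /bochner_transform (complex_integralE E1 E2 E3 E4) -/r /q; ring.
have ci (m : {sigma_finite_measure set (measurableTypeR R) -> \bar R}) N :
    m.-integrable setT (EFin \o (fun x : measurableTypeR R => (1 + `|x : R| ^+ k)^-1)) ->
    cintegrable lebesgue_measure (`[- N, N]%classic : set (measurableTypeR R)) (q m).
  by move=> wm; exact: cintegrable_bochner_quotient.
have cv (m : {sigma_finite_measure set (measurableTypeR R) -> \bar R}) :
    m.-integrable setT (EFin \o (fun x : measurableTypeR R => (1 + `|x : R| ^+ k)^-1)) ->
    ccvgy (fun N => cintegral lebesgue_measure (`[- N, N]%classic : set (measurableTypeR R)) (q m)) (c * L m).
  by move=> wm; exact: cvg_bochner_quotient.
exists (r * ((c * L m1 - c * L m2) + 'i * (c * L m3 - c * L m4))); split.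
  apply/ccvgy_cvg/(ccvgy_near (f := fun N =>
    r * ((cintegral lebesgue_measure (`[- N, N]%classic : set (measurableTypeR R)) (q m1) - cintegral lebesgue_measure (`[- N, N]%classic : set (measurableTypeR R)) (q m2))
    + 'i * (cintegral lebesgue_measure (`[- N, N]%classic : set (measurableTypeR R)) (q m3) - cintegral lebesgue_measure (`[- N, N]%classic : set (measurableTypeR R)) (q m4))))).
    (* [lebesgue_cintegral] is convertible to [cintegral]. Splitting it over the four Jordan
       components needs each quotient to be integrable on [-N, N], which Fubini supplied. *)
    apply: nearW => N; rewrite -[RHS]/(cintegral lebesgue_measure (`[- N, N]%classic : set (measurableTypeR R)) _).
    under [RHS]eq_cintegral do rewrite qE.
    have mI : measurable (`[- N, N]%classic : set (measurableTypeR R)) by exact: measurable_itv.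
    rewrite cintegralZ//; last first.
      by apply: cintegrableD => //; [|apply: cintegrableZ => //]; apply: cintegrableB => //; exact: ci.
    rewrite cintegralD//; first last.
    - by apply: cintegrableZ => //; apply: cintegrableB => //; exact: ci.
    - by apply: cintegrableB => //; exact: ci.
    rewrite cintegralZ//; last by apply: cintegrableB => //; exact: ci.
    by rewrite !cintegralB//; exact: ci.
  by apply: ccvgyZ; apply: ccvgyD; [|apply: ccvgyZ]; apply: ccvgyB; exact: cv.
have sq : (Num.sqrt (2 * pi) : R)%:C * (Num.sqrt (2 * pi) : R)%:C = 2 * (pi : R)%:C.
  rewrite -rmorphM -expr2 sqr_sqrtr ?mulr_ge0 ?pi_ge0// rmorphM.
  by congr (_ * _); rewrite rmorph_nat.
have sn0 : (Num.sqrt (2 * pi) : R)%:C != 0.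
  by rewrite -(rmorph0 (real_complex R)) (inj_eq (@complexI R)) sqrtr_eq0 -ltNge mulr_gt0 ?pi_gt0.
have ii : 'i%C * 'i%C = -1 :> R[i] by rewrite -expr2 sqr_i.
have n0 : k`!%:R != 0 :> R[i] by rewrite pnatr_eq0 -lt0n fact_gt0.
rewrite /r (fmorphV (real_complex R)) /c (inversion_constant _ _ _ _ ii n0 sn0 sq).
have H x := carleman_kernel_half_line x hz.
rewrite /carleman_transform.
pose g (t : measurableTypeR R) := cexp ('i%C * t%:C * z).
have g0 : g 0 = 1 by rewrite /g mulr0 mul0r cexp0.
(* Both half-planes are instances of one statement, with [s] the sign in front of the integral in
   [carleman_transform]. *)
suff K (D : set (measurableTypeR R)) (s : R[i]) : measurable D -> D 0 -> s * s = 1 ->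
    (forall x, D x -> carleman_kernel z x = s * (cexp ('i * x%:C * z) - 2^-1 * (\1_[set (0:R)] x)%:C)) ->
    (forall x, ~ D x -> carleman_kernel z x = 0) ->
    (L m1 - L m2) + 'i * (L m3 - L m4) = s * complex_integral (half_atom_removed mu) D g.
  case: ifPn H => z0 H.
    rewrite -[RHS]mul1r; apply: (K `[0, +oo[%classic 1) => //=.
    - by rewrite in_itv /= lexx.
    - by rewrite mulr1.
    - by move=> x; have [] := H x.
    - by move=> x; have [] := H x.
  rewrite -[RHS]mulN1r; apply: (K `]-oo, 0]%classic (-1)) => //=.
  - by rewrite in_itv /= lexx.
  - by rewrite mulN1r opprK.
  - by move=> x; have [] := H x.
  - by move=> x; have [] := H x.
move=> mD D0 ss HD HnD.
have s0 : s != 0.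
  by apply/eqP => s0; move: ss; rewrite s0 mul0r => /eqP; rewrite eq_sym oner_eq0.
have [i1 e1] := cintegral_carleman_kernel hz w1 mD D0 a1 s0 HD HnD.
have [i2 e2] := cintegral_carleman_kernel hz w2 mD D0 a2 s0 HD HnD.
have [i3 e3] := cintegral_carleman_kernel hz w3 mD D0 a3 s0 HD HnD.
have [i4 e4] := cintegral_carleman_kernel hz w4 mD D0 a4 s0 HD HnD.
rewrite (complex_integral_half_atom hmu E1 E2 E3 E4)// (complex_integralE E1 E2 E3 E4) g0 a0.
rewrite /L e1 e2 e3 e4 -/g; ring.
Qed.
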